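(* Let $1\le d\le\sqrt2$ and let $L\subset\mathbb{R}^3$ be the union of a string of closed unit balls in $\mathbb{R}^3$ whose centres lie on the $z$-axis and are equidistant with distance $2d$ (i.e. the centres are $(0,0,2dk)$, $k\in\mathbb{Z}$). Then any packing of translates of $L$ in $\mathbb{R}^3$ (i.e. any packing of unit balls in $\mathbb{R}^3$ consisting of entire translates of $L$) has a density at most $$\frac{\pi}{3d\sqrt{3-d^2}} ,$$ with equality, e.g., for the packing of unit balls whose centres form the lattice generated by the vertices of a tetrahedron with five edges of length $2$ and one edge of length $2d$ (the edge of length $2d$ being parallel to the $z$-axis). Another way of giving this lattice is the following: it is generated by the vertices of a rectangular right pyramid with base edges of lengths $2$ and $2d$ and lateral edges of length $2$. Among lattice packings of translates of $L$, the lattice generated by the vertices of a tetrahedron with five edges of length $2$ and one edge of length $2d$ (the edge of length $2d$ being parallel to the $z$-axis) is (up to congruence) the unique lattice with this maximal density.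
   Context: A packing is a family of sets with pairwise disjoint interiors. The density of a packing is meant in the usual sense: the (upper) limit, as $\rho\to\infty$, of the proportion of the volume of the ball of radius $\rho$ about the origin covered by the members of the packing. A point lattice is a translate of a discrete subgroup of $\mathbb{R}^3$; the lattice generated by given points $v_0,\dots,v_k$ is $\{v_0+\sum_{i=1}^k n_i(v_i-v_0): n_i\in\mathbb{Z}\}$. A lattice packing of translates of $L$ is a packing $\{L+\lambda:\lambda\in\Lambda\}$ with $\Lambda$ a two-dimensional point lattice in $\mathbb{R}^3$, such that the centres of all the unit balls occurring form a three-dimensional point lattice; the uniqueness statement is about this lattice of ball centres. A rectangular right pyramid is a pyramid with rectangular base whose apex projects orthogonally to the centre of the base. *)

(* Defs.v *)
From HB Require Import structures.
From mathcomp Require Export all_boot all_order all_algebra.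
From mathcomp Require Export all_classical all_reals all_analysis.
Set Implicit Arguments.
Unset Strict Implicit.
Unset Printing Implicit Defensive.
Import Order.TTheory GRing.Theory Num.Theory numFieldNormedType.Exports.
Local Open Scope classical_set_scope.
Local Open Scope ring_scope.

Definition dot (R : realType) (x y : 'rV[R]_3) : R := (x *m y^T) 0 0.

(* The library norm `|x| on 'rV[R]_3 is the sup norm; it induces the same
   topology, but distances here are Euclidean. *)
Definition enorm (R : realType) (x : 'rV[R]_3) : R := Num.sqrt (dot x x).

Definition cball (R : realType) (c : 'rV[R]_3) (r : R) : set 'rV[R]_3 :=
  closed_ball_ (@enorm R) c r.

Definition e3 (R : realType) : 'rV[R]_3 := delta_mx 0 (inord 2).

Definition vertical (R : realType) (u : 'rV[R]_3) : Prop :=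
  exists t : R, u = t *: e3 R.

Definition translate (R : realType) (K : set 'rV[R]_3) (t : 'rV[R]_3) :
  set 'rV[R]_3 := [set x + t | x in K].

Definition congruent (R : realType) (A B : set 'rV[R]_3) : Prop :=
  exists2 f : 'rV[R]_3 -> 'rV[R]_3,
    (forall x y, enorm (f x - f y) = enorm (x - y)) & f @` A = B.

(* Lebesgue measure on R^3, transported from the product (R * R) * R. *)
Definition volume (R : realType) (A : set 'rV[R]_3) : \bar R :=
  ((@lebesgue_measure R \x @lebesgue_measure R) \x @lebesgue_measure R)%E
    [set p : R * R * R | A (\row_i nth 0 [:: p.1.1; p.1.2; p.2] i)].

Definition packing (R : realType) (I : Type) (D : set I)
    (K : I -> set 'rV[R]_3) : Prop :=
  trivIset D (fun i => (K i)°).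

Definition density (R : realType) (I : Type) (D : set I)
    (K : I -> set 'rV[R]_3) : \bar R :=
  limf_esup (fun rho : R =>
      volume (\bigcup_(i in D) K i `&` cball 0 rho) / volume (cball 0 rho))%E
    (pinfty_nbhs R).

Definition discrete_subgroup (R : realType) (G : set 'rV[R]_3) : Prop :=
  [/\ G 0, forall x y, G x -> G y -> G (x - y) & G `<=` isolated G].

(* The real linear span of G has dimension k. *)
Definition span_dim (R : realType) (G : set 'rV[R]_3) (k : nat) : Prop :=
  exists s : k.-tuple 'rV[R]_3,
    [/\ free s, [set` s] `<=` G & G `<=` [set` span s]].

Definition point_lattice (R : realType) (k : nat) (Lam : set 'rV[R]_3) : Prop :=
  exists v (G : set 'rV[R]_3),
    [/\ discrete_subgroup G, span_dim G k & Lam = translate G v].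

Definition lattice_gen (R : realType) (k : nat) (v : k.+1.-tuple 'rV[R]_3) :
    set 'rV[R]_3 :=
  [set thead v + \sum_(i < k) (tnth v (lift ord0 i) - thead v) *~ n i
    | n in [set: 'I_k -> int]].

Definition string (R : realType) (d : R) : set 'rV[R]_3 :=
  \bigcup_(k in [set: int]) cball ((2 * d * k%:~R) *: e3 R) 1.

Definition ball_centres (R : realType) (d : R) (Lam : set 'rV[R]_3) :
    set 'rV[R]_3 :=
  [set lam + (2 * d * k%:~R) *: e3 R | lam in Lam & k in [set: int]].

Definition lattice_packing (R : realType) (d : R) (Lam : set 'rV[R]_3) : Prop :=
  [/\ point_lattice 2 Lam,
      packing Lam (translate (string d)) &
      point_lattice 3 (ball_centres d Lam)].

Definition tetrahedron (R : realType) (d : R) (a b c e : 'rV[R]_3) : Prop :=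
  [/\ free [:: b - a; c - a; e - a],
      enorm (b - a) = 2 * d, enorm (c - a) = 2, enorm (e - a) = 2 &
      [/\ enorm (c - b) = 2, enorm (e - b) = 2 & enorm (e - c) = 2]].

(* Base vertices p0, p1, p2, p3 in cyclic order, apex q; the centre of the
   base is 2^-1 *: (p0 + p2). *)
Definition rectangular_right_pyramid (R : realType)
    (p0 p1 p2 p3 q : 'rV[R]_3) : Prop :=
  let u := p1 - p0 in let w := p3 - p0 in
  let h := q - 2^-1 *: (p0 + p2) in
  [/\ free [:: u; w; h], p2 = p0 + u + w, dot u w = 0, dot h u = 0 & dot h w = 0].

Definition pyramid (R : realType) (d : R) (p0 p1 p2 p3 q : 'rV[R]_3) : Prop :=
  [/\ rectangular_right_pyramid p0 p1 p2 p3 q,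
      enorm (p1 - p0) = 2 * d, enorm (p3 - p0) = 2 &
      [/\ enorm (q - p0) = 2, enorm (q - p1) = 2,
          enorm (q - p2) = 2 & enorm (q - p3) = 2]].

(* Main.v *)
Require Import Defs.
From mathcomp Require Import measurable_realfun zify ring lra.
Set Implicit Arguments.
Unset Strict Implicit.
Unset Printing Implicit Defensive.
Import Order.TTheory GRing.Theory Num.Theory numFieldNormedType.Exports.
Local Open Scope classical_set_scope.
Local Open Scope ring_scope.

(** Seen from above, a translate of the string L is a point p of the plane with
    a height h modulo 2d.  Two translates do not overlap iff their planar
    points satisfy |p - q|^2 >= 4 - phase(h - h')^2, where phase is the distance
    to the multiples of 2d and so is at most d.  The density bound says that
    there is at most one such point per 2 sqrt(3 - d^2) of area.

    The bound comes from a Delaunay triangulation.  A triangle with squared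
    sides a_i and opposite angles alpha_i has area (1/4) sum a_i cot alpha_i.
    Across an edge of a Delaunay triangulation the two opposite cotangents have
    a nonnegative sum, so in the total area every a_i may be decreased to
    m_i = 4 - phase^2 ([weighted_cot_sum_ge0]).  For one triangle, Pedoe's
    inequality ([pedoe_cot]) bounds (1/4) sum m_i cot alpha_i below by the area
    of a triangle with squared sides m_i, whatever the shape of the given
    triangle.  The three phases of a triangle have sum at most 2d, and this
    makes that area at least sqrt(3 - d^2) ([bound_form_ge]).  A single Delaunay
    triangle can be smaller than this: only the sum obeys the bound.  As there
    are two triangles per point, the count follows ([square_bound]).

    Triangulations are lists of counterclockwise triangles in which every
    inner edge is used equally often in both directions.  Such a list is built
    by inserting the points one at a time ([points_insert]), starting with a fan
    over points spaced 2 apart on the boundary of a square, which makes the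
    angles opposite boundary edges acute.  Edge flips preserve the number of
    triangles, the total area and the balance of the edges, and they decrease
    the volume below the lifting to the paraboloid; a list that minimises this
    volume is Delaunay ([delaunay_exists]).

    The count in squares becomes a density in space by a comparison of volumes:
    a box with square base of side s and height 2d contains at most one centre
    of each string ([string_tile_count]), and balls are measured by slices
    ([volume_solid_ball]).  For a lattice that contains the vertical period,
    sheared boxes contain exactly one centre each ([lat_tile]), so its density
    is read off its planar determinant.

    For the uniqueness, the horizontal projection of a lattice packing has a
    reduced basis, whose triangle is not obtuse.  If the density is maximal,
    monotonicity of the area in the squared sides forces a_i = m_i and the
    phases d, d, 0 in some order ([extremal_cell]).  The Gram matrix of three
    generators is then that of the tetrahedron, and equal Gram matrices give an
    isometry ([gram_congruent]). *)

(** * Plane geometry of triangles *)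

Section PlanePoints.
Variable R : realType.
Implicit Types p q r s x y : R * R.

Definition orient p q r : R :=
  (q.1 - p.1) * (r.2 - p.2) - (q.2 - p.2) * (r.1 - p.1).
Definition dotat r p q : R :=
  (p.1 - r.1) * (q.1 - r.1) + (p.2 - r.2) * (q.2 - r.2).
Definition sqdist p q : R := (p.1 - q.1) ^+ 2 + (p.2 - q.2) ^+ 2.
Definition sqnorm p : R := p.1 ^+ 2 + p.2 ^+ 2.
(** The cotangent of the angle at [r] of the triangle [p], [q], [r]. *)
Definition cotat r p q : R := dotat r p q / orient p q r.

Lemma orient_rot p q r : orient q r p = orient p q r.
Proof. rewrite /orient; ring. Qed.

Lemma sqdist_ge0 p q : 0 <= sqdist p q.
Proof. by rewrite addr_ge0 ?sqr_ge0. Qed.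

(** A negative sum of the opposite cotangents means that [s] lies inside the
    circumcircle of [p], [q], [r].  The numerator of the sum is, up to sign, the
    in-circle determinant, which is also the loss of volume below the lifting of
    the points to the paraboloid.  Centred at [p] and then at [q], the same
    determinant shows that the quadrilateral is convex. *)
Lemma flip_convex p q r s : 0 < orient p q r -> 0 < orient q p s ->
  cotat r p q + cotat s q p < 0 ->
  [/\ 0 < orient p s r, 0 < orient s q r &
    orient p s r * (sqnorm p + sqnorm s + sqnorm r)
      + orient s q r * (sqnorm s + sqnorm q + sqnorm r)
    < orient p q r * (sqnorm p + sqnorm q + sqnorm r)
      + orient q p s * (sqnorm q + sqnorm p + sqnorm s)].
Proof.
move=> o1 o2 W.
set K := dotat r p q * orient q p s + dotat s q p * orient p q r.
have K0 : K < 0.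
  have -> : K = (cotat r p q + cotat s q p) * (orient p q r * orient q p s).
    by rewrite /K /cotat; field; rewrite !gt_eqF.
  by rewrite nmulr_rlt0 // mulr_gt0.
have E a b : sqdist a b = (a.1 - b.1) ^+ 2 + (a.2 - b.2) ^+ 2 by [].
have pos a b c : 0 < sqdist a b * c -> 0 < c.
  move=> h; rewrite ltNge; apply/negP => c0.
  by move: h; rewrite ltNge mulr_ge0_le0 ?sqdist_ge0.
split.
- apply: (@pos q p).
  have -> : sqdist q p * orient p s r
    = - K + sqdist s p * orient p q r + sqdist r p * orient q p s.
    by rewrite /K /sqdist /dotat /orient; ring.
  have := mulr_ge0 (sqdist_ge0 s p) (ltW o1).
  have := mulr_ge0 (sqdist_ge0 r p) (ltW o2).
  lra.
- apply: (@pos p q).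
  have -> : sqdist p q * orient s q r
    = - K + sqdist s q * orient p q r + sqdist r q * orient q p s.
    by rewrite /K /sqdist /dotat /orient; ring.
  have := mulr_ge0 (sqdist_ge0 s q) (ltW o1).
  have := mulr_ge0 (sqdist_ge0 r q) (ltW o2).
  lra.
rewrite -subr_gt0.
suff -> : orient p q r * (sqnorm p + sqnorm q + sqnorm r)
      + orient q p s * (sqnorm q + sqnorm p + sqnorm s)
      - (orient p s r * (sqnorm p + sqnorm s + sqnorm r)
      + orient s q r * (sqnorm s + sqnorm q + sqnorm r)) = - K.
  by rewrite oppr_gt0.
by rewrite /K /sqnorm /dotat /orient; ring.
Qed.

Lemma area_cot p q r : orient p q r != 0 ->
  sqdist p q * cotat r p q + sqdist q r * cotat p q r
    + sqdist r p * cotat q r p = 2 * orient p q r.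
Proof.
move=> o; rewrite /cotat (orient_rot p q r) -(orient_rot r p q).
rewrite !mulrA -!mulrDl; apply: (canLR (mulfK o)).
by rewrite /sqdist /dotat /orient; ring.
Qed.

Lemma cot_cot p q r : orient p q r != 0 ->
  cotat r p q * cotat p q r + cotat p q r * cotat q r p
    + cotat q r p * cotat r p q = 1.
Proof.
move=> o; rewrite /cotat (orient_rot p q r) -(orient_rot r p q).
have <- : (dotat r p q * dotat p q r + dotat p q r * dotat q r p
  + dotat q r p * dotat r p q) / orient p q r ^+ 2 = 1.
  rewrite [X in X / _](_ : _ = orient p q r ^+ 2) ?divff ?expf_neq0 //.
  by rewrite /dotat /orient; ring.
by field.
Qed.

Lemma cotD_gt0 p q r : 0 < orient p q r -> 0 < cotat r p q + cotat p q r.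
Proof.
move=> o; rewrite /cotat (orient_rot p q r) -mulrDl divr_gt0 //.
have -> : dotat r p q + dotat p q r = sqdist p r.
  by rewrite /dotat /sqdist; ring.
rewrite lt0r sqdist_ge0 andbT; apply/eqP => /eqP.
rewrite paddr_eq0 ?sqr_ge0 // !sqrf_eq0 !subr_eq0 => /andP[/eqP h1 /eqP h2].
by move: o; rewrite /orient h1 h2; lra.
Qed.

(** Pedoe's inequality for a triangle with cotangents [u], [v], [w] and a triangle
    with squared sides [m1], [m2], [m3], of which [k] bounds four times the
    area.  The first triangle may be obtuse. *)
Lemma pedoe_cot (m1 m2 m3 u v w k : R) : 0 < m1 -> 0 < m2 -> 0 < m3 ->
  0 <= k -> k ^+ 2 <= 2 * (m1 * m2 + m2 * m3 + m3 * m1)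
    - (m1 ^+ 2 + m2 ^+ 2 + m3 ^+ 2) ->
  u * v + v * w + w * u = 1 -> 0 < u + v -> k <= m1 * u + m2 * v + m3 * w.
Proof.
move=> m1_gt0 m2_gt0 m3_gt0 k_ge0 kQ uvw s_gt0.
set Q := 2 * _ - _ in kQ.
pose A := 2 * m1 * u + (m1 + m2 - m3) * v; pose B := m1 + m3 - m2.
(* complete the square in u, and use w (u + v) = 1 - u v *)
have h : 4 * m1 * (u + v) * (m1 * u + m2 * v + m3 * w)
  = A ^+ 2 + B ^+ 2 + Q * (v ^+ 2 + 1).
  have -> : 4 * m1 * (u + v) * (m1 * u + m2 * v + m3 * w)
    = 4 * m1 * ((u + v) * (m1 * u + m2 * v) + m3 * (w * u + v * w)) by ring.
  have -> : w * u + v * w = 1 - u * v by lra.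
  by rewrite /A /B /Q; ring.
rewrite -(@ler_pM2l _ (4 * m1 * (u + v))); last by rewrite !mulr_gt0.
rewrite h.
have -> : 4 * m1 * (u + v) * k = 2 * k * (A + B * v).
  by rewrite /A /B; ring.
have h2 : k ^+ 2 * (v ^+ 2 + 1) <= Q * (v ^+ 2 + 1).
  by rewrite ler_wpM2r // addr_ge0 ?sqr_ge0.
have h3 : A ^+ 2 + B ^+ 2 + k ^+ 2 * (v ^+ 2 + 1) - 2 * k * (A + B * v)
  = (A - k) ^+ 2 + (B - k * v) ^+ 2 by ring.
have := sqr_ge0 (A - k); have := sqr_ge0 (B - k * v).
move: h2 h3; clear; lra.
Qed.

Definition in_tri y p q r :=
  [&& 0 <= orient p q y, 0 <= orient q r y & 0 <= orient r p y].

Lemma in_tri_rot y p q r : in_tri y q r p = in_tri y p q r.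
Proof. by rewrite /in_tri andbA andbC. Qed.

Lemma weighted_sum_gt0 (a b c f g h : R) : 0 <= a -> 0 <= b -> 0 <= c ->
  0 < a + b + c -> 0 < f -> 0 < g -> 0 < h -> 0 < a * f + b * g + c * h.
Proof.
move=> a0 b0 c0 s f0 g0 h0.
have [a1|a1] := ltP 0 a.
  by rewrite -addrA ltr_pwDl ?mulr_gt0 // addr_ge0 // mulr_ge0 // ltW.
have [b1|b1] := ltP 0 b.
  rewrite addrAC ltr_wpDl ?mulr_gt0 // addr_ge0 // mulr_ge0 //; exact: ltW.
rewrite ltr_wpDl ?mulr_gt0 //; last by lra.
by rewrite addr_ge0 // mulr_ge0 // ltW.
Qed.

(** The signs of the orientations of [x], a vertex and [y] change around the
    triangle, since a convex combination of the three orientations is 0; a pair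
    of consecutive vertices with a sign change gives the part that contains [y]. *)
Lemma in_tri_split x y p q r : 0 < orient p q r ->
  in_tri x p q r -> in_tri y p q r ->
  [|| in_tri y p q x, in_tri y q r x | in_tri y r p x].
Proof.
move=> o /and3P[x1 x2 x3] /and3P[y1 y2 y3].
have E a : orient x a y = - orient a x y by rewrite /orient; ring.
rewrite /in_tri y1 y2 y3 /= !(E p) !(E q) !(E r) !oppr_ge0.
set f := orient p x y; set g := orient q x y; set h := orient r x y.
have H : orient q r x * f + orient r p x * g + orient p q x * h = 0.
  by rewrite /f /g /h /orient; ring.
have S : orient q r x + orient r p x + orient p q x = orient p q r.
  by rewrite /orient; ring.
have [f0|f0] := leP f 0; have [g0|g0] := leP g 0; have [h0|h0] := leP h 0;
  rewrite /= ?(ltW f0) ?(ltW g0) ?(ltW h0) ?andbT ?orbT //=.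
- have [f1|f1] := leP 0 f; first by rewrite ?orbT.
  have [g1|g1] := leP 0 g; first by rewrite ?orbT.
  have [h1|h1] := leP 0 h; first by rewrite ?orbT.
  have := @weighted_sum_gt0 _ _ _ (- f) (- g) (- h) x2 x3 x1.
  rewrite S !oppr_gt0 !mulrN -!opprD H oppr0 ltxx => /(_ o f1 g1 h1); lra.
- have := weighted_sum_gt0 x2 x3 x1 _ f0 g0 h0.
  by rewrite S H ltxx => /(_ o).
Qed.

End PlanePoints.

(** * Triangulations as lists of darts, and Delaunay flips *)

Definition swap (V : finType) (e : V * V) := (e.2, e.1).
Definition is_edge (V : finType) (p q : V) (e : V * V) : bool :=
  (p == e.1) && (q == e.2).
Definition rot_tri (V : finType) (t : V * V * V) := (t.1.2, t.2, t.1.1).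
(** A triangle enters with its three rotations, so that each of its edges is the
    first component of one dart, whose last component is the opposite vertex. *)
Definition darts (V : finType) (L : seq (V * V * V)) : seq (V * V * V) :=
  flatten [seq [:: t; rot_tri t; rot_tri (rot_tri t)] | t <- L].
Definition edge_count (V : finType) (L : seq (V * V * V)) (e : V * V) :=
  count (fun t => is_edge t.1.1 t.1.2 e) (darts L).

Ltac edge_lia := repeat match goal with
  |- context [nat_of_bool ?b] => generalize (nat_of_bool b); intro
  | |- context [edge_count ?L ?e] => generalize (edge_count L e); intro end;
  clear; intros; lia.

Section Chains.
Variables (R : realType) (V : finType) (P : V -> R * R).
Notation tri := (V * V * V)%type.
Implicit Types (t : tri) (L : seq tri) (e : V * V).

Definition ori t : R := orient (P t.1.1) (P t.1.2) (P t.2).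
Definition cot t : R := cotat (P t.2) (P t.1.1) (P t.1.2).
Definition positive L := all (fun t => 0 < ori t) (darts L).
(** Outside [bd], the boundary of the chain of triangles is zero; this is all the
    planar topology that the area bound uses. *)
Definition balanced (bd : pred (V * V)) L :=
  [forall e, ~~ bd e ==> (edge_count L e == edge_count L (swap e))].
Definition area L : R := \sum_(t <- darts L) ori t.
(** Up to a factor, the volume below the graph over the triangulation of the
    lifting to the paraboloid. *)
Definition energy L : R := \sum_(t <- darts L)
  ori t * (sqnorm (P t.1.1) + sqnorm (P t.1.2) + sqnorm (P t.2)).

Lemma rot_triK t : rot_tri (rot_tri (rot_tri t)) = t.
Proof. by case: t => [[]]. Qed.

Lemma ori_rot t : ori (rot_tri t) = ori t.
Proof. by rewrite /ori /= orient_rot. Qed.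

Lemma darts_cons t L :
  darts (t :: L) = [:: t, rot_tri t, rot_tri (rot_tri t) & darts L].
Proof. by []. Qed.

Lemma size_darts L : size (darts L) = (3 * size L)%N.
Proof. by elim: L => // t L IH; rewrite darts_cons /= IH mulnS. Qed.

Lemma mem_darts t L : t \in L -> t \in darts L.
Proof.
move=> tL; apply/flattenP; exists [:: t; rot_tri t; rot_tri (rot_tri t)].
  exact: map_f.
by rewrite inE eqxx.
Qed.

Lemma rot_darts t L : t \in darts L -> rot_tri t \in darts L.
Proof.
elim: L => // t' L IH; rewrite darts_cons !inE => /or4P[] /= H.
- by rewrite (eqP H) eqxx orbT.
- by rewrite (eqP H) eqxx !orbT.
- by rewrite (eqP H) rot_triK eqxx.
- by rewrite IH // !orbT.
Qed.

Lemma darts_pull t L : t \in darts L -> exists L', perm_eq (darts L) (darts (t :: L')).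
Proof.
elim: L => // t' L IH; rewrite darts_cons !inE => /or4P[] /= H.
- by exists L; rewrite (eqP H).
- exists L; rewrite (eqP H) !darts_cons rot_triK.
  by apply/permP => a /=; lia.
- exists L; rewrite (eqP H) !darts_cons !rot_triK.
  by apply/permP => a /=; lia.
- have [L' pL] := IH H; exists (t' :: L').
  apply/permP => a /=; move/permP: pL => /(_ a) /=; lia.
Qed.

Lemma positive_perm L L' : perm_eq (darts L) (darts L') ->
  positive L = positive L'.
Proof. exact: perm_all. Qed.

Lemma edge_count_perm L L' e : perm_eq (darts L) (darts L') ->
  edge_count L e = edge_count L' e.
Proof. by move/permP; apply. Qed.

Lemma area_perm L L' : perm_eq (darts L) (darts L') -> area L = area L'.
Proof. by move=> pL; apply: perm_big. Qed.

Lemma energy_perm L L' : perm_eq (darts L) (darts L') -> energy L = energy L'.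
Proof. by move=> pL; apply: perm_big. Qed.

Lemma size_perm L L' : perm_eq (darts L) (darts L') -> size L = size L'.
Proof. by move/perm_size; rewrite !size_darts; lia. Qed.

Lemma positive_cons t L : positive (t :: L) = (0 < ori t) && positive L.
Proof. by rewrite /positive darts_cons /= !ori_rot !andbA !andbb. Qed.

Lemma area_cons t L : area (t :: L) = 3 * ori t + area L.
Proof. by rewrite /area darts_cons !big_cons !ori_rot; ring. Qed.

Lemma energy_cons p q r L : energy ((p, q, r) :: L)
  = 3 * (orient (P p) (P q) (P r)
         * (sqnorm (P p) + sqnorm (P q) + sqnorm (P r))) + energy L.
Proof. by rewrite /energy darts_cons !big_cons !ori_rot /ori /=; ring. Qed.

Lemma edge_count_cons p q r L e : edge_count ((p, q, r) :: L) e
  = (is_edge p q e + is_edge q r e + is_edge r p e + edge_count L e)%N.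
Proof. by rewrite /edge_count darts_cons /= !addnA. Qed.

Lemma swapK e : swap (swap e) = e.
Proof. by case: e. Qed.

Lemma is_edge_swap p q e : is_edge p q (swap e) = is_edge q p e.
Proof. by rewrite /is_edge andbC. Qed.

Definition edge_countE := (edge_count_cons, is_edge_swap).

Lemma balancedP (bd : pred (V * V)) L :
  reflect (forall e, ~~ bd e -> edge_count L e = edge_count L (swap e))
          (balanced bd L).
Proof.
by apply: (iffP forallP) => H e;
  [move/implyP: (H e) => h /h /eqP | apply/implyP => /H ->].
Qed.

Lemma ori_neq t : 0 < ori t -> [/\ t.1.1 != t.1.2, t.1.2 != t.2 & t.2 != t.1.1].
Proof.
case: t => [[p q] r]; rewrite /ori /= => o.
by split; apply/eqP => h; move: o; rewrite h /orient; lra.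
Qed.

Lemma darts_pos t L : positive L -> t \in darts L -> 0 < ori t.
Proof. by move=> /allP H /H. Qed.

Lemma darts_pull2 p q r s L : positive L ->
  (p, q, r) \in darts L -> (q, p, s) \in darts L ->
  exists L', perm_eq (darts L) (darts [:: (p, q, r), (q, p, s) & L']).
Proof.
move=> pos tL tL'; have [L' pL] := darts_pull tL.
have [pq qr rp] := ori_neq (darts_pos pos tL).
have : (q, p, s) \in darts L'.
  move: tL'; rewrite (perm_mem pL) darts_cons !inE /rot_tri /= !xpair_eqE.
  rewrite /= in pq qr rp.
  by rewrite (negbTE pq) (eq_sym p r) (negbTE rp) (negbTE qr) !andbF.
move=> /darts_pull[L'' pL']; exists L''.
rewrite (perm_trans pL) //.
by rewrite !(darts_cons (p, q, r)) !perm_cons.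
Qed.

(** The lists of a given size are finite in number, so one of them minimises the
    energy under the constraints.  A flip at an edge with a negative sum of
    opposite cotangents would keep the constraints and decrease the energy. *)
Theorem delaunay_exists bd L0 : positive L0 -> balanced bd L0 ->
  exists L, [/\ size L = size L0, positive L, balanced bd L, area L = area L0 &
    forall p q r s, (p, q, r) \in darts L -> (q, p, s) \in darts L ->
      0 <= cot (p, q, r) + cot (q, p, s)].
Proof.
move=> pos0 bal0.
pose Pr (T : (size L0).-tuple tri) :=
  [&& positive T, balanced bd T & area T == area L0].
have Pr0 : Pr (in_tuple L0) by rewrite /Pr /= pos0 bal0 eqxx.
have [L /and3P[pos bal /eqP ar] Lmin] :=
  @arg_minP _ _ _ _ Pr (fun T => energy T) Pr0.
exists L; split; rewrite ?size_tuple //.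
move=> p q r s tL tL'; rewrite leNgt; apply/negP => neg.
have [L' pL] := darts_pull2 pos tL tL'.
have o1 := darts_pos pos tL; have o2 := darts_pos pos tL'.
have [n1 n2 n3] := flip_convex o1 o2 neg.
pose L1 := [:: (p, s, r), (s, q, r) & L'].
have sL1 : size L1 == size L0.
  by rewrite -(size_tuple L) (size_perm pL).
have PrL1 : Pr (Tuple sL1).
  rewrite /Pr /=; apply/and3P; split.
  - move: pos; rewrite (positive_perm pL) !positive_cons => /and3P[_ _ ->].
    by rewrite /ori /= n1 n2.
  - apply/balancedP => e be; have := balancedP _ _ bal e be.
    rewrite !(edge_count_perm _ pL) !edge_countE; edge_lia.
  - rewrite -ar (area_perm pL) !area_cons /ori /=; apply/eqP.
    by rewrite /orient; ring.
have := Lmin _ PrL1; rewrite leNgt => /negP; apply.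
rewrite (energy_perm pL) !energy_cons.
by move: n3; rewrite /= -(@ltr_pM2l _ 3) //; lra.
Qed.
End Chains.

(** * Lower bound for the area of a triangulation *)

Lemma sum_pair_ge0 (R : realType) (T : eqType) (f : T -> R) (A B : seq T) :
  size A = size B -> {in A & B, forall a b, 0 <= f a + f b} ->
  0 <= \sum_(a <- A) f a + \sum_(b <- B) f b.
Proof.
elim: A B => [|a A IH] [|b B] //=; first by rewrite !big_nil addr0.
move=> [sAB] H; rewrite !big_cons addrACA addr_ge0 //.
  by apply: H; rewrite inE eqxx.
by apply: IH => // x y xA yB; apply: H; rewrite inE ?xA ?yB orbT.
Qed.

Section AreaBound.
Variables (R : realType) (V : finType) (P : V -> R * R).
Notation tri := (V * V * V)%type.
Implicit Types (t : tri) (L : seq tri) (e : V * V).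
Notation ori := (ori P).
Notation cot := (cot P).

Lemma darts_sum (f : tri -> R) L : \sum_(t <- darts L) f t
  = \sum_(t <- L) (f t + f (rot_tri t) + f (rot_tri (rot_tri t))).
Proof.
elim: L => [|t L IH]; first by rewrite !big_nil.
by rewrite darts_cons !big_cons IH !addrA.
Qed.

Lemma is_edgeE (p q : V) e : is_edge p q e = ((p, q) == e).
Proof. by case: e. Qed.

(** Grouped by edges, the sum has the coefficient [w p q] times the cotangents on
    both sides of the edge.  By the balance of the edges these cotangents can be
    paired, and each pair has a nonnegative sum. *)
Lemma weighted_cot_sum_ge0 (bd : pred (V * V)) (w : V -> V -> R) L :
  positive P L -> balanced bd L ->
  (forall p q r s, (p, q, r) \in darts L -> (q, p, s) \in darts L ->
     0 <= cot (p, q, r) + cot (q, p, s)) ->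
  (forall e, bd (swap e) = bd e) ->
  (forall p q r, bd (p, q) -> 0 < ori (p, q, r) -> 0 <= cot (p, q, r)) ->
  (forall p q, w p q = w q p) ->
  (forall p q, p != q -> 0 <= w p q) ->
  0 <= \sum_(t <- darts L) w t.1.1 t.1.2 * cot t.
Proof.
move=> pos bal opp bdC bd_ge0 wC w_ge0.
pose S e := \sum_(t <- darts L | is_edge t.1.1 t.1.2 e) cot t.
have -> : \sum_(t <- darts L) w t.1.1 t.1.2 * cot t
  = \sum_e w e.1 e.2 * S e.
  rewrite (partition_big (fun t : tri => t.1) xpredT) //=.
  apply: eq_bigr => e _; rewrite mulr_sumr.
  under [RHS]eq_bigl => t do rewrite is_edgeE -surjective_pairing.
  by apply: eq_bigr => t /eqP ->.
rewrite -(pmulr_lge0 _ (ltr0n R 2)) mulr_natr mulr2n.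
have sw : involutive (@swap V) by move=> e; exact: swapK.
rewrite {2}(reindex_inj (inv_inj sw)) /= -big_split /=.
apply: sumr_ge0 => e _; rewrite (wC e.2) -mulrDr.
have Scount e' : \sum_(t <- darts L | is_edge t.1.1 t.1.2 e') cot t
  = \sum_(t <- [seq t <- darts L | is_edge t.1.1 t.1.2 e']) cot t.
  by rewrite big_filter.
have edP e' t : t \in [seq t <- darts L | is_edge t.1.1 t.1.2 e'] ->
    t \in darts L /\ t = (e'.1, e'.2, t.2).
  rewrite mem_filter /is_edge; case: t => [[a b] c] /=.
  by move=> /andP[/andP[/eqP -> /eqP ->]].
have [e12|e12] := eqVneq e.1 e.2.
  have S0 e' : e'.1 = e'.2 -> S e' = 0.
    move=> e12'; rewrite /S Scount big1_seq // => t /andP[_ /edP[tL tE]].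
    by have [] := ori_neq (darts_pos pos tL); rewrite tE /= e12' eqxx.
  by rewrite !S0 // addr0 mulr0.
apply: mulr_ge0; first exact: w_ge0.
have [be|be] := boolP (bd e).
  apply: addr_ge0; rewrite /S Scount big_seq; apply: sumr_ge0 => t /edP[tL tE];
    have := darts_pos pos tL; rewrite tE; apply: bd_ge0.
    by rewrite -surjective_pairing.
  by rewrite -(bdC e) in be.
rewrite /S !Scount; apply: sum_pair_ge0.
  by rewrite !size_filter; apply: (balancedP _ _ bal).
move=> t t' /edP[tL tE] /edP[tL' tE'].
by move: tL tL'; rewrite tE tE' /=; apply: opp.
Qed.

(** Twice the area of a triangle is a sum of squared sides times half the
    opposite cotangents, and [weighted_cot_sum_ge0] allows to replace the
    squared sides by the smaller [m]. *)
Theorem area_lower_bound (bd : pred (V * V)) (m : V -> V -> R) (k : R) L :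
  positive P L -> balanced bd L ->
  (forall e, bd (swap e) = bd e) ->
  (forall p q r, bd (p, q) -> 0 < ori (p, q, r) -> 0 <= cot (p, q, r)) ->
  (forall p q, m p q = m q p) ->
  (forall p q, p != q -> m p q <= sqdist (P p) (P q)) ->
  (forall p q r, 0 < ori (p, q, r) -> k <=
     m p q * cot (p, q, r) + m q r * cot (q, r, p) + m r p * cot (r, p, q)) ->
  3 * k * (size L)%:R <= 2 * area P L.
Proof.
move=> pos0 bal0 bdC bd_ge0 mC m_le m_tri.
have [L1 [<- pos bal <- opp]] := delaunay_exists pos0 bal0.
pose w p q := sqdist (P p) (P q) - m p q.
have wC p q : w p q = w q p.
  by rewrite /w (mC q) /sqdist; ring.
have w0 p q : p != q -> 0 <= w p q by move=> /m_le; rewrite subr_ge0.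
have := weighted_cot_sum_ge0 pos bal opp bdC bd_ge0 wC w0.
under eq_bigr do rewrite /w mulrBl.
rewrite sumrB subr_ge0 !darts_sum => H.
have posL t : t \in L1 -> 0 < ori t.
  by move=> tL; apply/(darts_pos pos)/mem_darts.
have k1 : k * (size L1)%:R <= \sum_(t <- L1) 2 * ori t.
  have -> : k * (size L1)%:R = \sum_(t <- L1) k.
    by rewrite big_const_seq count_predT iter_addr addr0 mulr_natr.
  apply: le_trans (le_trans H _).
    rewrite big_seq [leRHS]big_seq; apply: ler_sum => -[[p q] r] /posL.
    exact: m_tri.
  rewrite big_seq [leRHS]big_seq; apply: ler_sum => -[[p q] r] /posL o.
  rewrite -[leRHS]area_cot //=; exact: lt0r_neq0.
rewrite -mulrA (le_trans (ler_wpM2l _ k1)) //.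
rewrite /area darts_sum; under [X in _ <= _ * X]eq_bigr do rewrite !ori_rot.
rewrite -!mulr_sumr mulrA (_ : \sum_(i <- L1) (ori i + ori i + ori i)
  = 3 * \sum_(i <- L1) ori i) ?mulrA; first by rewrite (mulrC 3).
by rewrite mulr_sumr; apply: eq_bigr => t _; ring.
Qed.

End AreaBound.

(** * Insertion of points *)

Section EdgeSplit.
Variable R : realType.
Implicit Types p q r s x y : R * R.

Lemma barycentric p q r x : (forall f, f = @fst R R \/ f = @snd R R ->
  orient p q r * f x
  = orient q r x * f p + orient r p x * f q + orient p q x * f r).
Proof. by move=> f [] ->; rewrite /orient; ring. Qed.

Lemma orient_vertex p q r x : 0 < orient p q r ->
  orient p q x = 0 -> orient q r x = 0 -> x = q.
Proof.
move=> o o1 o2.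
have S : orient r p x = orient p q r.
  have -> : orient p q r = orient q r x + orient r p x + orient p q x.
    by rewrite /orient; ring.
  by rewrite o1 o2 add0r addr0.
have H f : f = @fst R R \/ f = @snd R R -> f x = f q.
  move=> /(barycentric p q r x); rewrite o1 o2 S !mul0r add0r addr0.
  by apply: mulfI; rewrite gt_eqF.
by rewrite [x]surjective_pairing [q]surjective_pairing !H; auto.
Qed.

Lemma edge_split_pos p q r s x : 0 < orient p q r -> orient p q x = 0 ->
  0 < orient q r x -> 0 < orient r p x -> 0 < orient q p s ->
  0 < orient p s x /\ 0 < orient s q x.
Proof.
move=> o o1 o2 o3 o4; split; rewrite -(pmulr_rgt0 _ o).
- have -> : orient p q r * orient p s x
    = orient r p x * orient q p s + orient p q x * orient p s r.
    by rewrite /orient; ring.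
  by rewrite o1 mul0r addr0 mulr_gt0.
- have -> : orient p q r * orient s q x
    = orient q r x * orient q p s + orient p q x * orient s q r.
    by rewrite /orient; ring.
  by rewrite o1 mul0r addr0 mulr_gt0.
Qed.

(** Here [x] is an inner point of the edge from [p] to [q], and the side of [y]
    with respect to the line from [x] to [r] decides.  The three-part split
    would have a degenerate part. *)
Lemma in_tri_edge_split p q r x y : 0 < orient p q r -> orient p q x = 0 ->
  0 < orient q r x -> 0 < orient r p x -> in_tri y p q r ->
  in_tri y p x r || in_tri y x q r.
Proof.
move=> o o1 o2 o3 /and3P[y1 y2 y3]; rewrite /in_tri.
have -> : 0 <= orient p x y.
  rewrite -(pmulr_rge0 _ o).
  have -> : orient p q r * orient p x y
    = orient r p x * orient p q y + orient p q x * orient p r y.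
    by rewrite /orient; ring.
  by rewrite o1 mul0r addr0 mulr_ge0 // ltW.
have -> : 0 <= orient x q y.
  rewrite -(pmulr_rge0 _ o).
  have -> : orient p q r * orient x q y
    = orient q r x * orient p q y + orient p q x * orient r q y.
    by rewrite /orient; ring.
  by rewrite o1 mul0r addr0 mulr_ge0 // ltW.
have -> : orient r x y = - orient x r y by rewrite /orient; ring.
by rewrite y2 y3 /= andbT oppr_ge0; apply: le_total.
Qed.

End EdgeSplit.

Section Insertion.
Variables (R : realType) (V : finType) (P : V -> R * R).
Variables (bd : pred (V * V)) (region : R * R -> Prop).
Notation tri := (V * V * V)%type.
Implicit Types (t : tri) (L : seq tri) (e : V * V) (S : pred V).

Definition inside y t := in_tri y (P t.1.1) (P t.1.2) (P t.2).
Definition covers L := forall y, region y -> has (inside y) (darts L).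
Definition vertices_in S L := all (fun t => S t.1.1) (darts L).

(** The covering condition only serves to find a triangle that contains the next
    point to insert. *)
Definition triangulation S L :=
  [/\ positive P L, balanced bd L, covers L & vertices_in S L].

Lemma inside_rot y t : inside y (rot_tri t) = inside y t.
Proof. exact: in_tri_rot. Qed.

Lemma covers_cons y t L :
  has (inside y) (darts (t :: L)) = inside y t || has (inside y) (darts L).
Proof. by rewrite darts_cons /= !inside_rot !orbA !orbb. Qed.

Lemma vertices_in_cons S p q r L : vertices_in S ((p, q, r) :: L)
  = [&& S p, S q, S r & vertices_in S L].
Proof. by rewrite /vertices_in darts_cons. Qed.

Lemma vertices_in_perm S L L' : perm_eq (darts L) (darts L') ->
  vertices_in S L = vertices_in S L'.
Proof. exact: perm_all. Qed.

(** By the balance of the edges there is a triangle on the other side of the edge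
    from [p] to [q]; both are cut in two. *)
Lemma edge_insert S L x p q r : triangulation S L -> ~~ S x ->
  (forall v, S v -> P v <> P x) ->
  (forall e, bd e -> orient (P e.1) (P e.2) (P x) <> 0) ->
  (p, q, r) \in darts L -> inside (P x) (p, q, r) ->
  orient (P p) (P q) (P x) = 0 ->
  exists L', [/\ size L' = (size L).+2, area P L' = area P L &
    triangulation (predU1 x S) L'].
Proof.
move=> [pos bal cov ver] xS xP xbd tL xin o1.
have o : 0 < orient (P p) (P q) (P r) := darts_pos pos tL.
have SD t : t \in darts L -> S t.1.1 by move/allP: ver; apply.
have Sp : S p := SD _ tL.
have Sq : S q := SD _ (rot_darts tL).
have Sr : S r := SD _ (rot_darts (rot_darts tL)).
have /and3P[_ o2 o3] := xin.
have {}o2 : 0 < orient (P q) (P r) (P x).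
  rewrite lt_neqAle o2 andbT; apply/eqP => /esym o2'.
  by case: (xP _ Sq); rewrite -(orient_vertex o o1 o2').
have {}o3 : 0 < orient (P r) (P p) (P x).
  rewrite lt_neqAle o3 andbT; apply/eqP => /esym o3'.
  case: (xP _ Sp); rewrite -(@orient_vertex _ (P r) (P p) (P q) _ _ o3' o1) //.
  by rewrite -orient_rot.
have pqbd : ~~ bd (p, q) by apply/negP => /xbd; apply.
have [s tL'] : exists s, (q, p, s) \in darts L.
  have : has (fun t => is_edge t.1.1 t.1.2 (swap (p, q))) (darts L).
    rewrite has_count -/(edge_count _ _) -(balancedP _ _ bal _ pqbd) -has_count.
    by apply/hasP; exists (p, q, r) => //; rewrite /is_edge /= !eqxx.
  move=> /hasP[[[a b] c] tL' /andP[/= /eqP aq /eqP bp]].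
  by exists c; rewrite aq bp in tL'.
have Ss : S s := SD _ (rot_darts (rot_darts tL')).
have o4 : 0 < orient (P q) (P p) (P s) := darts_pos pos tL'.
have [L1 pL] := darts_pull2 pos tL tL'.
have [p5 p6] := edge_split_pos o o1 o2 o3 o4.
exists [:: (p, x, r), (x, q, r), (q, x, s), (x, p, s) & L1]; split=> //.
- by rewrite (size_perm pL).
- rewrite (area_perm _ pL) !area_cons /ori /=.
  by rewrite /orient; ring.
split.
- move: pos; rewrite (positive_perm _ pL) !positive_cons => /and3P[_ _ ->].
  rewrite /ori /= (orient_rot (P r) (P p)) o3 -(orient_rot (P x) (P q)) o2.
  by rewrite (orient_rot (P s) (P q)) p6 -(orient_rot (P x) (P p)) p5.
- apply/balancedP => e be; have := balancedP _ _ bal e be.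
  by rewrite !(edge_count_perm _ pL) !edge_countE; edge_lia.
- move=> y /cov; rewrite (perm_has _ pL) !covers_cons.
  case/or3P => [yin|yin|->]; last by rewrite !orbT.
  + by have /orP[] := in_tri_edge_split o o1 o2 o3 yin;
      rewrite /inside /= => ->; rewrite ?orbT.
  + have o1' : orient (P q) (P p) (P x) = 0.
      by rewrite -[RHS]oppr0 -o1 /orient; ring.
    by have /orP[] := in_tri_edge_split o4 o1' p5 p6 yin;
      rewrite /inside /= => ->; rewrite ?orbT.
- rewrite !vertices_in_cons /= !eqxx Sp Sq Sr Ss !orbT /=.
  move: ver; rewrite (vertices_in_perm _ pL) !vertices_in_cons => /and4P[_ _ _ /and4P[_ _ _]].
  by apply: sub_all => t /= ->; rewrite orbT.
Qed.

Lemma point_insert S L x : triangulation S L -> ~~ S x -> region (P x) ->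
  (forall v, S v -> P v <> P x) ->
  (forall e, bd e -> orient (P e.1) (P e.2) (P x) <> 0) ->
  exists L', [/\ size L' = (size L).+2, area P L' = area P L &
    triangulation (predU1 x S) L'].
Proof.
move=> T xS Rx xP xbd; have [pos bal cov ver] := T.
have /hasP[[[p q] r] tL xin] := cov _ Rx.
have ins := edge_insert T xS xP xbd.
have o : 0 < orient (P p) (P q) (P r) := darts_pos pos tL.
have /and3P[/= o1 o2 o3] := xin.
have [z1|z1] := eqVneq (orient (P p) (P q) (P x)) 0; first exact: ins tL xin z1.
have [z2|z2] := eqVneq (orient (P q) (P r) (P x)) 0.
  by apply: (ins _ _ _ (rot_darts tL)) z2; rewrite inside_rot.
have [z3|z3] := eqVneq (orient (P r) (P p) (P x)) 0.
  by apply: (ins _ _ _ (rot_darts (rot_darts tL))) z3; rewrite !inside_rot.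
have {}o1 : 0 < orient (P p) (P q) (P x) by rewrite lt0r z1.
have {}o2 : 0 < orient (P q) (P r) (P x) by rewrite lt0r z2.
have {}o3 : 0 < orient (P r) (P p) (P x) by rewrite lt0r z3.
have SD t : t \in darts L -> S t.1.1 by move/allP: ver; apply.
have Sp : S p := SD _ tL.
have Sq : S q := SD _ (rot_darts tL).
have Sr : S r := SD _ (rot_darts (rot_darts tL)).
have [L1 pL] := darts_pull tL.
exists [:: (p, q, x), (q, r, x), (r, p, x) & L1]; split=> //.
- by rewrite (size_perm pL).
- by rewrite (area_perm _ pL) !area_cons /ori /= /orient; ring.
split.
- move: pos; rewrite (positive_perm _ pL) !positive_cons => /andP[_ ->].
  by rewrite /ori /= o1 o2 o3.
- apply/balancedP => e be; have := balancedP _ _ bal e be.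
  by rewrite !(edge_count_perm _ pL) !edge_countE; edge_lia.
- move=> y /cov; rewrite (perm_has _ pL) !covers_cons.
  case/orP => [yin|->]; last by rewrite !orbT.
  by have /or3P[] := in_tri_split o xin yin;
    rewrite /inside /= => ->; rewrite ?orbT.
- rewrite !vertices_in_cons /= !eqxx Sp Sq Sr !orbT /=.
  move: ver; rewrite (vertices_in_perm _ pL) !vertices_in_cons => /and4P[_ _ _].
  by apply: sub_all => t /= ->; rewrite orbT.
Qed.

Lemma points_insert (s : seq V) S L : triangulation S L -> uniq s ->
  {in s, forall x, [/\ ~~ S x, region (P x) &
    forall e, bd e -> orient (P e.1) (P e.2) (P x) <> 0]} ->
  injective P ->
  exists S' L', [/\ size L' = (size L + 2 * size s)%N, area P L' = area P L &
    triangulation S' L'].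
Proof.
move=> + + + injP; elim: s S L => [|x s IH] S L T /=.
  by exists S, L; rewrite muln0 addn0.
move=> /andP[xs us] H.
have [|xS Rx xbd] := H x; first by rewrite inE eqxx.
have xP v : S v -> P v <> P x by move=> Sv /injP vx; rewrite -vx Sv in xS.
have [L1 [sL1 aL1 T1]] := point_insert T xS Rx xP xbd.
have [|S2 [L2 [sL2 aL2 T2]]] := IH _ _ T1 us.
  move=> y ys; have [|yS Ry ybd] := H y; first by rewrite inE ys orbT.
  split=> //; rewrite negb_or yS andbT.
  by apply: contraNneq xs => <-.
exists S2, L2; split=> //; last by rewrite aL2.
by rewrite sL2 sL1; lia.
Qed.

End Insertion.

(** * Phases of heights modulo 2d *)

Lemma int_small (R : realType) (k : int) : `|k%:~R : R| < 1 -> k = 0.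
Proof. by rewrite -intr_norm -[1]/(1%:~R) ltr_int; lia. Qed.

Section Phase.
Variables (R : realType) (d : R).
Hypothesis d_gt0 : 0 < d.
Implicit Types (h : R) (k : int).

Definition nearest h : int := Num.floor (h / (2 * d) + 2^-1).
Definition residue h : R := h - 2 * d * (nearest h)%:~R.
(** The distance to the multiples of [2 * d]. *)
Definition phase h : R := `|residue h|.

Lemma phase_ge0 h : 0 <= phase h. Proof. exact: normr_ge0. Qed.

Lemma residue_itv h : - d <= residue h <= d.
Proof.
rewrite /residue /nearest; set t := h / _ + _.
have /andP[f1 f2] := floor_itv t; rewrite intrD in f2.
have -> : h = 2 * d * (t - 2^-1) by rewrite /t; field; rewrite gt_eqF.
set f : R := (Num.floor t)%:~R in f1 f2 *.
have : 0 <= d * (t - f) by rewrite mulr_ge0 ?subr_ge0 // ltW.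
have : 0 <= d * (f + 1 - t) by rewrite mulr_ge0 ?subr_ge0 // ltW.
lra.
Qed.

Lemma phase_le h : phase h <= d.
Proof. by rewrite /phase ler_norml residue_itv. Qed.

Lemma phase_min h k : phase h <= `|h - 2 * d * k%:~R|.
Proof.
have [->|nk] := eqVneq k (nearest h); first by [].
rewrite (le_trans (phase_le h)) //.
have -> : h - 2 * d * k%:~R = residue h - 2 * d * (k - nearest h)%:~R.
  by rewrite /residue intrB; ring.
have : 1 <= `|(k - nearest h)%:~R : R|.
  by rewrite -intr_norm -[1]/(1%:~R) ler_int; lia.
move: (_%:~R) => x x1; have /andP[r1 r2] := residue_itv h.
rewrite -normrN opprB; apply: le_trans (lerB_dist _ _).
rewrite !normrM (ger0_norm (ltW d_gt0)) (@ger0_norm _ 2) //.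
have : `|residue h| <= d by exact: phase_le.
have : 0 <= d * (`|x| - 1) by rewrite mulr_ge0 ?subr_ge0 // ltW.
lra.
Qed.

Lemma phaseN h : phase (- h) = phase h.
Proof.
have le a : phase (- a) <= phase a.
  rewrite (le_trans (phase_min (- a) (- nearest a))) //.
  by rewrite intrN mulrN opprK addrC -opprB normrN.
by apply/eqP; rewrite eq_le le -{1}(opprK h) le.
Qed.

Lemma normP (r : R) : (0 <= r /\ `|r| = r) \/ (r <= 0 /\ `|r| = - r).
Proof.
by have [r0|r0] := leP 0 r; [left; rewrite ger0_norm|right; rewrite ltr0_norm ?ltW].
Qed.

(** The residues of [a - b], [b - c] and [c - a] have sum 0 or [2 * d] up to sign.
    If it is 0, one phase is the sum of the other two, and the form of the second
    conclusion vanishes; otherwise the residues have the same sign and Heron's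
    factors of that form are nonnegative. *)
Lemma phase_triple a b c (x := phase (a - b)) (y := phase (b - c))
    (z := phase (c - a)) :
  x + y + z <= 2 * d /\
  0 <= 2 * (x ^+ 2 * y ^+ 2 + y ^+ 2 * z ^+ 2 + z ^+ 2 * x ^+ 2)
       - ((x ^+ 2) ^+ 2 + (y ^+ 2) ^+ 2 + (z ^+ 2) ^+ 2).
Proof.
rewrite /x /y /z /phase.
have /andP[a1 a2] := residue_itv (a - b).
have /andP[b1 b2] := residue_itv (b - c).
have /andP[c1 c2] := residue_itv (c - a).
set u := residue (a - b) in a1 a2 *; set v := residue (b - c) in b1 b2 *.
set w := residue (c - a) in c1 c2 *.
pose k := - (nearest (a - b) + nearest (b - c) + nearest (c - a)).
have S : u + v + w = 2 * d * k%:~R.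
  by rewrite /u /v /w /residue /k intrN !intrD; ring.
rewrite !real_normK ?num_real //.
have Heron p q r e : p + q + r = 2 * e -> 0 <= e -> p <= e -> q <= e -> r <= e ->
    0 <= 2 * (p ^+ 2 * q ^+ 2 + q ^+ 2 * r ^+ 2 + r ^+ 2 * p ^+ 2)
       - ((p ^+ 2) ^+ 2 + (q ^+ 2) ^+ 2 + (r ^+ 2) ^+ 2) :> R.
  move=> s e0 pe qe re; have -> : r = 2 * e - p - q by lra.
  have -> : 2 * (p ^+ 2 * q ^+ 2 + q ^+ 2 * (2 * e - p - q) ^+ 2
       + (2 * e - p - q) ^+ 2 * p ^+ 2)
       - ((p ^+ 2) ^+ 2 + (q ^+ 2) ^+ 2 + ((2 * e - p - q) ^+ 2) ^+ 2)
     = 16 * e * (e - p) * (e - q) * (p + q - e) by ring.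
  by rewrite !mulr_ge0 ?subr_ge0 //; lra.
have k1 : (-1 <= k <= 1)%R.
  have kd : `|k%:~R : R| < 2.
    rewrite -(@ltr_pM2l _ (2 * d)) ?mulr_gt0 //.
    rewrite -[X in X * _](@ger0_norm _ (2 * d)) ?mulr_ge0 ?(ltW d_gt0) //.
    rewrite -normrM -S ltr_norml; have dp := d_gt0; apply/andP; split; lra.
  by move: kd; rewrite -intr_norm -[2]/(2%:~R) ltr_int; lia.
have [k0|[k0|k0]] : k = 0 \/ k = 1 \/ k = -1 by lia.
- have {}S : u + v + w = 0 by rewrite S k0 mulr0.
  split.
    by case: (normP u) (normP v) (normP w) => [[? ->]|[? ->]] [[? ->]|[? ->]]
      [[? ->]|[? ->]]; lra.
  have -> : w = - u - v by lra.
  by rewrite le_eqVlt; apply/orP; left; apply/eqP; ring.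
- have {}S : u + v + w = 2 * d by rewrite S k0 mulr1.
  split; last exact: (Heron _ _ _ d S (ltW d_gt0)).
  by rewrite !ger0_norm; lra.
- have {}S : - u - v - w = 2 * d by rewrite -opprD -opprD S k0 mulrN1 opprK.
  split; first by rewrite !ler0_norm; lra.
  by have := Heron (- u) (- v) (- w) d S (ltW d_gt0); rewrite !sqrrN; apply; lra.
Qed.

(** Sixteen times the squared area of a triangle with these squared sides. *)
Definition bound_form (m1 m2 m3 : R) : R :=
  2 * (m1 * m2 + m2 * m3 + m3 * m1) - (m1 ^+ 2 + m2 ^+ 2 + m3 ^+ 2).

Lemma phase_sqr_sum a b c (x := phase (a - b)) (y := phase (b - c))
    (z := phase (c - a)) :
  x ^+ 2 + y ^+ 2 + z ^+ 2 <= 2 * d ^+ 2.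
Proof.
have [S _] := phase_triple a b c; rewrite -/x -/y -/z in S.
have H h : 0 <= phase h * (d - phase h).
  by rewrite mulr_ge0 ?phase_ge0 // subr_ge0 phase_le.
have := H (a - b); have := H (b - c); have := H (c - a).
rewrite -/x -/y -/z.
have : 0 <= d * (2 * d - (x + y + z)) by rewrite mulr_ge0 ?subr_ge0 // ltW.
lra.
Qed.

(** In terms of the phases x, y, z the form is 48 - 8 (x^2 + y^2 + z^2) plus
    sixteen times the squared area of the triangle with sides x, y, z; and
    x^2 + y^2 + z^2 <= d (x + y + z) <= 2 d^2. *)
Lemma bound_form_ge a b c :
  16 * (3 - d ^+ 2) <= bound_form (4 - phase (a - b) ^+ 2)
    (4 - phase (b - c) ^+ 2) (4 - phase (c - a) ^+ 2).
Proof.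
have [_] := phase_triple a b c; have := phase_sqr_sum a b c.
rewrite /bound_form; lra.
Qed.

(** Equality holds in x (d - x) >= 0, for each phase, and in x + y + z <= 2 d. *)
Lemma bound_form_eq a b c (x := phase (a - b)) (y := phase (b - c))
    (z := phase (c - a)) :
  bound_form (4 - x ^+ 2) (4 - y ^+ 2) (4 - z ^+ 2) <= 16 * (3 - d ^+ 2) ->
  [\/ [/\ x = d, y = d & z = 0], [/\ x = d, y = 0 & z = d]
    | [/\ x = 0, y = d & z = d]].
Proof.
have [S T] := phase_triple a b c; rewrite -/x -/y -/z in S T.
have H h : 0 <= phase h * (d - phase h).
  by rewrite mulr_ge0 ?phase_ge0 // subr_ge0 phase_le.
have Hx := H (a - b); have Hy := H (b - c); have Hz := H (c - a).
rewrite -/x -/y -/z in Hx Hy Hz.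
have D : 0 <= d * (2 * d - (x + y + z)) by rewrite mulr_ge0 ?subr_ge0 // ltW.
rewrite /bound_form => Q.
have D0 : d * (2 * d - (x + y + z)) = 0 by lra.
have Ez t : t * (d - t) = 0 -> t = 0 \/ t = d.
  by move/eqP; rewrite mulf_eq0 subr_eq0 => /orP[/eqP|/eqP/esym]; auto.
have Ex : x = 0 \/ x = d by apply: Ez; lra.
have Ey : y = 0 \/ y = d by apply: Ez; lra.
have Ezz : z = 0 \/ z = d by apply: Ez; lra.
have {}S : x + y + z = 2 * d.
  by move/eqP: D0; rewrite mulf_eq0 gt_eqF //= subr_eq0 => /eqP.
have dn0 := d_gt0.
case: Ex Ey Ezz => ex [] ey [] ez; rewrite ex ey ez in S *; try lra.
- by apply: Or33.
- by apply: Or32.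
- by apply: Or31.
Qed.

End Phase.

(** * The boundary of a square *)

Section SquareBoundary.
Variables (R : realType) (N : nat).
Hypothesis N_gt0 : (0 < N)%N.

(** [bdry_x] and [bdry_y] run counterclockwise through the [4 * N] integer points on
    the boundary of the square of side [N], in half units, from the origin. *)
Definition bdry_x k := minn (minn k N) (3 * N - k)%N.
Definition bdry_y k := minn (minn (k - N) N)%N (4 * N - k)%N.
Definition bpt k : R * R := (2 * (bdry_x k)%:R, 2 * (bdry_y k)%:R).

Lemma bpt_side k : (k < 4 * N)%N ->
  [\/ exists t : nat, bpt k = (2 * t%:R, 0) /\ bpt k.+1 = (2 * t%:R + 2, 0),
      exists t : nat,
        bpt k = (2 * N%:R, 2 * t%:R) /\ bpt k.+1 = (2 * N%:R, 2 * t%:R + 2),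
      exists t : nat,
        bpt k = (2 * t%:R + 2, 2 * N%:R) /\ bpt k.+1 = (2 * t%:R, 2 * N%:R) |
      exists t : nat, bpt k = (0, 2 * t%:R + 2) /\ bpt k.+1 = (0, 2 * t%:R)].
Proof.
move=> k4.
have E a : 2 * a%:R + 2 = 2 * a.+1%:R :> R by rewrite -natr1; ring.
have E0 : 0 = 2 * 0%:R :> R by rewrite mulr0.
rewrite /bpt; have [k1|k1] := ltnP k N.
  apply: Or41; exists k; rewrite E E0.
  by split; congr (_ * _%:R, _ * _%:R); rewrite /bdry_x /bdry_y; lia.
have [k2|k2] := ltnP k (2 * N).
  apply: Or42; exists (k - N)%N; rewrite E.
  by split; congr (_ * _%:R, _ * _%:R); rewrite /bdry_x /bdry_y; lia.
have [k3|k3] := ltnP k (3 * N).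
  apply: Or43; exists (3 * N - k.+1)%N; rewrite E.
  by split; congr (_ * _%:R, _ * _%:R); rewrite /bdry_x /bdry_y; lia.
apply: Or44; exists (4 * N - k.+1)%N; rewrite E E0.
by split; congr (_ * _%:R, _ * _%:R); rewrite /bdry_x /bdry_y; lia.
Qed.

Lemma bpt_last : bpt (4 * N) = bpt 0.
Proof. by rewrite /bpt; congr (_ * _%:R, _ * _%:R); rewrite /bdry_x /bdry_y; lia. Qed.

Lemma sqdist_bpt k l : (k < 4 * N)%N -> (l < 4 * N)%N -> k != l ->
  4 <= sqdist (bpt k) (bpt l).
Proof.
move=> k4 l4 kl; rewrite /sqdist /bpt /=.
have : (bdry_x k != bdry_x l) || (bdry_y k != bdry_y l).
  by apply: contraNT kl; rewrite negb_or !negbK /bdry_x /bdry_y; lia.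
have H a b : a != b -> 4 <= (2 * a%:R - 2 * b%:R) ^+ 2 :> R.
  move=> ab; have : 1 <= `|(a%:Z - b%:Z)%:~R : R|.
    by rewrite -intr_norm -[1]/(1%:~R) ler_int; lia.
  rewrite intrB -!pmulrn -mulrBr exprMn -[X in _ * X]real_normK ?num_real //.
  by move: (`|_|) => x x1; have := sqr_ge0 (x - 1); lra.
by case/orP => /H h; rewrite (le_trans h) // ?lerDl ?lerDr sqr_ge0.
Qed.

Lemma orient_bpt k y : (k < 4 * N)%N ->
  [\/ orient (bpt k) (bpt k.+1) y = 2 * y.2,
      orient (bpt k) (bpt k.+1) y = 2 * (2 * N%:R - y.1),
      orient (bpt k) (bpt k.+1) y = 2 * (2 * N%:R - y.2) |
      orient (bpt k) (bpt k.+1) y = 2 * y.1].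
Proof.
move=> /bpt_side[] [t [-> ->]]; rewrite /orient /=;
  [apply: Or41|apply: Or42|apply: Or43|apply: Or44]; ring.
Qed.

Lemma sqdist_bptS k : (k < 4 * N)%N -> sqdist (bpt k) (bpt k.+1) = 4.
Proof. by move=> /bpt_side[] [t [-> ->]]; rewrite /sqdist /=; ring. Qed.

Definition in_square (y : R * R) : Prop :=
  [/\ 0 <= y.1, y.1 <= 2 * N%:R, 0 <= y.2 & y.2 <= 2 * N%:R].

Lemma orient_bpt_ge0 k y : (k < 4 * N)%N -> in_square y ->
  0 <= orient (bpt k) (bpt k.+1) y.
Proof. by move=> /(orient_bpt y)[] -> [? ? ? ?]; lra. Qed.

(** The sum telescopes once the contributions of the right and top sides, the
    only ones that do not pass through the origin, are added up by the minimum. *)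
Lemma fan_area (o : R * R) :
  \sum_(0 <= k < 4 * N) orient o (bpt k) (bpt k.+1) = 2 * (2 * N%:R) ^+ 2.
Proof.
pose G k : R := 4 * N%:R * (minn (k - N) (2 * N))%:R
  + ((bpt k).1 * o.2 - (bpt k).2 * o.1).
have E k : (0 <= k < 4 * N)%N -> orient o (bpt k) (bpt k.+1) = G k.+1 - G k.
  move=> /andP[_ k4].
  have E1 : orient o (bpt k) (bpt k.+1) =
    ((bpt k).1 * (bpt k.+1).2 - (bpt k).2 * (bpt k.+1).1)
    + ((bpt k.+1).1 * o.2 - (bpt k.+1).2 * o.1)
    - ((bpt k).1 * o.2 - (bpt k).2 * o.1) by rewrite /orient; ring.
  have -> : G k.+1 - G k = 4 * N%:R * ((minn (k.+1 - N) (2 * N))%:R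
      - (minn (k - N) (2 * N))%:R) + ((bpt k.+1).1 * o.2 - (bpt k.+1).2 * o.1)
    - ((bpt k).1 * o.2 - (bpt k).2 * o.1) by rewrite /G; ring.
  rewrite E1; congr (_ + _ - _).
  rewrite /bpt /=.
  have [k1|k1] := ltnP k N.
    have [-> ->] : bdry_y k = 0%N /\ bdry_y k.+1 = 0%N by rewrite /bdry_y; lia.
    have [-> ->] : minn (k.+1 - N) (2 * N) = 0%N /\ minn (k - N) (2 * N) = 0%N.
      by lia.
    by ring.
  have [k2|k2] := ltnP k (2 * N).
    have [-> ->] : bdry_x k = N /\ bdry_x k.+1 = N by rewrite /bdry_x; lia.
    have -> : bdry_y k.+1 = (bdry_y k).+1 by rewrite /bdry_y; lia.
    have -> : minn (k.+1 - N) (2 * N) = (minn (k - N) (2 * N)).+1 by lia.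
    by rewrite -!natr1; ring.
  have [k3|k3] := ltnP k (3 * N).
    have [-> ->] : bdry_y k = N /\ bdry_y k.+1 = N by rewrite /bdry_y; lia.
    have -> : bdry_x k = (bdry_x k.+1).+1 by rewrite /bdry_x; lia.
    have -> : minn (k.+1 - N) (2 * N) = (minn (k - N) (2 * N)).+1 by lia.
    by rewrite -!natr1; ring.
  have [-> ->] : bdry_x k = 0%N /\ bdry_x k.+1 = 0%N by rewrite /bdry_x; lia.
  have -> : minn (k.+1 - N) (2 * N) = minn (k - N) (2 * N) by lia.
  by ring.
rewrite (eq_big_nat _ _ E) telescope_sumr //.
rewrite /G bpt_last (_ : minn (4 * N - N) (2 * N) = (2 * N)%N); last by lia.
by rewrite (_ : minn (0 - N) (2 * N) = 0%N) ?natrM; [ring|lia].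
Qed.

(** The orientations of [o], the boundary points and [y] change sign around the
    square, since a positive combination of those at the four corners is 0. *)
Lemma fan_covers o y : 0 < o.1 < 2 * N%:R -> 0 < o.2 < 2 * N%:R ->
  in_square y ->
  exists2 k, (k < 4 * N)%N & in_tri y o (bpt k) (bpt k.+1).
Proof.
move=> /andP[p1 p2] /andP[q1 q2] ysq.
pose f k := orient o (bpt k) y.
have [[k k4 /andP[fk fk1]]|H] :=
    pselect (exists2 k, (k < 4 * N)%N & (0 <= f k) && (f k.+1 <= 0)).
  exists k => //; rewrite /in_tri fk orient_bpt_ge0 //=.
  have -> : orient (bpt k.+1) o y = - f k.+1 by rewrite /f /orient; ring.
  by rewrite oppr_ge0.
have up k : (k < 4 * N)%N -> 0 <= f k -> 0 < f k.+1.
  by move=> k4 fk; rewrite ltNge; apply/negP => fk1; apply: H; exists k; rewrite ?fk.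
have f4 : f (4 * N)%N = f 0 by rewrite /f bpt_last.
have W : (2 * N%:R - o.1) * (2 * N%:R - o.2) * f 0%N
    + o.1 * (2 * N%:R - o.2) * f N
    + o.1 * o.2 * f (2 * N)%N + (2 * N%:R - o.1) * o.2 * f (3 * N)%N = 0.
  have bE k a b : bdry_x k = a -> bdry_y k = b -> bpt k = (2 * a%:R, 2 * b%:R).
    by rewrite /bpt => -> ->.
  have b0 : bpt 0 = (0, 0).
    by rewrite (bE _ 0%N 0%N) ?mulr0 //; rewrite /bdry_x /bdry_y; lia.
  have b1 : bpt N = (2 * N%:R, 0).
    by rewrite (bE _ N 0%N) ?mulr0 //; rewrite /bdry_x /bdry_y; lia.
  have b2 : bpt (2 * N) = (2 * N%:R, 2 * N%:R).
    by rewrite (bE _ N N) //; rewrite /bdry_x /bdry_y; lia.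
  have b3 : bpt (3 * N) = (0, 2 * N%:R).
    by rewrite (bE _ 0%N N) ?mulr0 //; rewrite /bdry_x /bdry_y; lia.
  by rewrite /f b0 b1 b2 b3 /orient /=; ring.
have c0 : 0 < (2 * N%:R - o.1) * (2 * N%:R - o.2).
  by rewrite mulr_gt0 // subr_gt0.
have c1 : 0 < o.1 * (2 * N%:R - o.2) by rewrite mulr_gt0 // subr_gt0.
have c2 : 0 < o.1 * o.2 by rewrite mulr_gt0 // subr_gt0.
have c3 : 0 < (2 * N%:R - o.1) * o.2 by rewrite mulr_gt0 // subr_gt0.
exfalso.
have [[j j4 fj]|H2] := pselect (exists2 k, (k < 4 * N)%N & 0 <= f k).
  have up2 i k : 0 <= f i -> (i + k < 4 * N)%N -> 0 < f (i + k).+1.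
    move=> fi; elim: k => [|k IH] ik; first by rewrite addn0 in ik *; apply: up.
    by apply: up => //; rewrite addnS in ik *; apply/ltW/IH; exact: ltnW.
  have f0 : 0 < f 0%N.
    have e4 : (4 * N)%N = (j + (4 * N - j.+1)).+1.
      by move: j4; clear; lia.
    by rewrite -f4 e4; apply: up2 fj _; rewrite -e4.
  have fpos k : (k <= 4 * N)%N -> 0 < f k.
    case: k => [|k] // k4; rewrite -[k]add0n; apply: up2; first exact: ltW.
    exact: k4.
  suff : 0 < (0 : R) by rewrite ltxx.
  rewrite -{2}W !addr_gt0 //; apply: mulr_gt0 => //; apply: fpos => //;
    by rewrite ?leq_pmull // leq_mul2r orbT.
have fneg k : (k < 4 * N)%N -> 0 < - f k.
  by move=> k4; rewrite oppr_gt0 ltNge; apply/negP => h; apply: H2; exists k.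
suff : 0 < - (0 : R) by rewrite oppr0 ltxx.
rewrite -{2}W !opprD -!mulrN !addr_gt0 //; apply: mulr_gt0 => //;
  apply: fneg; rewrite ?muln_gt0 ?ltn_pmul2r //; exact: ltn_Pmull.
Qed.

End SquareBoundary.

(** * Counting strings over a square *)

Lemma sum_cyclic_shift (M : nat) (g : nat -> nat) : g M = g 0%N ->
  (\sum_(0 <= k < M) g k.+1 = \sum_(0 <= k < M) g k)%N.
Proof.
move=> gM; apply/eqP; rewrite -(eqn_add2l (g 0%N)) -big_nat_recl //.
by rewrite big_nat_recr //= gM addnC.
Qed.

Section FanBalance.
Variables (V : finType) (o : V) (B : nat -> V) (M : nat).
Hypothesis BM : B M = B 0.

Definition fan := [seq (o, B k, B k.+1) | k <- iota 0 M].
Definition boundary (e : V * V) : bool :=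
  [exists k : 'I_M, is_edge (B k) (B k.+1) e || is_edge (B k.+1) (B k) e].

Lemma boundary_swap e : boundary (swap e) = boundary e.
Proof. by apply: eq_existsb => k; rewrite !is_edge_swap orbC. Qed.

Lemma edge_count_fan e : edge_count fan e = (\sum_(0 <= k < M)
  (is_edge o (B k) e + is_edge (B k) (B k.+1) e + is_edge (B k.+1) o e))%N.
Proof.
rewrite /index_iota subn0 /fan; elim: (iota 0 M) => [|k s IH].
  by rewrite big_nil.
by rewrite big_cons /= edge_count_cons IH.
Qed.

Lemma balanced_fan : balanced boundary fan.
Proof.
apply/balancedP => e /existsPn nbd; rewrite !edge_count_fan !big_split /=.
have z e' : (forall k : 'I_M, ~~ is_edge (B k) (B k.+1) e') ->
    (\sum_(0 <= k < M) is_edge (B k) (B k.+1) e' = 0)%N.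
  by move=> H; rewrite big_mkord big1 // => k _; rewrite (negbTE (H k)).
rewrite !z; first last.
- by move=> k; have := nbd k; rewrite negb_or => /andP[].
- by move=> k; have := nbd k; rewrite negb_or is_edge_swap => /andP[].
rewrite !addn0 addnC; congr (_ + _)%N.
- under [RHS]eq_bigr do rewrite is_edge_swap.
  by apply: (sum_cyclic_shift (g := fun k => is_edge (B k) o e : nat)); rewrite BM.
- under [RHS]eq_bigr do rewrite is_edge_swap.
  by rewrite (sum_cyclic_shift (g := fun k => is_edge o (B k) e : nat)) // BM.
Qed.

Lemma mem_fan t : t \in darts fan -> exists2 k, (k < M)%N &
  [\/ t = (o, B k, B k.+1), t = (B k, B k.+1, o) | t = (B k.+1, o, B k)].
Proof.
move=> /flattenP[s /mapP[u /mapP[k]]]; rewrite mem_iota add0n => /andP[_ kM] -> ->.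
rewrite !inE => /or3P[] /eqP ->; exists k => //.
- by apply: Or31. - by apply: Or32. - by apply: Or33.
Qed.

End FanBalance.

Section SquareBound.
Variables (R : realType) (d : R).
Hypotheses (d_ge1 : 1 <= d) (d_le : d ^+ 2 <= 2).

(** The triangulation has the given points as inner vertices and, as boundary
    vertices, the points spaced 2 apart on the boundary of the square, with
    height 0.  It has at least [2 * n] triangles, each of which contributes at
    least [Num.sqrt (3 - d ^+ 2)] to the area of the square. *)
Theorem square_bound n (pos : 'I_n -> R * R) (ht : 'I_n -> R) N :
  (forall i j, i != j ->
     4 <= sqdist (pos i) (pos j) + phase d (ht i - ht j) ^+ 2) ->
  (forall i, 2 <= (pos i).1 <= 2 * N%:R - 2 /\ 2 <= (pos i).2 <= 2 * N%:R - 2) ->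
  n%:R * (2 * Num.sqrt (3 - d ^+ 2)) <= (2 * N%:R) ^+ 2.
Proof.
case: n pos ht => [|n] pos ht sep0 sq; first by rewrite mul0r sqr_ge0.
have d1 := d_ge1; have d2 := d_le; have d_gt0 : 0 < d by lra.
have N0 : (0 < N)%N.
  by case: N sq => // /(_ ord0)[]; rewrite mulr0 => /andP[]; lra.
have N4 : (0 < 4 * N)%N by lia.
(* the given points, then the boundary points *)
pose V : finType := ('I_n.+1 + 'I_(4 * N))%type.
pose P (v : V) := match v with inl i => pos i | inr k => bpt R N k end.
pose h (v : V) := match v with inl i => ht i | inr k => 0 end.
pose m v w := 4 - phase d (h v - h w) ^+ 2.
have phase2 a : 0 <= phase d a ^+ 2 <= 2.
  rewrite sqr_ge0 /= (le_trans _ d_le) //.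
  by rewrite lerXn2r ?nnegrE ?phase_ge0 ?phase_le // ltW.
have sqC p q : sqdist p q = sqdist q p :> R by rewrite /sqdist; ring.
have farB i k : 4 <= sqdist (pos i) (bpt R N (k : 'I_(4 * N))).
  have [/andP[a1 a2] /andP[b1 b2]] := sq i.
  have H (x y : R) : 2 <= x -> 4 <= x ^+ 2 + y ^+ 2.
    move=> x2; have : 0 <= (x - 2) ^+ 2 := sqr_ge0 _.
    by have := sqr_ge0 y; lra.
  have [] := bpt_side R N0 (ltn_ord k) => -[t [-> _]]; rewrite /sqdist /=.
  - by rewrite addrC; apply: H; lra.
  - by rewrite -sqrrN opprB; apply: H; lra.
  - by rewrite addrC -sqrrN opprB; apply: H; lra.
  - by apply: H; lra.
have sepB v k : v != inr k -> 4 <= sqdist (P v) (bpt R N (k : 'I_(4 * N))).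
  by case: v => [i _|l lk]; [exact: farB | apply: sqdist_bpt].
have sep v w : v != w -> m v w <= sqdist (P v) (P w).
  case: v w => [i|k] [j|l] vw; rewrite /m lerBlDr.
  - exact: sep0.
  - by rewrite ler_wpDr ?sqr_ge0 // sepB.
  - by rewrite ler_wpDr ?sqr_ge0 // sqC sepB.
  - by rewrite ler_wpDr ?sqr_ge0 // sepB.
have injP : injective P.
  move=> v w vw; apply/eqP; apply: contraT => /sep.
  rewrite vw /m /sqdist !subrr expr0n /= addr0 => h1.
  by have /andP[_] := phase2 (h v - h w); lra.
pose B k : V := inr (Ordinal (ltn_pmod k N4)).
have BM : B (4 * N)%N = B 0%N.
  by congr inr; apply/val_inj; rewrite /= modnn mod0n.
have PB k : (k <= 4 * N)%N -> P (B k) = bpt R N k.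
  rewrite leq_eqVlt => /orP[/eqP ->|k4]; last by rewrite /= modn_small.
  by rewrite BM /= mod0n bpt_last.
pose o : V := inl ord0.
pose L0 := fan o B (4 * N); pose bd := boundary B (4 * N).
have bdP e : bd e -> exists2 k : 'I_(4 * N), True &
    (e = (B k, B k.+1) \/ e = (B k.+1, B k)).
  move=> /existsP[k /orP[] /andP[/eqP e1 /eqP e2]]; exists k => //.
    by left; rewrite [e]surjective_pairing -e1 -e2.
  by right; rewrite [e]surjective_pairing -e1 -e2.
have inner i : in_square N (pos i).
  by have [/andP[? ?] /andP[? ?]] := sq i; split; lra.
have orB k i : (k < 4 * N)%N -> 0 < orient (P (B k)) (P (B k.+1)) (pos i).
  move=> k4; rewrite (PB _ (ltnW k4)) (PB _ k4).
  have [/andP[? ?] /andP[? ?]] := sq i.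
  by have [] := orient_bpt N0 (pos i) k4 => ->; lra.
have T0 : triangulation P bd (in_square N) [pred v | (v == o) || (if v is inr _ then true else false)] L0.
  split.
  - apply/allP => t /mem_fan[k k4]; have := orB k ord0 k4.
    have E a b c : orient a b c = orient b c a :> R by rewrite -orient_rot.
    by move=> ob [] ->; rewrite /ori /=; [rewrite E|..|rewrite -E].
  - exact: balanced_fan.
  - move=> y ysq.
    have [/andP[a1 a2] /andP[b1 b2]] := sq ord0.
    have [||k k4 yin] := @fan_covers R N N0 (pos ord0) y _ _ ysq; try lra.
    apply/hasP; exists (o, B k, B k.+1).
      by apply/mem_darts/map_f; rewrite mem_iota.
    change (in_tri y (pos ord0) (P (B k)) (P (B k.+1))).
    by rewrite (PB _ (ltnW k4)) (PB _ k4).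
  - by apply/allP => t /mem_fan[k k4] [] ->.
(* the fan has the first point as its apex; the others are inserted *)
pose s : seq V := [seq inl (lift ord0 i) | i <- enum 'I_n].
have us : uniq s.
  rewrite /s map_inj_uniq; first exact: enum_uniq.
  move=> a b ab; apply: (@lift_inj _ ord0).
  exact: (congr1 (fun v : V => if v is inl i then i else ord0) ab).
have ss : size s = n by rewrite size_map size_enum_ord.
have [|S [L [sL aL [Lpos Lbal _ _]]]] := points_insert T0 us _ injP.
  move=> x /mapP[i _ ->]; split; [by []|exact: inner|].
  move=> e /bdP[k _ eB]; have ok := orB k (lift ord0 i) (ltn_ord k).
  have E a b c : orient a b c = - orient b a c :> R by rewrite /orient; ring.
  apply/eqP; case: eB => ->; first by rewrite gt_eqF.
  by rewrite E oppr_eq0 gt_eqF.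
have aL0 : area P L0 = 3 * (2 * (2 * N%:R) ^+ 2).
  rewrite /area darts_sum -(fan_area N0 (pos ord0)) mulr_sumr /L0 /fan big_map.
  rewrite /index_iota subn0 big_seq [RHS]big_seq; apply: eq_bigr => k.
  rewrite mem_iota add0n => /andP[_ k4]; rewrite !ori_rot.
  rewrite -(PB _ (ltnW k4)) -(PB _ k4) -[orient _ _ _]/(ori P (o, B k, B k.+1)).
  by ring.
have A0 : 0 <= 3 - d ^+ 2 by lra.
have main : 3 * (4 * Num.sqrt (3 - d ^+ 2)) * (size L)%:R <= 2 * area P L.
apply: (area_lower_bound (m := m) Lpos Lbal).
- exact: boundary_swap.
- move=> p q r pqbd pqr; have [pq qr rp] := ori_neq pqr.
  rewrite /= in pq qr rp.
  have D : 0 <= dotat (P r) (P p) (P q).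
    have -> : dotat (P r) (P p) (P q) = (sqdist (P r) (P p) + sqdist (P r) (P q)
      - sqdist (P p) (P q)) / 2 by rewrite /dotat /sqdist; field.
    have sB v l : v != B l -> 4 <= sqdist (P v) (P (B l)) by exact: sepB.
    have h3 : sqdist (P p) (P q) = 4.
      have [k _ [[-> ->]|[-> ->]]] := bdP _ pqbd; have k4 := ltn_ord k.
        by rewrite (PB _ (ltnW k4)) (PB _ k4) (sqdist_bptS R N0 k4).
      by rewrite sqC (PB _ (ltnW k4)) (PB _ k4) (sqdist_bptS R N0 k4).
    have [k1 [k2 [pB qB]]] : exists k1 k2, p = B k1 /\ q = B k2.
      have [k _ [[-> ->]|[-> ->]]] := bdP _ pqbd.
        by exists k, k.+1.
      by exists k.+1, k.
    have h1 : 4 <= sqdist (P r) (P p) by rewrite pB; apply: sB; rewrite -pB.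
    have h2 : 4 <= sqdist (P r) (P q).
      by rewrite qB; apply: sB; rewrite -qB eq_sym.
    by lra.
  by rewrite /cot /cotat divr_ge0 // ltW.
- by move=> p q; rewrite /m -phaseN // opprB.
- exact: sep.
- move=> p q r pqr.
  have m_gt0 v w : 0 < m v w.
    by have /andP[_] := phase2 (h v - h w); rewrite /m; lra.
  apply: pedoe_cot => //.
  + rewrite exprMn sqr_sqrtr // (_ : 4 ^+ 2 = 16); last by ring.
    exact: bound_form_ge.
  + by apply: cot_cot; rewrite gt_eqF.
  + exact: cotD_gt0.
move: main; rewrite aL aL0 sL size_map size_iota ss natrD natrM [n.+1%:R]mulrSr.
set A := Num.sqrt _; have : 0 <= A by apply: sqrtr_ge0.
have : 1 <= N%:R :> R by rewrite ler1n.
rewrite natrM => Nge1 Age0; have : 0 <= A * (N%:R - 1).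
  by rewrite mulr_ge0 ?subr_ge0.
move: Nge1 Age0; clearbody A; clear; move: n%:R N%:R => x y; lra.
Qed.

End SquareBound.

(** * Coordinates in space *)

Section Coordinates.
Variable R : realType.
Implicit Types (u v w : 'rV[R]_3) (p : R * R * R).

Definition x1 u : R := u 0 (inord 0).
Definition x2 u : R := u 0 (inord 1).
Definition x3 u : R := u 0 (inord 2).
Definition row3 p : 'rV[R]_3 := \row_i nth 0 [:: p.1.1; p.1.2; p.2] i.

Lemma x1_row3 p : x1 (row3 p) = p.1.1. Proof. by rewrite /x1 mxE inordK. Qed.
Lemma x2_row3 p : x2 (row3 p) = p.1.2. Proof. by rewrite /x2 mxE inordK. Qed.
Lemma x3_row3 p : x3 (row3 p) = p.2. Proof. by rewrite /x3 mxE inordK. Qed.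

Lemma x1D u v : x1 (u + v) = x1 u + x1 v. Proof. by rewrite /x1 mxE. Qed.
Lemma x2D u v : x2 (u + v) = x2 u + x2 v. Proof. by rewrite /x2 mxE. Qed.
Lemma x3D u v : x3 (u + v) = x3 u + x3 v. Proof. by rewrite /x3 mxE. Qed.
Lemma x1N u : x1 (- u) = - x1 u. Proof. by rewrite /x1 mxE. Qed.
Lemma x2N u : x2 (- u) = - x2 u. Proof. by rewrite /x2 mxE. Qed.
Lemma x3N u : x3 (- u) = - x3 u. Proof. by rewrite /x3 mxE. Qed.
Lemma x1Z a u : x1 (a *: u) = a * x1 u. Proof. by rewrite /x1 mxE. Qed.
Lemma x2Z a u : x2 (a *: u) = a * x2 u. Proof. by rewrite /x2 mxE. Qed.
Lemma x3Z a u : x3 (a *: u) = a * x3 u. Proof. by rewrite /x3 mxE. Qed.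
Lemma x10 : x1 0 = 0. Proof. by rewrite /x1 mxE. Qed.
Lemma x20 : x2 0 = 0. Proof. by rewrite /x2 mxE. Qed.
Lemma x30 : x3 0 = 0. Proof. by rewrite /x3 mxE. Qed.
Lemma x1e3 : x1 (e3 R) = 0.
Proof. by rewrite /x1 mxE eqxx /= -val_eqE /= !inordK. Qed.
Lemma x2e3 : x2 (e3 R) = 0.
Proof. by rewrite /x2 mxE eqxx /= -val_eqE /= !inordK. Qed.
Lemma x3e3 : x3 (e3 R) = 1.
Proof. by rewrite /x3 mxE !eqxx. Qed.
Lemma x1Mz u (k : int) : x1 (u *~ k) = x1 u * k%:~R.
Proof. by rewrite -scaler_int x1Z mulrC. Qed.
Lemma x2Mz u (k : int) : x2 (u *~ k) = x2 u * k%:~R.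
Proof. by rewrite -scaler_int x2Z mulrC. Qed.
Lemma x3Mz u (k : int) : x3 (u *~ k) = x3 u * k%:~R.
Proof. by rewrite -scaler_int x3Z mulrC. Qed.

Definition coordE := (x1D, x2D, x3D, x1N, x2N, x3N, x1Z, x2Z, x3Z, x1Mz, x2Mz,
  x3Mz, x10, x20, x30, x1e3, x2e3, x3e3, x1_row3, x2_row3, x3_row3).

Lemma ord3P (i : 'I_3) : [\/ i = inord 0, i = inord 1 | i = inord 2].
Proof.
case: i => [[|[|[|]]]] // h; [apply: Or31|apply: Or32|apply: Or33];
  by apply/val_inj; rewrite /= inordK.
Qed.

Lemma row3P u v : x1 u = x1 v -> x2 u = x2 v -> x3 u = x3 v -> u = v.
Proof.
move=> h1 h2 h3; apply/rowP => i.
by have [] := ord3P i => ->.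
Qed.

Lemma dotE u v : dot u v = x1 u * x1 v + x2 u * x2 v + x3 u * x3 v.
Proof.
rewrite /dot mxE !big_ord_recr big_ord0 /= add0r !mxE.
by congr (_ * _ + _ * _ + _ * _); rewrite /x1 /x2 /x3; congr (_ 0 _);
  apply/val_inj; rewrite /= inordK.
Qed.

Lemma dot_ge0 u : 0 <= dot u u.
Proof. by rewrite dotE -!expr2 !addr_ge0 ?sqr_ge0. Qed.

Lemma enorm_ge0 u : 0 <= enorm u.
Proof. exact: sqrtr_ge0. Qed.

Lemma enorm_sqr u : enorm u ^+ 2 = dot u u.
Proof. by rewrite sqr_sqrtr // dot_ge0. Qed.

Lemma enorm_le u r : 0 <= r -> (enorm u <= r) = (dot u u <= r ^+ 2).
Proof. by move=> r0; rewrite -enorm_sqr ler_sqr ?nnegrE ?enorm_ge0. Qed.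

Lemma enorm_ge u r : 0 <= r -> (r <= enorm u) = (r ^+ 2 <= dot u u).
Proof. by move=> r0; rewrite -enorm_sqr ler_sqr ?nnegrE ?enorm_ge0. Qed.

Lemma enorm_eq u r : 0 <= r -> dot u u = r ^+ 2 -> enorm u = r.
Proof. by move=> r0; rewrite /enorm => ->; rewrite sqrtr_sqr ger0_norm. Qed.

Lemma enormN u : enorm (- u) = enorm u.
Proof. by rewrite /enorm; congr Num.sqrt; rewrite !dotE !coordE; ring. Qed.

Lemma enormB u v : enorm (u - v) = enorm (v - u).
Proof. by rewrite -enormN opprB. Qed.

Lemma enormZ a u : enorm (a *: u) = `|a| * enorm u.
Proof.
apply: enorm_eq; first by rewrite mulr_ge0 ?enorm_ge0.
by rewrite exprMn real_normK ?num_real // enorm_sqr !dotE !coordE; ring.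
Qed.

Lemma dot_le_enorm u v : dot u v <= enorm u * enorm v.
Proof.
have [h|h] := leP (dot u v) 0.
  by rewrite (le_trans h) // mulr_ge0 ?enorm_ge0.
rewrite -ler_sqr ?nnegrE ?(ltW h) ?mulr_ge0 ?enorm_ge0 //.
rewrite exprMn !enorm_sqr -subr_ge0 !dotE.
have -> : (x1 u * x1 u + x2 u * x2 u + x3 u * x3 u)
   * (x1 v * x1 v + x2 v * x2 v + x3 v * x3 v)
   - (x1 u * x1 v + x2 u * x2 v + x3 u * x3 v) ^+ 2
  = (x1 u * x2 v - x2 u * x1 v) ^+ 2 + (x1 u * x3 v - x3 u * x1 v) ^+ 2
    + (x2 u * x3 v - x3 u * x2 v) ^+ 2 by ring.
by rewrite !addr_ge0 ?sqr_ge0.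
Qed.

Lemma enormD u v : enorm (u + v) <= enorm u + enorm v.
Proof.
rewrite enorm_le ?addr_ge0 ?enorm_ge0 // sqrrD !enorm_sqr.
have -> : dot (u + v) (u + v) = dot u u + dot u v *+ 2 + dot v v.
  by rewrite !dotE !coordE; ring.
by rewrite lerD2r lerD2l lerMn2r dot_le_enorm.
Qed.

Lemma enorm_tri u v w : enorm (u - w) <= enorm (u - v) + enorm (v - w).
Proof. by rewrite (le_trans _ (enormD _ _)) // addrA subrK. Qed.

Lemma cballE c r u : 0 <= r -> cball c r u <->
  (x1 u - x1 c) ^+ 2 + (x2 u - x2 c) ^+ 2 + (x3 u - x3 c) ^+ 2 <= r ^+ 2.
Proof.
move=> r0; rewrite /cball /closed_ball_ /= enorm_le // dotE !coordE.
rewrite (_ : _ + _ = (x1 u - x1 c) ^+ 2 + (x2 u - x2 c) ^+ 2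
  + (x3 u - x3 c) ^+ 2) //; ring.
Qed.

End Coordinates.

(** * Integrals of circular sections *)

Section Integrals.
Variable R : realType.
Notation mu := (@lebesgue_measure R).

Lemma derive_LRcontinuous (F f : R -> R) a b :
  (forall x, is_derive x (1 : R) F (f x)) -> derivable_oo_LRcontinuous F a b.
Proof.
move=> dF.
have cF : continuous F.
  move=> x; apply/differentiable_continuous/derivable1_diffP.
  by have [] := dF x.
split.
- by move=> x _; have [] := dF x.
- by apply: cvg_at_right_filter; apply: cF.
- by apply: cvg_at_left_filter; apply: cF.
Qed.

Lemma integral_derive (F f : R -> R) a b : a < b ->
  (forall x, is_derive x (1 : R) F (f x)) -> continuous f ->
  (\int[mu]_(x in `[a, b]) (f x)%:E = (F b - F a)%:E)%E.
Proof.
move=> ab dF cf; rewrite (@continuous_FTC2 _ f F) //.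
- by apply: continuous_subspaceT.
- exact: derive_LRcontinuous.
- by move=> x _; rewrite derive1E; apply: derive_val.
Qed.

Lemma continuous_subX (c : R) n : continuous (fun y : R => (y - c) ^+ n).
Proof.
move=> y; apply: (@continuous_comp _ _ _ (fun y : R => y - c)
  (fun y => y ^+ n)); last exact: exprn_continuous.
by apply: cvgB; [exact: cvg_id|exact: cvg_cst].
Qed.

Lemma sin_lt : {in `[(- (pi / 2) : R), pi / 2] &, {homo @sin R : x y / x < y}}.
Proof.
move=> x y; rewrite !in_itv /= => /andP[x1 x2] /andP[y1 y2] xy.
rewrite -[x]opprK -[y]opprK.
have E z : sin z = cos (pi / 2 - z) :> R.
  by rewrite cosB cos_pihalf sin_pihalf mul0r add0r mul1r.
by rewrite !opprK !E ltr_cos ?in_itv /=; lra.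
Qed.

(** The substitution y = c + s sin t turns the integrand into 2 s^2 cos^2 t. *)
Lemma half_disc (c s : R) : 0 < s ->
  (\int[mu]_(y in `[(c - s)%R, (c + s)%R]) (2 * Num.sqrt (s ^+ 2 - (y - c) ^+ 2))%:E
    = (pi * s ^+ 2)%:E)%E.
Proof.
move=> s0.
pose F (t : R) : R := c + s * sin t.
pose G (y : R) : R := 2 * Num.sqrt (s ^+ 2 - (y - c) ^+ 2).
have pi0 := pi_gt0 R.
have Fa : F (- (pi / 2)) = c - s by rewrite /F sinN sin_pihalf; ring.
have Fb : F (pi / 2) = c + s by rewrite /F sin_pihalf; ring.
have dF t : is_derive t (1 : R) F (s * cos t).
  apply: is_derive_eq. rewrite /GRing.scale /=; ring.
have F' : derive1 F = (fun t => s * cos t).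
  by apply/funext => t; rewrite derive1E; apply: derive_val.
have cF' : continuous (derive1 F).
  by rewrite F' => t; apply: cvgM; [exact: cvg_cst|exact: continuous_cos].
have cG : continuous G.
  move=> y; apply: cvgM; first exact: cvg_cst.
  apply: continuous_comp; last exact: sqrt_continuous.
  apply: cvgB; first exact: cvg_cst.
  exact: continuous_subX.
transitivity (\int[mu]_(t in `[(- (pi / 2))%R, (pi / 2)%R])
    (((G \o F) * derive1 F)%R t)%:E)%E.
  rewrite -Fa -Fb; apply: integration_by_substitution_increasing.
  - lra.
  - by move=> x y xI yI xy; rewrite /F ltrD2l ltr_pM2l // sin_lt.
  - by move=> t _; apply: cF'.
  - by apply/cvg_ex; eexists; apply: cvg_at_right_filter; apply: cF'.
  - by apply/cvg_ex; eexists; apply: cvg_at_left_filter; apply: cF'.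
  - exact: (@derive_LRcontinuous F (fun t => s * cos t) _ _ dF).
  - exact: continuous_subspaceT.
pose H (t : R) : R := s ^+ 2 * (t + sin t * cos t).
transitivity (\int[mu]_(t in `[(- (pi / 2))%R, (pi / 2)%R])
    (2 * s ^+ 2 * cos t ^+ 2)%:E)%E.
  apply: eq_integral => t; rewrite inE /= in_itv /= => tI.
  have -> : ((G \o F) * derive1 F)%R t = G (F t) * (s * cos t) by rewrite F'.
  rewrite /G /F addrAC subrr add0r exprMn -[X in X - _]mulr1 -mulrBr.
  rewrite -cos2sin2 -exprMn sqrtr_sqr ger0_norm; first by congr EFin; ring.
  by rewrite mulr_ge0 ?(ltW s0) // cos_ge0_pihalf.
have dH (t : R) : is_derive t (1 : R) H (2 * s ^+ 2 * cos t ^+ 2).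
  apply: is_derive_eq.
  have := cos2Dsin2 t; set c' := cos t; set s' := sin t => h.
  have {}h : s' * s' = 1 - c' ^+ 2 by rewrite -h; ring.
  rewrite /GRing.scale /= !mulrDr !mulrN h; ring.
have cH : continuous (fun t : R => 2 * s ^+ 2 * cos t ^+ 2).
  move=> t; apply: cvgM; first exact: cvg_cst.
  by apply: cvgM; exact: continuous_cos.
rewrite (integral_derive _ dH cH); last by lra.
by rewrite /H !sinN !cosN cos_pihalf; congr EFin; field.
Qed.

Lemma ball_slices (c r : R) : 0 < r ->
  (\int[mu]_(x in `[(c - r)%R, (c + r)%R]) (pi * (r ^+ 2 - (x - c) ^+ 2))%:E
    = (4 / 3 * pi * r ^+ 3)%:E)%E.
Proof.
move=> r0; pose H (x : R) : R := pi * (r ^+ 2 * x - 3^-1 * (x - c) ^+ 3).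
have dH (x : R) : is_derive x (1 : R) H (pi * (r ^+ 2 - (x - c) ^+ 2)).
  by rewrite /H; apply: is_derive_eq; rewrite /GRing.scale /=; field.
have cH : continuous (fun x : R => pi * (r ^+ 2 - (x - c) ^+ 2)).
  move=> x; apply: cvgM; first exact: cvg_cst.
  apply: cvgB; first exact: cvg_cst.
  exact: continuous_subX.
rewrite (integral_derive _ dH cH); last by lra.
by rewrite /H; congr EFin; field.
Qed.

End Integrals.

(** * Volume of balls *)

Section BallVolume.
Variable R : realType.
Notation mu := (@lebesgue_measure R).

Definition solid_ball (a : R * R * R) (r : R) : set (R * R * R) :=
  [set p | (p.1.1 - a.1.1) ^+ 2 + (p.1.2 - a.1.2) ^+ 2 + (p.2 - a.2) ^+ 2
             <= r ^+ 2].

Lemma measurable_fun_p11 : measurable_fun setT (fun p : R * R * R => p.1.1).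
Proof. exact: measurableT_comp. Qed.
Lemma measurable_fun_p12 : measurable_fun setT (fun p : R * R * R => p.1.2).
Proof. exact: measurableT_comp. Qed.
Lemma measurable_fun_p2 : measurable_fun setT (fun p : R * R * R => p.2).
Proof. exact: measurable_snd. Qed.

Lemma measurable_fun_sqr d (T : measurableType d) (f : T -> R) (a : R) :
  measurable_fun setT f -> measurable_fun setT (fun x => (f x - a) ^+ 2).
Proof. by move=> mf; apply: measurable_funX; apply: measurable_funB. Qed.

Lemma measurable_solid_ball a r : measurable (solid_ball a r).
Proof.
have mf : measurable_fun setT (fun p : R * R * R =>
    (p.1.1 - a.1.1) ^+ 2 + (p.1.2 - a.1.2) ^+ 2 + (p.2 - a.2) ^+ 2).
  apply: measurable_funD; first apply: measurable_funD;
    apply: measurable_fun_sqr.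
  - exact: measurable_fun_p11.
  - exact: measurable_fun_p12.
  - exact: measurable_fun_p2.
rewrite (_ : solid_ball a r = setT `&` (fun p : R * R * R =>
    (p.1.1 - a.1.1) ^+ 2 + (p.1.2 - a.1.2) ^+ 2 + (p.2 - a.2) ^+ 2)
  @^-1` [set` `]-oo, r ^+ 2]%R]).
  by apply: mf => //; exact: measurable_itv.
by apply/seteqP; split=> p /=; rewrite in_itv /=; [split|case].
Qed.

Lemma chord_measure (c t : R) :
  mu [set z | (z - c) ^+ 2 <= t] = (2 * Num.sqrt t)%:E.
Proof.
have [t0|t0] := leP 0 t; last first.
  rewrite (_ : [set _ | _] = set0) ?measure0 ?ltr0_sqrtr ?mulr0 //.
  apply/seteqP; split=> // z /= zt.
  by have := sqr_ge0 (z - c); rewrite leNgt (le_lt_trans zt t0).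
rewrite (_ : [set _ | _] = [set` `[c - Num.sqrt t, c + Num.sqrt t]%R]).
  rewrite lebesgue_measure_itv /= lte_fin.
  have [st|st] := ltP; first by rewrite -EFinB; congr EFin; ring.
  have s0 : Num.sqrt t = 0.
    by apply/eqP; rewrite eq_le sqrtr_ge0 andbT; lra.
  by rewrite s0 mulr0.
have E z : ((z - c) ^+ 2 <= t) = (`|z - c| <= Num.sqrt t).
  rewrite -[LHS]/(_ <= t) -[X in _ <= X](sqr_sqrtr t0) -[X in X <= _]real_normK ?num_real //.
  by rewrite ler_sqr ?nnegrE ?sqrtr_ge0.
apply/seteqP; split=> z /=; rewrite in_itv /= E ler_norml; lra.
Qed.

(** Vertical chords first, then half discs ([half_disc]), then slices
    ([ball_slices]). *)
Lemma volume_solid_ball a r : 0 < r ->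
  ((mu \x mu) \x mu)%E (solid_ball a r) = (4 / 3 * pi * r ^+ 3)%:E.
Proof.
move=> r0; transitivity (\int[mu \x mu]_q mu (xsection (solid_ball a r) q))%E.
  by [].
pose f (q : R * R) : R :=
  2 * Num.sqrt (r ^+ 2 - (q.1 - a.1.1) ^+ 2 - (q.2 - a.1.2) ^+ 2).
have mf : measurable_fun setT f.
  apply: measurable_funM => //; apply: measurableT_comp.
    exact: (continuous_measurable_fun (@sqrt_continuous R)).
  apply: measurable_funB; first apply: measurable_funB => //;
    exact: measurable_fun_sqr.
transitivity (\int[mu \x mu]_q (f q)%:E)%E.
  apply: eq_integral => q _; rewrite /f -(chord_measure a.2).
  congr (mu _); apply/seteqP; split=> z; rewrite /xsection /= inE /solid_ball /=;
    rewrite -!lerBrDl ?lerBrDr => h; lra.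
rewrite fubini_tonelli1; first last.
- by move=> q; rewrite lee_fin mulr_ge0 ?sqrtr_ge0.
- exact/measurable_EFinP.
transitivity (\int[mu]_(x in `[(a.1.1 - r)%R, (a.1.1 + r)%R])
   (pi * (r ^+ 2 - (x - a.1.1) ^+ 2))%:E)%E; last exact: ball_slices.
rewrite [RHS]integral_mkcond; apply: eq_integral => x _. 
rewrite /fubini_F /f patchE /=.
set t := r ^+ 2 - (x - a.1.1) ^+ 2.
have tE : (a.1.1 - r <= x <= a.1.1 + r) = (0 <= t).
  rewrite /t subr_ge0 -[X in X <= _ ^+ 2]real_normK ?num_real //.
  by rewrite ler_sqr ?nnegrE ?(ltW r0) // ler_norml; apply/idP/idP; lra.
have -> : (x \in `[a.1.1 - r, a.1.1 + r]%classic) = (0 <= t).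
  by rewrite -tE; apply/idP/idP => [/set_mem|h]; [|apply/mem_set];
    rewrite /= in_itv.
have [t0|t0|t0] := ltgtP t 0.
- apply: integral0_eq => y _; rewrite ltr0_sqrtr ?mulr0 //.
  by have := sqr_ge0 (y - a.1.2); lra.
- rewrite -(sqr_sqrtr (ltW t0)) -(half_disc a.1.2) ?sqrtr_gt0 //.
  rewrite [RHS]integral_mkcond; apply: eq_integral => y _.
  rewrite patchE; case: ifPn => //; rewrite notin_setE /= in_itv /= => /negP ny.
  rewrite ltr0_sqrtr ?mulr0 // subr_lt0 -[ltRHS]real_normK ?num_real //.
  rewrite ltr_sqr ?nnegrE ?sqrtr_ge0 // ltNge ler_norml.
  by apply: contra ny; lra.
- rewrite t0 mulr0; apply: integral0_eq => y _; rewrite -[Num.sqrt _]/_.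
  by rewrite ler0_sqrtr ?mulr0 // sub0r oppr_le0 sqr_ge0.
Qed.

End BallVolume.

(** * Boxes over a sheared planar grid *)

Section Tiles.
Variable R : realType.
Notation mu := (@lebesgue_measure R).
Notation mu3 := ((mu \x mu) \x mu)%E.

Lemma seq_set_cons (I : eqType) (i : I) s :
  [set` i :: s] = i |` [set` s] :> set I.
Proof.
apply/seteqP; split=> x /=; rewrite inE; first by case/orP=> [/eqP|]; [left|right].
by case=> [->|->]; rewrite ?eqxx ?orbT.
Qed.

Lemma seq_set_nil (I : eqType) : [set` [::]] = set0 :> set I.
Proof. by apply/seteqP; split. Qed.

Lemma measure_seq_union d (T : measurableType d) (m : {measure set T -> \bar R})
    (I : eqType) (s : seq I) (A : I -> set T) :
  (forall i, measurable (A i)) -> uniq s ->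
  (forall i j, i != j -> A i `&` A j = set0) ->
  m (\bigcup_(i in [set` s]) A i) = (\sum_(i <- s) m (A i))%E.
Proof.
move=> mA us dis; elim: s us => [|i s IH] /=.
  by move=> _; rewrite big_nil seq_set_nil bigcup_set0 measure0.
move=> /andP[si us]; rewrite big_cons -IH // seq_set_cons bigcup_setU1 measureU //.
- by apply: fin_bigcup_measurable => //; exact: finite_seq.
- apply/seteqP; split=> // x [Ai [j /= js Aj]].
  have ij : i != j by apply: contraNneq si => ->.
  have : (A i `&` A j) x by [].
  by rewrite dis.
Qed.

Lemma measure_seq_union_le d (T : measurableType d)
    (m : {measure set T -> \bar R}) (I : eqType) (s : seq I) (A : I -> set T) :
  (forall i, measurable (A i)) ->
  (m (\bigcup_(i in [set` s]) A i) <= \sum_(i <- s) m (A i))%E.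
Proof.
move=> mA; elim: s => [|i s IH] /=.
  by rewrite big_nil seq_set_nil bigcup_set0 measure0.
have mU : measurable (\bigcup_(j in [set` s]) A j).
  by apply: fin_bigcup_measurable => //; exact: finite_seq.
rewrite big_cons seq_set_cons bigcup_setU1 (le_trans (measureU2 m (mA i) mU)) //.
exact: leeD.
Qed.

Variables (p q b c : R).
Hypotheses (p_gt0 : 0 < p) (b_gt0 : 0 < b) (c_gt0 : 0 < c).

Definition slot (s : R) (j : int) : set R := [set` `[s * j%:~R, s * (j + 1)%:~R[%R].

Lemma cell_measure s j : 0 < s -> mu (slot s j) = s%:E.
Proof.
move=> s0; rewrite lebesgue_measure_itv /= lte_fin ltr_pM2l // ltr_int.
rewrite ltrDl /= -EFinB; congr EFin; rewrite intrD; ring.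
Qed.


(** Only the second coordinate is sheared: this suffices to get exactly one point
    of a planar lattice in each box, for boxes whose first side is the first
    coordinate of a generator. *)
Definition tile (j : int * int * int) : set (R * R * R) :=
  [set P | [/\ slot p j.1.1 P.1.1, slot b j.1.2 (P.1.2 - q * P.1.1)
             & slot c j.2 P.2]].

Definition tile_base (j : int * int) : set (R * R) :=
  [set P | slot p j.1 P.1 /\ slot b j.2 (P.2 - q * P.1)].

Lemma measurable_cell s j : measurable (slot s j).
Proof. exact: measurable_itv. Qed.

Lemma measurable_tile_base j : measurable (tile_base j).
Proof.
have m1 : measurable_fun setT (fun P : R * R => P.1) by exact: measurable_fst.
have m2 : measurable_fun setT (fun P : R * R => P.2 - q * P.1).
  apply: measurable_funB; first exact: measurable_snd.
  by apply: measurable_funM.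
rewrite (_ : tile_base j = (setT `&` fst @^-1` slot p j.1) `&`
   (setT `&` (fun P : R * R => P.2 - q * P.1) @^-1` slot b j.2)).
  by apply: measurableI; [apply: m1|apply: m2] => //; exact: measurable_cell.
by apply/seteqP; split=> P /=; [case|case=> -[? ?] []].
Qed.

Lemma measurable_tile j : measurable (tile j).
Proof.
rewrite (_ : tile j = tile_base j.1 `*` slot c j.2).
  apply: measurableX; [exact: measurable_tile_base|exact: measurable_cell].
by apply/seteqP; split=> P /=; [case|case=> -[? ?] ?].
Qed.

Lemma volume_tile j : mu3 (tile j) = (p * b * c)%:E.
Proof.
rewrite (_ : tile j = tile_base j.1 `*` slot c j.2); last first.
  by apply/seteqP; split=> P /=; [case|case=> -[? ?] ?].
transitivity ((mu \x mu)%E (tile_base j.1) * mu (slot c j.2))%E.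
  apply: product_measure1E; [exact: measurable_tile_base|exact: measurable_cell].
rewrite cell_measure //.
have -> : (mu \x mu)%E (tile_base j.1) = (p * b)%:E; last by rewrite EFinM.
transitivity (\int[mu]_x mu (xsection (tile_base j.1) x))%E; first by [].
transitivity (\int[mu]_(x in slot p j.1.1) cst b%:E x)%E; last first.
  rewrite integral_cst /=; last exact: measurable_cell.
  by rewrite cell_measure // -EFinM mulrC.
rewrite [RHS]integral_mkcond; apply: eq_integral => x _; rewrite patchE.
case: ifPn => [/set_mem xI|/negP xI].
  rewrite /= -[RHS]/(b%:E).
  have -> : xsection (tile_base j.1) x
    = [set` `[b * (j.1.2)%:~R + q * x, b * (j.1.2 + 1)%:~R + q * x[%R].
    apply/seteqP; split=> y; rewrite xsectionP /tile_base /slot /= !in_itv /=.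
      by move=> [_]; lra.
    move=> h; split; [by move: xI; rewrite /slot /= in_itv|lra].
  rewrite lebesgue_measure_itv /= lte_fin ltrD2r ltr_pM2l // ltr_int ltrDl /=.
  by rewrite -EFinB; congr EFin; rewrite intrD; ring.
rewrite (_ : xsection _ _ = set0) ?measure0 //.
apply/seteqP; split=> y //; rewrite xsectionP => -[h _].
by apply: xI; apply/mem_set.
Qed.

Definition tile_of (P : R * R * R) : int * int * int :=
  (Num.floor (P.1.1 / p), Num.floor ((P.1.2 - q * P.1.1) / b), Num.floor (P.2 / c)).

Lemma cellP s j x : 0 < s -> slot s j x <-> Num.floor (x / s) = j.
Proof.
move=> s0; rewrite /slot /= in_itv /=.
rewrite [s * j%:~R]mulrC -ler_pdivlMr // [s * _]mulrC -ltr_pdivrMr //.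
split; first by move=> h; apply/floor_def.
by move=> <-; apply: floor_itv.
Qed.

Lemma tileP j P : tile j P <-> tile_of P = j.
Proof.
split=> [[/(cellP _ _ p_gt0) h1 /(cellP _ _ b_gt0) h2 /(cellP _ _ c_gt0) h3]|<-].
  by rewrite /tile_of h1 h2 h3; case: (j) => -[].
by split; apply/cellP.
Qed.

Lemma tile_disjoint i j : i != j -> tile i `&` tile j = set0.
Proof.
move=> ij; apply/seteqP; split=> // P [/tileP Pi /tileP Pj].
by rewrite -Pi -Pj eqxx in ij.
Qed.

End Tiles.

(** * Counting centres by volume *)

(** A duplicate-free list of maximal size contains everything. *)
Lemma bounded_enum (T : eqType) (P : T -> Prop) (n : nat) :
  (forall s, uniq s -> (forall x, x \in s -> P x) -> (size s <= n)%N) ->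
  exists s, uniq s /\ forall x, x \in s <-> P x.
Proof.
move=> H; pose Q k := `[< exists s, [/\ uniq s, forall x, x \in s -> P x
  & size s = k] >].
have Q0 : exists k, Q k by exists 0; apply/asboolP; exists [::].
have Qn k : Q k -> (k <= n)%N by move=> /asboolP[s [us sP <-]]; exact: H.
have [k /asboolP[s [us sP sk]] kmax] := ex_maxnP Q0 Qn.
exists s; split=> // x; split; first exact: sP.
move=> Px; apply: contraT => xs.
have : Q k.+1.
  apply/asboolP; exists (x :: s); split; [by rewrite /= xs| |by rewrite /= sk].
  by move=> y; rewrite inE => /orP[/eqP ->|/sP].
by move=> /kmax; rewrite ltnn.
Qed.

Lemma bounded_enum_real (R : realType) (T : eqType) (P : T -> Prop) (a : R) :
  (forall s, uniq s -> (forall x, x \in s -> P x) -> (size s)%:R <= a) ->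
  exists s, uniq s /\ forall x, x \in s <-> P x.
Proof.
move=> H; have a0 : 0 <= a by exact: (H [::]).
apply: (@bounded_enum _ _ (Num.bound a)) => s us sP.
by rewrite -(ler_nat R) (le_trans (H s us sP)) // ltW // archi_boundP.
Qed.

Section Volume.
Variable R : realType.
Notation mu := (@lebesgue_measure R).
Notation mu3 := ((mu \x mu) \x mu)%E.
Implicit Types (u v : 'rV[R]_3) (C : set 'rV[R]_3).

Definition coords u : R * R * R := (x1 u, x2 u, x3 u).

Lemma row3_coords (P : R * R * R) : coords (row3 P) = P.
Proof. by rewrite /coords !coordE; case: P => [[]]. Qed.

Lemma volumeE (A : set 'rV[R]_3) : volume A = mu3 (@row3 R @^-1` A).
Proof. by []. Qed.

Lemma row3_cball c r : 0 <= r -> @row3 R @^-1` cball c r = solid_ball (coords c) r.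
Proof.
move=> r0; apply/seteqP; split=> P.
  by move=> /(cballE _ _ r0); rewrite !coordE.
by move=> h; apply/(cballE _ _ r0); rewrite !coordE.
Qed.

Lemma volume_cball c (r : R) : 0 < r -> volume (cball c r) = (4 / 3 * pi * r ^+ 3)%:E.
Proof. by move=> r0; rewrite volumeE row3_cball ?ltW // volume_solid_ball. Qed.

Lemma measurable_cball c (r : R) : 0 <= r -> measurable (@row3 R @^-1` cball c r).
Proof. by move=> r0; rewrite row3_cball //; exact: measurable_solid_ball. Qed.

Lemma coord_enorm u : [/\ `|x1 u| <= enorm u, `|x2 u| <= enorm u
  & `|x3 u| <= enorm u].
Proof.
have H (a b : R) : 0 <= b -> a ^+ 2 <= b ^+ 2 -> `|a| <= b.
  by move=> b0; rewrite -(@real_normK _ a) ?num_real // ler_sqr ?nnegrE.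
have E : enorm u ^+ 2 = x1 u ^+ 2 + x2 u ^+ 2 + x3 u ^+ 2.
  by rewrite enorm_sqr dotE; ring.
have := sqr_ge0 (x1 u); have := sqr_ge0 (x2 u); have := sqr_ge0 (x3 u).
by split; apply: H; rewrite ?enorm_ge0 // E; lra.
Qed.

Lemma enorm_le_coord u : enorm u <= `|x1 u| + `|x2 u| + `|x3 u|.
Proof.
rewrite enorm_le ?addr_ge0 // dotE.
have E (a : R) : a * a = `|a| ^+ 2 by rewrite real_normK ?num_real // expr2.
rewrite !E; move: (normr_ge0 (x1 u)) (normr_ge0 (x2 u)) (normr_ge0 (x3 u)).
move: (`|x1 u|) (`|x2 u|) (`|x3 u|) => a b c a0 b0 c0.
have := mulr_ge0 a0 b0; have := mulr_ge0 b0 c0; have := mulr_ge0 a0 c0; lra.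
Qed.

Section Counting.
Variables (p q b c : R).
Hypotheses (p_gt0 : 0 < p) (b_gt0 : 0 < b) (c_gt0 : 0 < c).
Notation tile_of := (tile_of p q b c).

Definition tile_diam : R := p + (b + `|q| * p) + c.

Lemma tile_diamP u v : tile_of (coords u) = tile_of (coords v) ->
  enorm (u - v) <= tile_diam.
Proof.
move=> /[dup] e /(tileP q p_gt0 b_gt0 c_gt0) [].
have /(tileP q p_gt0 b_gt0 c_gt0) [] := erefl (tile_of (coords v)).
rewrite /slot /coords /= !in_itv /= !intrD => /andP[a1 a2] /andP[b1 b2]
  /andP[c1 c2] /andP[a3 a4] /andP[b3 b4] /andP[c3 c4].
rewrite (le_trans (enorm_le_coord _)) // !coordE /tile_diam.
have d1 : `|x1 u - x1 v| <= p by rewrite ler_norml; lra.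
have d3 : `|x3 u - x3 v| <= c by rewrite ler_norml; lra.
have d2 : `|x2 u - x2 v| <= b + `|q| * p.
  have -> : x2 u - x2 v = ((x2 u - q * x1 u) - (x2 v - q * x1 v))
    + q * (x1 u - x1 v) by ring.
  rewrite (le_trans (ler_normD _ _)) // lerD //.
    by rewrite ler_norml; lra.
  by rewrite normrM ler_wpM2l.
lra.
Qed.

Lemma tile_diam_ge0 : 0 <= tile_diam.
Proof. by rewrite !addr_ge0 ?mulr_ge0 ?(ltW p_gt0) ?(ltW b_gt0) ?(ltW c_gt0). Qed.

Lemma volume_tiles (J : seq (int * int * int)) : uniq J ->
  mu3 (\bigcup_(j in [set` J]) tile p q b c j) = ((size J)%:R * (p * b * c))%:E.
Proof.
move=> uJ; rewrite measure_seq_union //.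
- rewrite (eq_bigr (fun=> (p * b * c)%:E)).
    rewrite sumEFin; congr EFin.
    by rewrite big_const_seq count_predT iter_addr addr0 mulr_natl.
  by move=> j _; exact: volume_tile.
- by move=> j; exact: measurable_tile.
- by move=> i j ij; exact: tile_disjoint.
Qed.

(** The boxes are disjoint and lie in the ball enlarged by their diameter. *)
Lemma tiles_meeting_ball (J : seq (int * int * int)) (rho : R) : 0 < rho ->
  uniq J ->
  (forall j, j \in J -> exists u, tile_of (coords u) = j /\ enorm u <= rho) ->
  (size J)%:R * (p * b * c) <= 4 / 3 * pi * (rho + tile_diam) ^+ 3.
Proof.
move=> r0 uJ H; have rd : 0 < rho + tile_diam by rewrite ltr_wpDr // tile_diam_ge0.
rewrite -lee_fin -volume_tiles // -(volume_cball 0 rd) volumeE.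
apply: le_measure; rewrite ?inE.
- apply: fin_bigcup_measurable; first exact: finite_seq.
  by move=> j _; exact: measurable_tile.
- exact: measurable_cball (ltW rd).
move=> P [j /= /H[u [uj ur]] /(tileP q p_gt0 b_gt0 c_gt0) Pj].
rewrite /cball /closed_ball_ /= sub0r enormN.
have -> : row3 P = u + (row3 P - u) by rewrite addrC subrK.
rewrite (le_trans (enormD _ _)) // lerD // tile_diamP // row3_coords.
by rewrite Pj uj.
Qed.

Lemma sum_tiles_size (T : eqType) (f : T -> int * int * int) (s : seq T) :
  size s = (\sum_(j <- undup (map f s)) count (fun x => f x == j) s)%N.
Proof.
under eq_bigr do rewrite -sum1_count big_mkcond /=.
rewrite exchange_big /= -[LHS]sum1_size big_seq [RHS]big_seq.
apply: eq_bigr => x xs; rewrite -big_mkcond /= sum1_count.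
under eq_count do rewrite eq_sym.
rewrite (@count_uniq_mem _ _ (f x)) ?undup_uniq // mem_undup.
by rewrite map_f.
Qed.

Lemma count_upper C (M : R) : 0 <= M ->
  (forall j s, uniq s -> (forall u, u \in s -> C u /\ tile_of (coords u) = j) ->
     (size s)%:R <= M) ->
  forall rho s, 0 < rho -> uniq s ->
    (forall u, u \in s -> C u /\ enorm u <= rho) ->
    (size s)%:R <= M * (4 / 3 * pi / (p * b * c)) * (rho + tile_diam) ^+ 3.
Proof.
move=> M0 H rho s r0 us sP.
set J := undup (map (fun u => tile_of (coords u)) s).
have uJ : uniq J by exact: undup_uniq.
have v0 : 0 < p * b * c by rewrite !mulr_gt0.
have sJ : (size s)%:R <= M * (size J)%:R.
  rewrite (sum_tiles_size (fun u => tile_of (coords u))) natr_sum -/J.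
  have -> : M * (size J)%:R = \sum_(j <- J) M.
    by rewrite big_const_seq count_predT iter_addr addr0 mulr_natr.
  apply: ler_sum => j _; rewrite -size_filter; apply: (H j).
    exact: filter_uniq.
  move=> u; rewrite mem_filter => /andP[/eqP uj /sP[Cu _]]; by split.
apply: le_trans sJ _; rewrite -[X in _ <= X]mulrA; apply: ler_wpM2l => //.
rewrite mulrAC ler_pdivlMr //; apply: tiles_meeting_ball => //.
move=> j; rewrite mem_undup => /mapP[u us' ->]; exists u; split=> //.
by have [] := sP _ us'.
Qed.

(** The boxes that meet the smaller ball cover it, and each contains a centre. *)
Lemma count_lower C : (forall j, exists u, C u /\ tile_of (coords u) = j) ->
  forall rho, tile_diam < rho -> exists s, [/\ uniq s,
    forall u, u \in s -> C u /\ enorm u <= rho &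
    4 / 3 * pi / (p * b * c) * (rho - tile_diam) ^+ 3 <= (size s)%:R].
Proof.
move=> H rho rd.
have [g gP] := choice H.
have v0 : 0 < p * b * c by rewrite !mulr_gt0.
set r := rho - tile_diam; have r0 : 0 < r by rewrite subr_gt0.
have [J [uJ JP]] : exists J, uniq J /\ forall j, j \in J <->
    exists u, tile_of (coords u) = j /\ enorm u <= r.
  apply: (@bounded_enum_real R _ _
    (4 / 3 * pi * (r + tile_diam) ^+ 3 / (p * b * c))) => s us sP.
  by rewrite ler_pdivlMr //; apply: tiles_meeting_ball.
exists (map g J); split.
- rewrite map_inj_in_uniq // => i j _ _ gij.
  by have [_ <-] := gP i; have [_ <-] := gP j; rewrite gij.
- move=> u /mapP[j /JP[v [vj vr]] ->]; have [Cg gj] := gP j; split=> //.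
  have -> : g j = v + (g j - v) by rewrite addrC subrK.
  rewrite (le_trans (enormD _ _)) //.
  have -> : rho = r + tile_diam by rewrite /r subrK.
  by rewrite lerD // tile_diamP // gj.
rewrite size_map mulrAC ler_pdivrMr // -lee_fin -volume_tiles //.
rewrite -(volume_cball 0 r0) volumeE; apply: le_measure; rewrite ?inE.
- exact: measurable_cball (ltW r0).
- apply: fin_bigcup_measurable; first exact: finite_seq.
  by move=> j _; exact: measurable_tile.
move=> P; rewrite /cball /closed_ball_ /= sub0r enormN => Pr.
exists (tile_of P); last by apply/tileP.
by apply/JP; exists (row3 P); rewrite row3_coords.
Qed.

End Counting.
End Volume.

(** * Density of a union of unit balls *)

Lemma one_sub_pow6_ge (R : realType) (t : R) : 0 <= t <= 2^-1 ->
  1 - 6 * t <= (1 - t) ^+ 6.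
Proof.
move=> /andP[t0 t1].
have q2 : 1 - 2 * t <= (1 - t) ^+ 2 by have := sqr_ge0 t; lra.
have s2 : 0 <= 1 - 2 * t by lra.
have -> : (1 - t) ^+ 6 = (1 - t) ^+ 2 * ((1 - t) ^+ 2 * (1 - t) ^+ 2) by ring.
have q4 : (1 - 2 * t) * (1 - 2 * t) <= (1 - t) ^+ 2 * (1 - t) ^+ 2.
  exact: ler_pM.
have : (1 - 2 * t) * ((1 - 2 * t) * (1 - 2 * t))
    <= (1 - t) ^+ 2 * ((1 - t) ^+ 2 * (1 - t) ^+ 2).
  by apply: ler_pM => //; exact: mulr_ge0.
have : 0 <= t ^+ 2 * (12 - 8 * t) by rewrite mulr_ge0 ?sqr_ge0 //; lra.
by clear; lra.
Qed.

Section Density.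
Variable R : realType.
Notation mu := (@lebesgue_measure R).
Notation mu3 := ((mu \x mu) \x mu)%E.
Implicit Types (u v : 'rV[R]_3) (C U : set 'rV[R]_3).

Definition set_density U : \bar R :=
  limf_esup (fun rho : R =>
      volume (U `&` cball 0 rho) / volume (cball 0 rho))%E (pinfty_nbhs R).

Definition balls C : set 'rV[R]_3 := \bigcup_(c in C) cball c 1.

Lemma densityE (I : Type) (D : set I) (K : I -> set 'rV[R]_3) :
  density D K = set_density (\bigcup_(i in D) K i).
Proof. by []. Qed.

Definition count_le C (eta delta : R) := forall rho s, 0 < rho -> uniq s ->
  (forall u, u \in s -> C u /\ enorm u <= rho) ->
  (size s)%:R <= eta * (rho + delta) ^+ 3.

Lemma cball0 u (rho : R) : cball 0 rho u <-> enorm u <= rho.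
Proof. by rewrite /cball /closed_ball_ /= sub0r enormN. Qed.

Lemma volume_seq_balls_le (s : seq 'rV[R]_3) (r : R) : 0 < r ->
  (mu3 (\bigcup_(c in [set` s]) (@row3 R @^-1` cball c r))
    <= ((size s)%:R * (4 / 3 * pi * r ^+ 3))%:E)%E.
Proof.
move=> r0; apply: le_trans (measure_seq_union_le _ _ _) _.
  by move=> c; apply: measurable_cball; exact: ltW.
rewrite (eq_bigr (fun=> (4 / 3 * pi * r ^+ 3)%:E)).
  rewrite sumEFin lee_fin big_const_seq count_predT iter_addr addr0.
  by rewrite [(size s)%:R * _]mulr_natl.
by move=> c _; exact: volume_cball.
Qed.

Lemma balls_in_ball C eta delta rho : count_le C eta delta -> 0 < rho ->
  exists s, [/\ uniq s, forall u, u \in s <-> C u /\ enorm u <= rho + 1 &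
    @row3 R @^-1` (balls C `&` cball 0 rho) =
    (\bigcup_(c in [set` s]) (@row3 R @^-1` cball c 1))
      `&` (@row3 R @^-1` cball 0 rho)].
Proof.
move=> H r0; have r1 : 0 < rho + 1 by rewrite addr_gt0.
have [s [us sP]] : exists s, uniq s /\ forall u, u \in s <-> C u /\ enorm u <= rho + 1.
  apply: (@bounded_enum_real R _ _ (eta * (rho + 1 + delta) ^+ 3)) => s us sP.
  exact: H.
exists s; split=> //; apply/seteqP; split=> P.
  move=> [[c Cc cP] /[dup] Pr /cball0 Pr']; split=> //; exists c => //=.
  apply/sP; split=> //.
  have -> : c = row3 P + (c - row3 P) by rewrite addrC subrK.
  by rewrite (le_trans (enormD _ _)) // lerD.
by move=> [[c /= /sP[Cc _] cP] Pr]; split=> //; exists c.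
Qed.

Lemma density_ratio (a rho : R) : 0 < rho ->
  (a%:E / volume (cball (0 : 'rV[R]_3) rho) = (a / (4 / 3 * pi * rho ^+ 3))%:E)%E.
Proof.
move=> r0; rewrite volume_cball // inver gt_eqF ?mulr_gt0 ?pi_gt0 ?exprn_gt0 //.
Qed.

(** Only the balls with centre in the ball of radius [rho + 1] meet that of radius
    [rho]. *)
Lemma density_le C (eta delta : R) : 0 <= eta -> 0 <= delta ->
  count_le C eta delta -> (set_density (balls C) <= eta%:E)%E.
Proof.
move=> eta0 delta0 H; apply/lee_addgt0Pr => e e0; rewrite -EFinD.
have k0 : 0 < 7 * eta + 1 by rewrite ltr_wpDl ?mulr_ge0.
(* chosen so that (1 + t)^3 <= 1 + 7 t and 7 eta t <= e *)
pose t := Num.min 1 (e / (7 * eta + 1)).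
have t0 : 0 < t by rewrite /t lt_min ltr01 divr_gt0.
have t1 : t <= 1 by rewrite /t ge_min lexx.
have t2 : t * (7 * eta + 1) <= e.
  by rewrite -ler_pdivlMr // /t ge_min lexx orbT.
pose A := (1 + delta) / t.
have A0 : 0 < A by rewrite divr_gt0 // ltr_wpDr.
pose f (rho : R) := (volume (balls C `&` cball 0 rho) / volume (cball 0 rho))%E.
apply: (@le_trans _ _ (ereal_sup [set f rho | rho in [set rho : R | A < rho]])).
  apply: ereal_inf_lbound; exists [set rho | A < rho] => //.
  by exists A; split=> //; exact: num_real.
apply: ge_ereal_sup => _ [rho /= Ar <-].
have r0 : 0 < rho by exact: lt_trans Ar.
have [s [us sP E]] := balls_in_ball H r0.
have r1 : 0 < rho + 1 by rewrite addr_gt0.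
have Hs : (size s)%:R <= eta * (rho + 1 + delta) ^+ 3.
  by apply: H => // u /sP.
have mU : measurable (\bigcup_(c in [set` s]) (@row3 R @^-1` cball c 1)).
  apply: fin_bigcup_measurable; first exact: finite_seq.
  by move=> c _; exact: measurable_cball.
have mB := measurable_cball (0 : 'rV[R]_3) (ltW r0).
have le1 : (volume (balls C `&` cball 0 rho)
    <= ((size s)%:R * (4 / 3 * pi))%:E)%E.
  have -> : 4 / 3 * pi = 4 / 3 * pi * 1 ^+ 3 :> R by rewrite expr1n mulr1.
  rewrite volumeE E.
  apply: le_trans (volume_seq_balls_le s ltr01).
  by apply: le_measure; rewrite ?inE //; exact: measurableI.
have k3 : 0 < 4 / 3 * pi * rho ^+ 3 by rewrite !mulr_gt0 ?pi_gt0 ?exprn_gt0.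
apply: (@le_trans _ _ (((size s)%:R * (4 / 3 * pi))%:E / volume (cball 0 rho))%E).
  apply: lee_wpmul2r => //; rewrite volume_cball // inver gt_eqF //.
  by rewrite lee_fin invr_ge0 ltW.
rewrite density_ratio // lee_fin ler_pdivrMr //.
have tr : 1 + delta <= t * rho by rewrite -ler_pdivrMl // mulrC ltW.
have c1 : (rho + 1 + delta) ^+ 3 <= (rho * (1 + t)) ^+ 3.
  have ab : rho + 1 + delta <= rho * (1 + t) by lra.
  by apply: lerXn2r ab; rewrite nnegrE; lra.
have c2 : (rho * (1 + t)) ^+ 3 <= rho ^+ 3 * (1 + 7 * t).
  rewrite exprMn; apply: ler_wpM2l; first by rewrite exprn_ge0 ?ltW.
  have q1 : 0 <= t * (1 - t) by rewrite mulr_ge0 ?subr_ge0 // ltW.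
  have q2 : 0 <= t * (1 - t) * t by rewrite mulr_ge0 // ltW.
  by lra.
have c3 : eta * (1 + 7 * t) <= eta + e by lra.
have P0 : 0 <= 4 / 3 * pi :> R by rewrite mulr_ge0 ?pi_ge0.
rewrite mulrC [X in _ <= X]mulrCA; apply: ler_wpM2l => //.
apply: le_trans Hs _; rewrite [X in _ <= X]mulrC.
apply: (@le_trans _ _ (eta * (rho ^+ 3 * (1 + 7 * t)))).
  by apply: ler_wpM2l => //; exact: le_trans c2.
by rewrite mulrCA; apply: ler_wpM2l => //; rewrite exprn_ge0 // ltW.
Qed.

(** Unit balls with centres at distance 2 can touch; the radius below 1 makes them
    disjoint. *)
Lemma volume_seq_balls (s : seq 'rV[R]_3) (r : R) : 0 < r < 1 -> uniq s ->
  {in s &, forall u v, u != v -> 2 <= enorm (u - v)} ->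
  mu3 (\bigcup_(c in [set` s]) (@row3 R @^-1` cball c r))
    = ((size s)%:R * (4 / 3 * pi * r ^+ 3))%:E.
Proof.
move=> /andP[r0 r1]; elim: s => [|c s IH] /=.
  by move=> _ _; rewrite seq_set_nil bigcup_set0 measure0 mul0r.
move=> /andP[cs us] sep; rewrite seq_set_cons bigcup_setU1 measureU.
- rewrite [X in (_ + X)%E]IH //; last first.
    by move=> u v us' vs'; apply: sep; rewrite inE ?us' ?vs' orbT.
  rewrite [X in (X + _)%E](_ : _ = (4 / 3 * pi * r ^+ 3)%:E); last first.
    exact: (volume_cball c r0).
  by rewrite -EFinD [(size s).+1%:R]mulrSr; congr EFin; ring.
- exact: measurable_cball (ltW r0).
- apply: fin_bigcup_measurable; first exact: finite_seq.
  by move=> u _; exact: measurable_cball (ltW r0).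
apply/seteqP; split=> // P [cP [u /= us' uP]].
have cu : c != u by apply: contraNneq cs => ->.
have := sep c u; rewrite inE eqxx inE us' orbT => /(_ isT isT cu).
apply/negP; rewrite -ltNge.
rewrite (le_lt_trans (enorm_tri _ (row3 P) _)) //.
rewrite (_ : 2 = 1 + 1) //; apply: ltrD; first exact: le_lt_trans r1.
by rewrite enormB; exact: le_lt_trans r1.
Qed.

(** Balls of radius [1 - t] around the centres in the ball of radius [rho - 1] are
    disjoint and lie in that of radius [rho]; then [t] tends to 0. *)
Lemma density_ge C (eta delta eta' delta' : R) : 0 <= eta -> 0 <= delta ->
  count_le C eta' delta' ->
  (forall u v, C u -> C v -> u != v -> 2 <= enorm (u - v)) ->
  (forall rho, delta < rho -> exists s, [/\ uniq s,
    forall u, u \in s -> C u /\ enorm u <= rho &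
    eta * (rho - delta) ^+ 3 <= (size s)%:R]) ->
  (eta%:E <= set_density (balls C))%E.
Proof.
move=> eta0 delta0 H sep low; apply: le_ereal_inf_tmp => _ [V VF <-].
apply/lee_addgt0Pr => e e0.
have k0 : 0 < 6 * eta + 1 by rewrite ltr_wpDl ?mulr_ge0.
(* chosen so that (1 - t)^6 >= 1 - 6 t and 6 eta t <= e *)
pose t := Num.min 2^-1 (e / (6 * eta + 1)).
have t0 : 0 < t by rewrite /t lt_min invr_gt0 ltr0n divr_gt0.
have t1 : t <= 2^-1 by rewrite /t ge_min lexx.
have t2 : t * (6 * eta + 1) <= e.
  by rewrite -ler_pdivlMr // /t ge_min lexx orbT.
pose A := (1 + delta) / t.
have A0 : 0 < A by rewrite divr_gt0 // ltr_wpDr.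
have [rho Ar Vrho] := pinfty_ex_gt (num_real A) VF.
have r0 : 0 < rho by exact: lt_trans Ar.
have tr : 1 + delta <= t * rho by rewrite -ler_pdivrMl // mulrC ltW.
have rt : t * rho <= rho by rewrite ler_piMl ?ltW //; lra.
have hr : 0 < 2^-1 * rho by rewrite mulr_gt0.
have trh : t * rho <= 2^-1 * rho by rewrite ler_wpM2r // ltW.
apply: (@le_trans _ _ ((volume (balls C `&` cball 0 rho)
    / volume (cball 0 rho)) + e%:E)%E); last first.
  by apply: leeD => //; apply: ereal_sup_ubound; exists rho.
have [|s [us sP sz]] := low (rho - 1); first by lra.
have [s' [us' sP' E]] := balls_in_ball H r0.
have mU : measurable (@row3 R @^-1` (balls C `&` cball 0 rho)).
  rewrite E; apply: measurableI; last exact: measurable_cball (ltW r0).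
  apply: fin_bigcup_measurable; first exact: finite_seq.
  by move=> c _; exact: measurable_cball.
have le1 : (((size s)%:R * (4 / 3 * pi * (1 - t) ^+ 3))%:E
    <= volume (balls C `&` cball 0 rho))%E.
  rewrite -volume_seq_balls //; last 2 first.
  - by apply/andP; split; lra.
  - by move=> u v /sP[Cu _] /sP[Cv _]; exact: sep.
  rewrite volumeE; apply: le_measure; rewrite ?inE //.
    apply: fin_bigcup_measurable; first exact: finite_seq.
    by move=> c _; apply: measurable_cball; lra.
  move=> P [c /= /sP[Cc cr] cP]; split.
    by exists c => //; apply: le_trans cP _; lra.
  apply/cball0; have -> : row3 P = c + (row3 P - c) by rewrite addrC subrK.
  rewrite (le_trans (enormD _ _)) //.
  have : enorm (row3 P - c) <= 1 - t by rewrite enormB.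
  by lra.
have k3 : 0 < 4 / 3 * pi * rho ^+ 3 by rewrite !mulr_gt0 ?pi_gt0 ?exprn_gt0.
apply: (@le_trans _ _ (((size s)%:R * (4 / 3 * pi * (1 - t) ^+ 3))%:E
    / volume (cball 0 rho) + e%:E)%E); last first.
  apply: leeD => //; apply: lee_wpmul2r => //.
  rewrite volume_cball // inver gt_eqF //.
  by rewrite lee_fin invr_ge0 ltW.
rewrite density_ratio // -EFinD lee_fin -lerBlDr ler_pdivlMr //.
have P0 : 0 <= 4 / 3 * pi :> R by rewrite mulr_ge0 ?pi_ge0.
rewrite [X in X <= _]mulrCA [X in _ <= X]mulrCA; apply: ler_wpM2l => //.
have ti : 0 <= 1 - t by lra.
rewrite [X in X <= _]mulrC.
apply: (@le_trans _ _ (eta * (rho - 1 - delta) ^+ 3 * (1 - t) ^+ 3)); last first.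
  by apply: ler_wpM2r => //; rewrite exprn_ge0.
apply: (@le_trans _ _ (eta * (rho * (1 - t)) ^+ 3 * (1 - t) ^+ 3)); last first.
  apply: ler_wpM2r; first by rewrite exprn_ge0.
  have ab : rho * (1 - t) <= rho - 1 - delta by lra.
  apply: ler_wpM2l => //; apply: lerXn2r ab; rewrite nnegrE; lra.
have -> : eta * (rho * (1 - t)) ^+ 3 * (1 - t) ^+ 3
  = rho ^+ 3 * (eta * (1 - t) ^+ 6) by ring.
apply: ler_wpM2l; first by rewrite exprn_ge0 // ltW.
have c6 : 1 - 6 * t <= (1 - t) ^+ 6.
  by apply: one_sub_pow6_ge; lra.
have := ler_wpM2l eta0 c6; lra.
Qed.

End Density.

(** * Interiors of unions of unit balls *)

Section Topology.
Variable R : realType.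
Implicit Types (u v x y : 'rV[R]_3) (A S : set 'rV[R]_3).

Lemma nbhs_enorm x A : nbhs x A <->
  exists2 e : R, 0 < e & forall y, enorm (y - x) < e -> A y.
Proof.
split.
  move=> /nbhs_ballP[e /= e0 eA]; exists e => // y ye; apply: eA.
  split=> // i j; rewrite ord1 /ball /=.
  have [h1 h2 h3] := coord_enorm (x - y); rewrite enormB in ye.
  by have [] := ord3P j => ->;
    [move: h1|move: h2|move: h3]; rewrite !coordE => h; apply: le_lt_trans ye.
move=> [e e0 eA]; apply/nbhs_ballP; exists (e / 3) => /=; first by rewrite divr_gt0.
move=> y [_ xy]; apply: eA; rewrite enormB (le_lt_trans (enorm_le_coord _)) //.
have h1 := xy 0 (inord 0); have h2 := xy 0 (inord 1); have h3 := xy 0 (inord 2).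
rewrite /ball /= in h1 h2 h3; rewrite !coordE; rewrite /x1 /x2 /x3; lra.
Qed.

Lemma interior_enorm x A : A° x <->
  exists2 e : R, 0 < e & forall y, enorm (y - x) < e -> A y.
Proof. exact: nbhs_enorm. Qed.

(** The middle of two centres at distance less than 2 is inside both balls. *)
Lemma balls_separated S S' c c' : (balls S)° `&` (balls S')° = set0 ->
  S c -> S' c' -> 2 <= enorm (c - c').
Proof.
move=> dis Sc Sc'; rewrite leNgt; apply/negP => cc'.
suff : ((balls S)° `&` (balls S')°) (2^-1 *: (c + c')) by rewrite dis.
have E (a b : 'rV[R]_3) : enorm (2^-1 *: (a + b) - a) = 2^-1 * enorm (a - b).
  have -> : 2^-1 *: (a + b) - a = 2^-1 *: (b - a).
    by apply: row3P; rewrite !coordE; field.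
  by rewrite enormZ ger0_norm // enormB.
have I (T : set 'rV[R]_3) (a b : 'rV[R]_3) : T a -> enorm (a - b) < 2 -> (balls T)° (2^-1 *: (a + b)).
  move=> Ta ab; apply/interior_enorm; exists (1 - 2^-1 * enorm (a - b)).
    by rewrite subr_gt0; lra.
  move=> y ya; exists a => //; rewrite /cball /closed_ball_ /=.
  rewrite enormB (le_trans (enorm_tri y (2^-1 *: (a + b)) a)) //.
  by rewrite E; lra.
by split; [exact: I|rewrite addrC; apply: I; rewrite // enormB].
Qed.

(** A common inner point can be moved towards a centre of the first union, so as
    to be strictly inside that ball while remaining in the second union. *)
Lemma balls_disjoint S S' :
  (forall c c', S c -> S' c' -> 2 <= enorm (c - c')) ->
  (balls S)° `&` (balls S')° = set0.
Proof.
move=> sep; apply/seteqP; split=> // x [].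
move=> /interior_enorm[e e0 eS] /interior_enorm[e' e'0 eS'].
have [c Sc xc] : balls S x.
  by apply: eS; rewrite subrr /enorm dotE !coordE !mulr0 !addr0 sqrtr0.
rewrite /cball /closed_ball_ /= in xc.
pose s := Num.min 2^-1 (e' / 2).
have s0 : 0 < s by rewrite /s lt_min invr_gt0 ltr0n divr_gt0.
have s1 : s <= 2^-1 by rewrite /s ge_min lexx.
have s2 : s < e'.
  by apply: (@le_lt_trans _ _ (e' / 2)); [rewrite /s ge_min lexx orbT|lra].
pose y := x + s *: (c - x).
have cx := enorm_ge0 (c - x).
have [c' Sc' yc'] : balls S' y.
  apply: eS'; rewrite /y addrAC subrr add0r enormZ gtr0_norm //.
  by apply: le_lt_trans s2; rewrite ler_piMr // ltW.
rewrite /cball /closed_ball_ /= in yc'.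
have yc : enorm (c - y) < 1.
  have -> : c - y = (1 - s) *: (c - x).
    by rewrite /y; apply: row3P; rewrite !coordE; ring.
  rewrite enormZ ger0_norm; last by lra.
  apply: (@le_lt_trans _ _ (1 - s)); last by lra.
  by rewrite ler_piMr //; lra.
have := sep _ _ Sc Sc'; apply/negP; rewrite -ltNge.
rewrite (le_lt_trans (enorm_tri _ y _)) //.
by rewrite (enormB y); lra.
Qed.

Lemma separated_isolated S (r : R) : 0 < r ->
  (forall u v, S u -> S v -> u != v -> r <= enorm (u - v)) -> S `<=` isolated S.
Proof.
move=> r0 sep u Su; split; first exact/mem_set.
exists [set v | enorm (v - u) < r]; first by apply/nbhs_enorm; exists r.
apply/seteqP; split=> v /=.
  move=> [vu Sv]; apply/eqP; apply: contraLR vu => nvu.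
  by rewrite -leNgt sep.
move=> ->; split=> //.
by rewrite subrr /enorm dotE !coordE !mulr0 !addr0 sqrtr0.
Qed.

Lemma string_balls (d : R) t : translate (string d) t =
  balls [set t + (2 * d * k%:~R) *: e3 R | k in [set: int]].
Proof.
apply/seteqP; split=> x.
  move=> [y [k _ yk] <-]; exists (t + (2 * d * k%:~R) *: e3 R); first by exists k.
  move: yk; rewrite /cball /closed_ball_ /=; congr (_ <= _); congr enorm.
  by apply: row3P; rewrite !coordE; ring.
move=> [_ [k _ <-] xk]; exists (x - t); last by rewrite subrK.
exists k => //; move: xk; rewrite /cball /closed_ball_ /=.
by congr (_ <= _); congr enorm; apply: row3P; rewrite !coordE; ring.
Qed.

Lemma strings_balls (d : R) (I : Type) (D : set I) (t : I -> 'rV[R]_3) :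
  \bigcup_(i in D) translate (string d) (t i) =
  balls [set t i + (2 * d * k%:~R) *: e3 R | i in D & k in [set: int]].
Proof.
apply/seteqP; split=> x.
  move=> [i Di]; rewrite string_balls => -[c [k _ <-] xc].
  by exists (t i + (2 * d * k%:~R) *: e3 R) => //; exists i => //; exists k.
move=> [c [i Di [k _ <-]] xc]; exists i => //; rewrite string_balls.
by exists (t i + (2 * d * k%:~R) *: e3 R) => //; exists k.
Qed.

End Topology.

(** * The density bound for strings *)

Section Strings.
Variables (R : realType) (d : R).
Hypotheses (d_ge1 : 1 <= d) (d_le : d ^+ 2 <= 2).
Implicit Types (u v : 'rV[R]_3) (C : set 'rV[R]_3).

Definition up u (k : int) : 'rV[R]_3 := u + (2 * d * k%:~R) *: e3 R.

(** A set of ball centres composed of whole strings; the second clause separates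
    centres of different strings only. *)
Definition string_set C :=
  (forall u k, C u -> C (up u k)) /\
  (forall u v, C u -> C v -> (exists k, u = up v k) \/ 2 <= enorm (u - v)).

Lemma packing_string_set (I : Type) (D : set I) (t : I -> 'rV[R]_3) :
  packing D (fun i => translate (string d) (t i)) ->
  string_set [set t i + (2 * d * k%:~R) *: e3 R | i in D & k in [set: int]].
Proof.
move=> pk; split.
  move=> _ k [i Di [l _ <-]]; exists i => //; exists (l + k) => //.
  by rewrite /up -addrA -scalerDl intrD mulrDr.
move=> _ _ [i Di [k _ <-]] [j Dj [l _ <-]].
have [ij|ij] := pselect (i = j).
  left; exists (k - l); rewrite ij /up -addrA -scalerDl; congr (_ + _ *: _).
  by rewrite intrB; ring.
right; have dis : (translate (string d) (t i))°
    `&` (translate (string d) (t j))° = set0.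
  apply: contrapT => h; apply: ij; apply: pk => //.
  by apply/set0P/eqP.
by rewrite !string_balls in dis; apply: (balls_separated dis); [exists k|exists l].
Qed.

Lemma up_phase_sep C u v : string_set C -> C u -> C v ->
  ~ (exists k, u = up v k) ->
  4 <= sqdist (x1 u, x2 u) (x1 v, x2 v) + phase d (x3 u - x3 v) ^+ 2.
Proof.
move=> [Cup Csep] Cu Cv nuv.
pose k := nearest d (x3 u - x3 v).
have [[l ul]|] := Csep u (up v k) Cu (Cup v k Cv).
  case: nuv; exists (k + l); rewrite ul /up -addrA -scalerDl; congr (_ + _ *: _).
  by rewrite intrD; ring.
rewrite enorm_ge // (_ : 2 ^+ 2 = 4); last by ring.
rewrite dotE /up !coordE /sqdist /phase real_normK ?num_real // /residue -/k /=.
lra.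
Qed.

(** The area of the horizontal projection of a face of the extremal tetrahedron. *)
Definition tri_area : R := Num.sqrt (3 - d ^+ 2).

Lemma tri_area_gt0 : 0 < tri_area.
Proof. by rewrite sqrtr_gt0 subr_gt0 (le_lt_trans d_le) // ltr_nat. Qed.

(** Different centres in a box of height [2 * d] lie on different strings.
    [square_bound] applies to their projections, moved 2 away from the sides of
    a square with even integral side. *)
Lemma string_tile_count C (s : R) j (l : seq 'rV[R]_3) : string_set C -> 0 < s ->
  uniq l -> (forall u, u \in l -> C u /\ tile_of s 0 s (2 * d) (coords u) = j) ->
  (size l)%:R <= (s + 6) ^+ 2 / (2 * tri_area).
Proof.
have d1 := d_ge1; move=> CS s0 ul lP.
have d0 : 0 < 2 * d by lra.
have inC i : (i < size l)%N -> C (nth 0 l i) /\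
    tile s 0 s (2 * d) j (coords (nth 0 l i)).
  by move=> /(mem_nth 0)/lP[Ci /(tileP 0 s0 s0 d0)].
rewrite ler_pdivlMr ?mulr_gt0 ?tri_area_gt0 //.
pose N := (Num.trunc ((s + 4) / 2)).+1.
have s4 : 0 <= (s + 4) / 2 by rewrite divr_ge0 //; lra.
have N1 : (s + 4) / 2 < N%:R by exact: truncnS_gt.
have N2 : N%:R - 1 <= (s + 4) / 2.
  by rewrite /N -natr1 addrK truncn_le.
set a := j.1.1%:~R * s; set b := j.1.2%:~R * s.
pose pos (i : 'I_(size l)) : R * R :=
  (x1 (nth 0 l i) - a + 2, x2 (nth 0 l i) - b + 2).
pose ht (i : 'I_(size l)) := x3 (nth 0 l i).
have bnd : (size l)%:R * (2 * tri_area) <= (2 * N%:R) ^+ 2.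
  apply: (@square_bound R d d_ge1 d_le _ pos ht).
    move=> i k ik; have [Ci Ti] := inC i (ltn_ord i).
    have [Ck Tk] := inC k (ltn_ord k).
    have -> : sqdist (pos i) (pos k) = sqdist (x1 (nth 0 l i), x2 (nth 0 l i))
        (x1 (nth 0 l k), x2 (nth 0 l k)) by rewrite /sqdist /pos /=; ring.
    apply: (up_phase_sep CS) => // -[m um].
    have m0 : m = 0.
      have [_ _] := Ti; have [_ _] := Tk.
      rewrite /coords um /up /slot /= !in_itv /= !coordE !intrD mulr1z.
      move=> /andP[h1 h2] /andP[h3 h4]; apply: (@int_small R).
      rewrite ltr_norml; apply/andP.
      by split; rewrite -(@ltr_pM2l _ (2 * d)) //; lra.
    move: um; rewrite m0 /up mulr0 scale0r addr0 => /eqP.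
    by rewrite nth_uniq ?ltn_ord // => ik'; case/negP: ik; exact: ik'.
  move=> i; have [_ [h1 h2 _]] := inC i (ltn_ord i).
  move: h1 h2; rewrite /coords /slot /= !in_itv /= !intrD mulr1z mul0r subr0.
  rewrite /pos /a /b /=.
  by move=> /andP[? ?] /andP[? ?]; split; apply/andP; split; lra.
apply: le_trans bnd _; apply: lerXn2r; rewrite ?nnegrE; lra.
Qed.

Definition density_bound : R := pi / (3 * d * tri_area).

Lemma density_bound_gt0 : 0 < density_bound.
Proof.
have d1 := d_ge1.
by rewrite divr_gt0 ?pi_gt0 // !mulr_gt0 ?tri_area_gt0 //; lra.
Qed.

(** The bound for boxes of side [s], as [s] tends to infinity. *)
Theorem string_set_density C : string_set C ->
  (set_density (balls C) <= density_bound%:E)%E.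
Proof.
have d1 := d_ge1; have B0 := density_bound_gt0; have A0p := tri_area_gt0.
move=> CS; apply/lee_addgt0Pr => e e0; rewrite -EFinD.
have k0 : 0 < 3 * density_bound + 1 by lra.
pose t := Num.min 1 (e / (3 * density_bound + 1)).
have t0 : 0 < t by rewrite /t lt_min ltr01 divr_gt0.
have t1 : t <= 1 by rewrite /t ge_min lexx.
have t2 : t * (3 * density_bound + 1) <= e.
  by rewrite -ler_pdivlMr // /t ge_min lexx orbT.
pose s := 6 / t.
have s0 : 0 < s by rewrite divr_gt0.
have dd : 0 < 2 * d by lra.
have M0 : 0 <= (s + 6) ^+ 2 / (2 * tri_area).
  by rewrite divr_ge0 ?sqr_ge0 // mulr_ge0 // ltW.
have cnt := @count_upper R s 0 s (2 * d) s0 s0 dd C _ M0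
  (fun j l ul lP => string_tile_count CS s0 ul lP).
have eta0 : 0 <= (s + 6) ^+ 2 / (2 * tri_area) * (4 / 3 * pi / (s * s * (2 * d))).
  apply: mulr_ge0 => //; apply: divr_ge0; first by rewrite mulr_ge0 ?pi_ge0.
  by apply/ltW/mulr_gt0 => //; exact: mulr_gt0.
apply: le_trans (density_le eta0 (tile_diam_ge0 0 s0 s0 dd) cnt) _.
rewrite lee_fin.
have -> : (s + 6) ^+ 2 / (2 * tri_area) * (4 / 3 * pi / (s * s * (2 * d)))
    = density_bound * (1 + t) ^+ 2.
  rewrite /density_bound /s; field; rewrite !gt_eqF //; lra.
have : 0 <= density_bound * (t * (1 - t)).
  by apply: mulr_ge0; [exact: ltW|apply: mulr_ge0; [exact: ltW|lra]].
lra.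
Qed.

End Strings.

(** * Density of lattices with a vertical period *)

Section LatticeDensity.
Variables (R : realType) (d : R).
Hypothesis d_gt0 : 0 < d.
Implicit Types (a u v : 'rV[R]_3).

Definition lat_point a u v (i j k : int) : 'rV[R]_3 := up d (a + u *~ i + v *~ j) k.
Definition string_lattice a u v : set 'rV[R]_3 :=
  [set x | exists i j k, x = lat_point a u v i j k].

Lemma lat_subr a u v : string_lattice a u (u - v) = string_lattice a u v.
Proof.
by apply/seteqP; split=> x [i [j [k ->]]]; exists (i + j), (- j), k;
  apply: row3P; rewrite /lat_point /up !coordE ?(intrD, intrN); ring.
Qed.

Lemma floorDint (x : R) (n : int) : Num.floor (x + n%:~R) = Num.floor x + n.
Proof. by rewrite floorDrz ?intr_int // intrKfloor. Qed.

Definition planar_det u v : R := x1 u * x2 v - x2 u * x1 v.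

Lemma lat_swap a u v : string_lattice a u v = string_lattice a v u.
Proof.
apply/seteqP; split=> x [i [j [k ->]]]; exists j, i, k;
  by rewrite /lat_point addrAC.
Qed.

Lemma lat_oppl a u v : string_lattice a (- u) v = string_lattice a u v.
Proof.
by apply/seteqP; split=> x [i [j [k ->]]]; exists (- i), j, k;
  rewrite /lat_point ?mulrNz ?mulNrz ?opprK.
Qed.

Lemma lat_oppr a u v : string_lattice a u (- v) = string_lattice a u v.
Proof. by rewrite lat_swap lat_oppl lat_swap. Qed.

(** In the sheared coordinates the basis becomes triangular, and a lattice vector
    moves each floor by an integer once the later coefficients are fixed. *)
Lemma lat_tile a u v i j k (p := x1 u) (q := x2 u / x1 u) (b := planar_det u v / x1 u) :
  0 < x1 u -> 0 < planar_det u v ->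
  tile_of p q b (2 * d) (coords (lat_point a u v i j k)) =
  (Num.floor (x1 a / p + j%:~R * (x1 v / p)) + i,
   Num.floor ((x2 a - q * x1 a) / b) + j,
   Num.floor ((x3 a + x3 u * i%:~R + x3 v * j%:~R) / (2 * d)) + k).
Proof.
move=> u0 D0; have dn : d != 0 by rewrite gt_eqF.
have un : x1 u != 0 by rewrite gt_eqF.
have Dn : planar_det u v != 0 by rewrite gt_eqF.
have Dn' : x1 u * x2 v - x2 u * x1 v != 0 by [].
rewrite /tile_of /coords /lat_point /up !coordE -!floorDint.
congr (_, _, _); congr (Num.floor _); rewrite /p /b /q /planar_det /=; field;
  rewrite ?un ?dn ?Dn' //.
Qed.

Lemma lat_counts_pos a u v (eta := 4 / 3 * pi / (2 * d * planar_det u v)) :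
  0 < x1 u -> 0 < planar_det u v -> exists2 delta, 0 <= delta &
  count_le (string_lattice a u v) eta delta /\
  (forall rho, delta < rho -> exists s, [/\ uniq s,
    forall x, x \in s -> string_lattice a u v x /\ enorm x <= rho &
    eta * (rho - delta) ^+ 3 <= (size s)%:R]).
Proof.
move=> u0 D0; have b0 : 0 < planar_det u v / x1 u by rewrite divr_gt0.
have dd : 0 < 2 * d by rewrite mulr_gt0.
exists (tile_diam (x1 u) (x2 u / x1 u) (planar_det u v / x1 u) (2 * d)).
  exact: tile_diam_ge0.
have etaE : eta = 4 / 3 * pi / (x1 u * (planar_det u v / x1 u) * (2 * d)).
  by rewrite /eta; congr (_ / _); field; rewrite gt_eqF.
split.
- move=> rho s r0 us sP; rewrite etaE -[4 / 3 * pi / _]mul1r.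
  apply: (count_upper u0 b0 dd ler01) sP => //.
  move=> j t ut tP; rewrite lern1 leqNgt; apply/negP => t2.
  case: t ut tP t2 => [|x [|y t]] //= /andP[xt _] tP _.
  have [[i1 [j1 [k1 xE]]] xj] := tP x (mem_head _ _).
  have [|[i2 [j2 [k2 yE]]] yj] := tP y; first by rewrite !inE eqxx orbT.
  move: xj yj xt; rewrite xE yE !lat_tile // => <- [].
  move=> + /addrI ej; rewrite ej => /addrI ei; rewrite ei => /addrI ->.
  by rewrite inE eqxx.
rewrite etaE; apply: count_lower => // -[[j1 j2] j3].
pose j := j2 - Num.floor ((x2 a - x2 u / x1 u * x1 a) / (planar_det u v / x1 u)).
pose i := j1 - Num.floor (x1 a / x1 u + j%:~R * (x1 v / x1 u)).
pose k := j3 - Num.floor ((x3 a + x3 u * i%:~R + x3 v * j%:~R) / (2 * d)).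
exists (lat_point a u v i j k); split; first by exists i, j, k.
by rewrite lat_tile // /i /j /k; congr (_, _, _); rewrite addrC subrK.
Qed.

(** Exchanging the generators or changing their signs makes the first coordinate
    of [u] and the determinant positive. *)
Lemma lat_counts a u v (eta := 4 / 3 * pi / (2 * d * `|planar_det u v|)) :
  planar_det u v != 0 -> exists2 delta, 0 <= delta &
  count_le (string_lattice a u v) eta delta /\
  (forall rho, delta < rho -> exists s, [/\ uniq s,
    forall x, x \in s -> string_lattice a u v x /\ enorm x <= rho &
    eta * (rho - delta) ^+ 3 <= (size s)%:R]).
Proof.
rewrite /eta => {eta}.
have detNl x y : planar_det (- x) y = - planar_det x y by rewrite /planar_det !coordE; ring.
have detNr x y : planar_det x (- y) = - planar_det x y by rewrite /planar_det !coordE; ring.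
wlog u0 : u v / x1 u != 0.
  move=> H D; have [u0|u0] := eqVneq (x1 u) 0; last exact: H.
  have detC : planar_det v u = - planar_det u v by rewrite /planar_det; ring.
  rewrite lat_swap -normrN -detC; apply: H; last by rewrite detC oppr_eq0.
  by apply: contraNneq D => v0; rewrite /planar_det u0 v0 mulr0 mul0r subrr.
wlog u1 : u v u0 / 0 < x1 u.
  move=> H D; have [h|h|h] := ltgtP (x1 u) 0; last by rewrite h eqxx in u0.
    rewrite -lat_oppl -normrN -detNl; apply: H; rewrite ?detNl ?coordE ?oppr_eq0 //.
    by rewrite oppr_gt0.
  exact: H.
move=> D; have [h|h|h] := ltgtP (planar_det u v) 0; last by rewrite h eqxx in D.
  by rewrite ltr0_norm // -lat_oppr -detNr; apply: lat_counts_pos; rewrite ?detNr ?oppr_gt0.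
by rewrite gtr0_norm //; apply: lat_counts_pos.
Qed.

Lemma eta_ge0 (D : R) : 0 <= D -> 0 <= 4 / 3 * pi / (2 * d * D).
Proof.
move=> D0; apply: divr_ge0; first by rewrite mulr_ge0 ?pi_ge0.
by rewrite mulr_ge0 // mulr_ge0 // ltW.
Qed.

Lemma lat_density_le a u v : planar_det u v != 0 ->
  (set_density (balls (string_lattice a u v)) <= (4 / 3 * pi / (2 * d * `|planar_det u v|))%:E)%E.
Proof.
move=> /(lat_counts a)[delta delta0 [cnt _]].
exact: density_le (eta_ge0 (normr_ge0 _)) delta0 cnt.
Qed.

Lemma lat_density_ge a u v : planar_det u v != 0 ->
  (forall x y, string_lattice a u v x -> string_lattice a u v y -> x != y -> 2 <= enorm (x - y)) ->
  ((4 / 3 * pi / (2 * d * `|planar_det u v|))%:E <= set_density (balls (string_lattice a u v)))%E.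
Proof.
move=> /(lat_counts a)[delta delta0 [cnt low]] sep.
exact: density_ge (eta_ge0 (normr_ge0 _)) delta0 cnt sep low.
Qed.

End LatticeDensity.

(** * Lattices given by generators *)

Section IntegerLattices.
Variable R : realType.
Implicit Types (a b c e u v w x : 'rV[R]_3) (i j k : int).

Definition int_lattice a u v w : set 'rV[R]_3 :=
  [set x | exists i j k, x = a + u *~ i + v *~ j + w *~ k].

Lemma lattice_gen4E a b c e :
  lattice_gen [tuple a; b; c; e] = int_lattice a (b - a) (c - a) (e - a).
Proof.
apply/seteqP; split=> x.
  move=> [n _ <-]; exists (n ord0), (n (lift ord0 ord0)),
    (n (lift ord0 (lift ord0 ord0))).
  by rewrite !big_ord_recl big_ord0 addr0 /thead !(tnth_nth 0) /= !addrA.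
move=> [i [j [k ->]]].
exists (fun o : 'I_3 => nth 0 [:: i; j; k] o) => //.
by rewrite !big_ord_recl big_ord0 addr0 /thead !(tnth_nth 0) /= !addrA.
Qed.

Lemma lattice_gen5P a b c e f x : lattice_gen [tuple a; b; c; e; f] x <->
  exists i j k l, x = a + (b - a) *~ i + (c - a) *~ j + (e - a) *~ k
    + (f - a) *~ l.
Proof.
split.
  move=> [n _ <-]; exists (n ord0), (n (lift ord0 ord0)),
    (n (lift ord0 (lift ord0 ord0))), (n (lift ord0 (lift ord0 (lift ord0 ord0)))).
  by rewrite !big_ord_recl big_ord0 addr0 /thead !(tnth_nth 0) /= !addrA.
move=> [i [j [k [l ->]]]].
exists (fun o : 'I_4 => nth 0 [:: i; j; k; l] o) => //.
by rewrite !big_ord_recl big_ord0 addr0 /thead !(tnth_nth 0) /= !addrA.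
Qed.

Lemma free3P u v w : free [:: u; v; w] <->
  forall al be ga : R, al *: u + be *: v + ga *: w = 0 ->
    [/\ al = 0, be = 0 & ga = 0].
Proof.
have E (k : 'I_3 -> R) : \sum_(i < 3) k i *: [tuple u; v; w]`_i
    = k ord0 *: u + k (lift ord0 ord0) *: v + k (lift ord0 (lift ord0 ord0)) *: w.
  by rewrite !big_ord_recl big_ord0 addr0 /= !addrA.
split.
  move=> /(@freeP _ _ 3 [tuple u; v; w]) H al be ga S.
  have := H (fun o : 'I_3 => nth 0 [:: al; be; ga] o); rewrite E => /(_ S) h.
  by split; [exact: (h ord0)|exact: (h (lift ord0 ord0))
    |exact: (h (lift ord0 (lift ord0 ord0)))].
move=> H; apply/(@freeP _ _ 3 [tuple u; v; w]) => k; rewrite E => /H[h1 h2 h3] i.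
have [] := ord3P i => ->; [rewrite -h1|rewrite -h2|rewrite -h3];
  by congr k; apply/val_inj; rewrite /= inordK.
Qed.

Lemma free_cons2 u v w : free [:: u; v; w] -> free [:: v; w].
Proof. by rewrite free_cons => /andP[]. Qed.

Lemma zlat_subgroup u v w : int_lattice 0 u v w 0 /\
  forall x y, int_lattice 0 u v w x -> int_lattice 0 u v w y -> int_lattice 0 u v w (x - y).
Proof.
split; first by exists 0, 0, 0; rewrite !mulr0z !addr0.
move=> _ _ [i [j [k ->]]] [i' [j' [k' ->]]].
exists (i - i'), (j - j'), (k - k'); apply: row3P; rewrite !coordE !intrB; ring.
Qed.

Lemma translate_zlat a u v w : translate (int_lattice 0 u v w) a = int_lattice a u v w.
Proof.
apply/seteqP; split=> x.
  move=> [_ [i [j [k ->]]] <-]; exists i, j, k.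
  by apply: row3P; rewrite !coordE; ring.
move=> [i [j [k ->]]]; exists (u *~ i + v *~ j + w *~ k).
  by exists i, j, k; rewrite add0r.
by apply: row3P; rewrite !coordE; ring.
Qed.

Definition separated (C : set 'rV[R]_3) (r : R) :=
  forall x y, C x -> C y -> x != y -> r <= enorm (x - y).

Lemma point_lattice_zlat3 a u v w (r : R) : 0 < r -> free [:: u; v; w] ->
  separated (int_lattice 0 u v w) r -> point_lattice 3 (int_lattice a u v w).
Proof.
move=> r0 fr sep; have [z0 zB] := zlat_subgroup u v w.
exists a, (int_lattice 0 u v w); split; last by rewrite translate_zlat.
  by split=> //; exact: separated_isolated sep.
exists [tuple u; v; w]; split=> //.
  move=> x /=; rewrite !inE => /or3P[] /eqP ->.
  - by exists 1, 0, 0; rewrite add0r !mulr0z !addr0.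
  - by exists 0, 1, 0; rewrite !mulr0z !addr0 add0r.
  - by exists 0, 0, 1; rewrite !mulr0z !addr0 add0r.
move=> _ [i [j [k ->]]] /=; rewrite add0r.
by rewrite !rpredD // rpredMz // memv_span // !inE eqxx ?orbT.
Qed.

Lemma point_lattice_zlat2 a v w (r : R) : 0 < r -> free [:: v; w] ->
  separated (int_lattice 0 0 v w) r -> point_lattice 2 (int_lattice a 0 v w).
Proof.
move=> r0 fr sep; have [z0 zB] := zlat_subgroup 0 v w.
exists a, (int_lattice 0 0 v w); split; last by rewrite translate_zlat.
  by split=> //; exact: separated_isolated sep.
exists [tuple v; w]; split=> //.
  move=> x /=; rewrite !inE => /orP[] /eqP ->.
  - by exists 0, 1, 0; rewrite !mulr0z !addr0 add0r.
  - by exists 0, 0, 1; rewrite !mulr0z !addr0 add0r.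
move=> _ [i [j [k ->]]] /=; rewrite mul0rz !add0r.
by rewrite !rpredD // rpredMz // memv_span // !inE eqxx ?orbT.
Qed.

(** Affine in [s], and for [s = 1] and [s = 2] a positive definite integral form. *)
Lemma tetra_form_ge1 (s : R) i j k : 1 <= s <= 2 ->
  ~~ [&& i == 0, j == 0 & k == 0] ->
  1 <= s * (i%:~R * (i%:~R + j%:~R + k%:~R))
    + (j%:~R ^+ 2 + k%:~R ^+ 2 + j%:~R * k%:~R) :> R.
Proof.
move=> /andP[s1 s2] nz.
pose q1 := i * (i + j + k) + (j ^+ 2 + k ^+ 2 + j * k).
pose q2 := 2 * (i * (i + j + k)) + (j ^+ 2 + k ^+ 2 + j * k).
have H1 : 1 <= q1.
  have E : 2 * q1 = (i + j) ^+ 2 + (j + k) ^+ 2 + (i + k) ^+ 2 by rewrite /q1; ring.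
  have := sqr_ge0 (i + j); have := sqr_ge0 (j + k); have := sqr_ge0 (i + k).
  move=> h1 h2 h3; rewrite -gtz0_ge1 lt0r; apply/andP; split; last by lia.
  apply: contra nz => /eqP q0.
  have /eqP : (i + j) ^+ 2 = 0 by lia.
  have /eqP : (j + k) ^+ 2 = 0 by lia.
  have /eqP : (i + k) ^+ 2 = 0 by lia.
  rewrite !sqrf_eq0 => /eqP ? /eqP ? /eqP ?; lia.
have H2 : 1 <= q2.
  have E : 2 * q2 = (2 * i + j + k) ^+ 2 + j ^+ 2 + k ^+ 2 by rewrite /q2; ring.
  have := sqr_ge0 (2 * i + j + k); have := sqr_ge0 j; have := sqr_ge0 k.
  move=> h1 h2 h3; rewrite -gtz0_ge1 lt0r; apply/andP; split; last by lia.
  apply: contra nz => /eqP q0.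
  have /eqP : (2 * i + j + k) ^+ 2 = 0 by lia.
  have /eqP : j ^+ 2 = 0 by lia.
  have /eqP : k ^+ 2 = 0 by lia.
  rewrite !sqrf_eq0 => /eqP ? /eqP ? /eqP ?; lia.
have {}H1 : 1 <= q1%:~R :> R by rewrite -[1]/(1%:~R) ler_int.
have {}H2 : 1 <= q2%:~R :> R by rewrite -[1]/(1%:~R) ler_int.
have -> : s * (i%:~R * (i%:~R + j%:~R + k%:~R))
    + (j%:~R ^+ 2 + k%:~R ^+ 2 + j%:~R * k%:~R)
  = (2 - s) * q1%:~R + (s - 1) * q2%:~R :> R.
  by rewrite /q1 /q2 !expr2 !(intrD, intrM); ring.
have : 0 <= (2 - s) * (q1%:~R - 1) by rewrite mulr_ge0 ?subr_ge0.
have : 0 <= (s - 1) * (q2%:~R - 1) by rewrite mulr_ge0 ?subr_ge0.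
lra.
Qed.

End IntegerLattices.

(** * Tetrahedra and pyramids *)

Section Tetrahedron.
Variables (R : realType) (d : R).
Hypotheses (d_ge1 : 1 <= d) (d_le : d ^+ 2 <= 2).
Implicit Types (a b c e u v w x : 'rV[R]_3) (i j k : int).

(** The Gram matrix of the edges of the tetrahedron at an end of its long edge. *)
Definition tetra_gram u v w :=
  [/\ dot u u = 4 * d ^+ 2, dot v v = 4, dot w w = 4 &
   [/\ dot u v = 2 * d ^+ 2, dot u w = 2 * d ^+ 2 & dot v w = 2]].

Lemma dotB u v : dot (u - v) (u - v) = dot u u - 2 * dot u v + dot v v.
Proof. by rewrite !dotE !coordE; ring. Qed.

Lemma dotC u v : dot u v = dot v u.
Proof. by rewrite !dotE; ring. Qed.

Lemma subBB a b c : b - c = (b - a) - (c - a).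
Proof. by rewrite opprB addrA subrK. Qed.

Lemma tetrahedronP a b c e : tetrahedron d a b c e <->
  free [:: b - a; c - a; e - a] /\ tetra_gram (b - a) (c - a) (e - a).
Proof.
have d1 := d_ge1.
have N x (r : R) : 0 <= r -> enorm x = r <-> dot x x = r ^+ 2.
  by move=> r0; split=> [<-|/enorm_eq]; [rewrite enorm_sqr|apply].
have d0 : 0 <= 2 * d by lra.
rewrite /tetrahedron /tetra_gram (subBB a c b) (subBB a e b) (subBB a e c).
move: (b - a) (c - a) (e - a) => u v w.
split=> [[fr /(N _ _ d0) h1 /(N _ 2 _) h2 /(N _ 2 _) h3
   [/(N _ 2 _) h4 /(N _ 2 _) h5 /(N _ 2 _) h6]]|[fr [h1 h2 h3 [h4 h5 h6]]]].
  have z2 : 0 <= 2 :> R by [].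
  move: (h2 z2) (h3 z2) (h4 z2) (h5 z2) (h6 z2) => {}h2 {}h3 {}h4 {}h5 {}h6.
  rewrite !dotB (dotC v u) in h4; rewrite !dotB (dotC w u) in h5.
  rewrite !dotB (dotC w v) in h6.
  by split => //; split; try split; lra.
split=> //.
- by apply/N => //; rewrite h1; ring.
- by apply/N => //; rewrite h2; ring.
- by apply/N => //; rewrite h3; ring.
split; apply/N => //; rewrite dotB.
- by rewrite (dotC v) h1 h2 h4; ring.
- by rewrite (dotC w) h1 h3 h5; ring.
- by rewrite (dotC w) h2 h3 h6; ring.
Qed.

Lemma tetra_norm u v w i j k : tetra_gram u v w ->
  ~~ [&& i == 0, j == 0 & k == 0] -> 2 <= enorm (u *~ i + v *~ j + w *~ k).
Proof.
move=> [h1 h2 h3 [h4 h5 h6]] nz; rewrite enorm_ge //.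
have -> : dot (u *~ i + v *~ j + w *~ k) (u *~ i + v *~ j + w *~ k)
  = i%:~R ^+ 2 * dot u u + j%:~R ^+ 2 * dot v v + k%:~R ^+ 2 * dot w w
    + 2 * (i%:~R * j%:~R * dot u v + i%:~R * k%:~R * dot u w
           + j%:~R * k%:~R * dot v w).
  by rewrite !dotE !coordE; ring.
rewrite h1 h2 h3 h4 h5 h6.
have s12 : 1 <= d ^+ 2 <= 2.
  by rewrite d_le andbT expr2 -[1]mulr1 ler_pM.
have := tetra_form_ge1 s12 nz; lra.
Qed.

Lemma tetra_separated a u v w : tetra_gram u v w -> separated (int_lattice a u v w) 2.
Proof.
move=> T _ _ [i [j [k ->]]] [i' [j' [k' ->]]] ne.
have -> : a + u *~ i + v *~ j + w *~ k - (a + u *~ i' + v *~ j' + w *~ k')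
  = u *~ (i - i') + v *~ (j - j') + w *~ (k - k').
  by apply: row3P; rewrite !coordE !intrB; ring.
apply: tetra_norm => //; rewrite !subr_eq0; apply: contra ne.
by move=> /and3P[/eqP -> /eqP -> /eqP ->].
Qed.

Lemma vertical_edge u v w : tetra_gram u v w -> vertical u ->
  u = (2 * d) *: e3 R \/ u = - ((2 * d) *: e3 R).
Proof.
move=> [h1 _ _ _] [t ut].
have /eqP : t ^+ 2 = (2 * d) ^+ 2.
  by rewrite exprMn (_ : 2 ^+ 2 = 4) -?h1 ?ut ?dotE ?coordE; ring.
by rewrite eqf_sqr => /orP[] /eqP tE; [left|right]; rewrite ut tE ?scaleNr.
Qed.

Lemma zlat_lat a u v w : tetra_gram u v w -> vertical u ->
  int_lattice a u v w = string_lattice d a v w.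
Proof.
move=> T /(vertical_edge T)[] ->; apply/seteqP; split=> x.
- move=> [i [j [k ->]]]; exists j, k, i.
  by apply: row3P; rewrite /lat_point /up !coordE; ring.
- move=> [i [j [k ->]]]; exists k, i, j.
  by apply: row3P; rewrite /lat_point /up !coordE; ring.
- move=> [i [j [k ->]]]; exists j, k, (- i).
  by apply: row3P; rewrite /lat_point /up !coordE !intrN; ring.
- move=> [i [j [k ->]]]; exists (- k), i, j.
  by apply: row3P; rewrite /lat_point /up !coordE !intrN; ring.
Qed.

(** The heights of the two other edges are both [d] or both [- d], so the planar
    Gram matrix is known. *)
Lemma tetra_det u v w : tetra_gram u v w -> vertical u -> `|planar_det v w| = 2 * tri_area d.
Proof.
have d1 := d_ge1; have d2 := d_le; have A0p := tri_area_gt0 d_le.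
move=> T /(vertical_edge T) uE; have [_ h2 h3 [h4 h5 h6]] := T.
have signs : (x3 v = d /\ x3 w = d) \/ (x3 v = - d /\ x3 w = - d).
  have cancel (y : R) : 2 * d * y = 2 * d ^+ 2 -> y = d.
    by rewrite expr2 mulrA; apply: mulfI; rewrite mulf_neq0 // gt_eqF //; lra.
  case: uE h4 h5 => ->; rewrite !dotE !coordE => h4 h5; [left|right].
    by split; apply: cancel; lra.
  by split; apply: (canRL (@opprK _)); apply: cancel; lra.
have [e1 e2 e3] : [/\ x3 v ^+ 2 = d ^+ 2, x3 w ^+ 2 = d ^+ 2
    & x3 v * x3 w = d ^+ 2].
  by case: signs => -[-> ->]; rewrite ?sqrrN ?mulrNN -?expr2.
have D2 : `|planar_det v w| ^+ 2 = (2 * tri_area d) ^+ 2.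
  rewrite real_normK ?num_real // exprMn /tri_area sqr_sqrtr; last by lra.
  have -> : planar_det v w ^+ 2 = (dot v v - x3 v ^+ 2) * (dot w w - x3 w ^+ 2)
    - (dot v w - x3 v * x3 w) ^+ 2 by rewrite /planar_det !dotE; ring.
  by rewrite h2 h3 h6 e1 e2 e3; ring.
move/eqP: D2; rewrite eqrXn2 //; first by move/eqP.
by rewrite mulr_ge0 // ltW.
Qed.

Lemma eta_bound : 4 / 3 * pi / (2 * d * (2 * tri_area d)) = density_bound d.
Proof.
have d1 := d_ge1; have A0p := tri_area_gt0 d_le.
rewrite /density_bound; field; rewrite !gt_eqF //; lra.
Qed.

Lemma tetra_density a u v w : tetra_gram u v w -> vertical u ->
  set_density (balls (int_lattice a u v w)) = (density_bound d)%:E.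
Proof.
have d1 := d_ge1; have A0p := tri_area_gt0 d_le; have d0 : 0 < d by lra.
move=> T vu; have D := tetra_det T vu.
have Dn : planar_det v w != 0.
  by rewrite -normr_gt0 D mulr_gt0.
rewrite -eta_bound -D (zlat_lat _ T vu); apply/eqP; rewrite eq_le.
rewrite lat_density_le //=; apply: lat_density_ge => //.
by rewrite -(zlat_lat _ T vu); exact: tetra_separated.
Qed.

Lemma set1_balls c : cball c 1 = balls [set c].
Proof. by rewrite /balls bigcup_set1. Qed.

Lemma tetra_packing a u v w : tetra_gram u v w ->
  packing (int_lattice a u v w) (fun x => cball x 1).
Proof.
move=> T x y Gx Gy [z]; rewrite !set1_balls => zxy.
apply/eqP; apply: contraT => ne; move: zxy; rewrite balls_disjoint //.
by move=> _ _ -> ->; exact: (tetra_separated T Gx Gy ne).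
Qed.

Lemma ball_centres_zlat a u v w : tetra_gram u v w -> vertical u ->
  ball_centres d (int_lattice a 0 v w) = int_lattice a u v w.
Proof.
move=> T vu; rewrite (zlat_lat _ T vu); apply/seteqP; split=> x.
  move=> [_ [i [j [k ->]]] [l _ <-]]; exists j, k, l.
  by rewrite /lat_point /up mul0rz addr0.
move=> [i [j [k ->]]]; exists (a + v *~ i + w *~ j).
  by exists 0, i, j; rewrite mulr0z addr0.
by exists k.
Qed.

Lemma density_ball_centres (Lam : set 'rV[R]_3) :
  density Lam (translate (string d)) = set_density (balls (ball_centres d Lam)).
Proof.
rewrite densityE (strings_balls d Lam id); congr set_density; congr balls.
Qed.

Lemma tetra_lattice_packing a u v w : tetra_gram u v w -> vertical u ->
  free [:: u; v; w] -> lattice_packing d (int_lattice a 0 v w).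
Proof.
have d1 := d_ge1; move=> T vu fr; split.
- apply: (@point_lattice_zlat2 _ _ _ _ 2) => //; first exact: free_cons2 fr.
  move=> x y [i [j [k xE]]] [i' [j' [k' yE]]]; apply: (tetra_separated (a := 0) T).
    by exists 0, j, k; rewrite xE mul0rz mulr0z.
  by exists 0, j', k'; rewrite yE mul0rz mulr0z.
- move=> x y Gx Gy [z]; rewrite !string_balls => zxy.
  apply/eqP; apply: contraT => ne; move: zxy; rewrite balls_disjoint //.
  move=> _ _ [l _ <-] [l' _ <-].
  have [s us] : exists s : int, (2 * d) *: e3 R = u *~ s.
    by have [->|->] := vertical_edge T vu; [exists 1|exists (-1)];
      rewrite ?mulrNz ?mulNrz ?opprK mulr1z.
  have up_u (m : int) : (2 * d * m%:~R) *: e3 R = u *~ (s * m).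
    by rewrite mulrC -scalerA us scaler_int mulrzA.
  case: Gx Gy ne => i [j [k ->]] [i' [j' [k' ->]]] ne.
  rewrite !up_u !mul0rz !addr0.
  have -> : a + v *~ j + w *~ k + u *~ (s * l)
      - (a + v *~ j' + w *~ k' + u *~ (s * l'))
    = u *~ (s * l - s * l') + v *~ (j - j') + w *~ (k - k').
    by apply: row3P; rewrite !coordE !intrB; ring.
  apply: tetra_norm => //; apply: contra ne => /and3P[_].
  by rewrite !subr_eq0 !mul0rz => /eqP -> /eqP ->.
rewrite (ball_centres_zlat a T vu).
exact: (@point_lattice_zlat3 _ _ _ _ _ 2) (tetra_separated T).
Qed.

Lemma tetra_exists : exists a b c e : 'rV[R]_3,
  tetrahedron d a b c e /\ vertical (b - a).
Proof.
have d1 := d_ge1; have A0p := tri_area_gt0 d_le; have d2 := d_le.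
(* the long edge is vertical, and the opposite one is parallel to the x-axis *)
exists 0, ((2 * d) *: e3 R), (row3 (1, tri_area d, d)), (row3 (-1, tri_area d, d)).
have A2 : tri_area d * tri_area d = 3 - d ^+ 2 by rewrite -expr2 sqr_sqrtr //; lra.
split; last by exists (2 * d); rewrite subr0.
apply/tetrahedronP; rewrite !subr0; split.
  apply/free3P => al be ga S.
  have := congr1 (@x1 R) S; have := congr1 (@x2 R) S; have := congr1 (@x3 R) S.
  rewrite !coordE /= => h3 h2 h1.
  have bg : be = ga by lra.
  have be0 : be = 0.
    apply: (@mulIf _ (2 * tri_area d)); first by rewrite gt_eqF ?mulr_gt0.
    by rewrite mul0r; move: h2; rewrite -bg; lra.
  split => //; last by rewrite -bg.
  apply: (@mulIf _ (2 * d)); first by rewrite gt_eqF //; lra.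
  by move: h3; rewrite -bg be0; lra.
rewrite /tetra_gram !dotE !coordE /= A2.
by split; try split; ring.
Qed.

(** Opposite edges of the tetrahedron are orthogonal, so the long edge and a
    translate of the opposite edge span a rectangle; the remaining vertex is at
    distance 2 from its corners. *)
Lemma pyramid_of_tetra a b c e : tetrahedron d a b c e ->
  pyramid d a b (b + (e - c)) (a + (e - c)) e /\
  lattice_gen [tuple a; b; b + (e - c); a + (e - c); e]
    = lattice_gen [tuple a; b; c; e].
Proof.
have d1 := d_ge1.
move=> /tetrahedronP[fr T]; have [h1 h2 h3 [h4 h5 h6]] := T.
set u := b - a in fr T h1 h4 h5; set v := c - a in fr T h2 h4 h6.
set w := e - a in fr T h3 h5 h6.
have bE : b = a + u by rewrite /u addrC subrK.
have cE : c = a + v by rewrite /v addrC subrK.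
have eE : e = a + w by rewrite /w addrC subrK.
have N x y (r : R) : x = y -> 0 <= r -> dot y y = r ^+ 2 -> enorm x = r.
  by move=> -> r0 /enorm_eq; apply.
have qp x : dot x x = 4 -> dot x x = 2 ^+ 2 by move=> ->; ring.
have wv : dot (w - v) (w - v) = 2 ^+ 2.
  by rewrite dotB (dotC w) h2 h3 h6; ring.
split; last first.
  apply/seteqP; split=> x.
    rewrite lattice_gen4E => /lattice_gen5P[i [j [k [l ->]]]].
    exists (i + j), (- j - k), (j + k + l); rewrite bE cE eE.
    by apply: row3P; rewrite !coordE !(intrD, intrN); ring.
  rewrite lattice_gen4E => -[i [j [k ->]]]; apply/lattice_gen5P.
  exists i, 0, (- j), (j + k); rewrite bE cE eE.
  by apply: row3P; rewrite !coordE !(intrD, intrN); ring.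
have ew x y : x - y = (x - y) :> 'rV[R]_3 by [].
split.
- rewrite /rectangular_right_pyramid.
  have -> : a + (e - c) - a = w - v.
    by rewrite cE eE; apply: row3P; rewrite !coordE; ring.
  rewrite -/u; set h := e - 2^-1 *: (a + (b + (e - c))).
  have hE : h = 2^-1 *: (v + w - u).
    by rewrite /h bE cE eE; apply: row3P; rewrite !coordE; field.
  split.
  + apply/free3P => al be ga S.
    have [|g1 g2 g3] := (free3P u v w).1 fr
      (al - ga / 2) (ga / 2 - be) (be + ga / 2).
      rewrite -[RHS]S hE.
      by apply: row3P; rewrite !coordE; field.
    by split; lra.
  + by rewrite bE; apply: row3P; rewrite !coordE; ring.
  + have -> : dot u (w - v) = dot u w - dot u v by rewrite !dotE !coordE; ring.
    by rewrite h4 h5 subrr.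
  + have -> : dot h u = 2^-1 * (dot u v + dot u w - dot u u).
      by rewrite hE !dotE !coordE; ring.
    by rewrite h1 h4 h5; field.
  + have -> : dot h (w - v) = 2^-1 * (dot w w - dot v v - (dot u w - dot u v)).
      by rewrite hE !dotE !coordE; ring.
    by rewrite h2 h3 h4 h5; field.
- by apply: (N _ u) => //; [lra|rewrite h1; ring].
- by apply: (N _ (w - v)) => //; rewrite cE eE; apply: row3P; rewrite !coordE; ring.
split.
- by apply: (N _ w) => //; exact: qp.
- apply: (N _ (w - u)) => //.
    by rewrite bE eE; apply: row3P; rewrite !coordE; ring.
  by rewrite dotB (dotC w) h1 h3 h5; ring.
- apply: (N _ (v - u)) => //.
    by rewrite bE cE eE; apply: row3P; rewrite !coordE; ring.
  by rewrite dotB (dotC v) h1 h2 h4; ring.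
- apply: (N _ v) => //; last exact: qp.
  by rewrite cE eE; apply: row3P; rewrite !coordE; ring.
Qed.

Lemma tetra_of_pyramid p0 p1 p2 p3 q : pyramid d p0 p1 p2 p3 q ->
  tetrahedron d p0 p1 (q - (p3 - p0)) q /\
  lattice_gen [tuple p0; p1; q - (p3 - p0); q]
    = lattice_gen [tuple p0; p1; p2; p3; q].
Proof.
have d1 := d_ge1.
move=> [[fr p2E uw hu hw] n1 n2 [n3 n4 n5 n6]].
set u := p1 - p0 in fr p2E uw hu n1; set w := p3 - p0 in fr p2E uw hw n2.
set h := q - _ in fr hu hw.
have p1E : p1 = p0 + u by rewrite /u addrC subrK.
have p3E : p3 = p0 + w by rewrite /w addrC subrK.
have hE : q = p0 + (h + 2^-1 *: (u + w)).
  by rewrite /h p2E; apply: row3P; rewrite !coordE; field.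
have D x (r : R) : enorm x = r -> dot x x = r ^+ 2 by move=> <-; rewrite enorm_sqr.
split; last first.
  apply/seteqP; split=> x.
    rewrite lattice_gen4E => -[i [j [k ->]]]; apply/lattice_gen5P.
    exists i, 0, (- j), (j + k); rewrite p2E p1E p3E.
    by apply: row3P; rewrite !coordE !(intrD, intrN); ring.
  rewrite lattice_gen4E => /lattice_gen5P[i [j [k [l ->]]]].
  exists (i + j), (- j - k), (j + k + l); rewrite p2E p1E p3E.
  by apply: row3P; rewrite !coordE !(intrD, intrN); ring.
apply/tetrahedronP.
have -> : q - w - p0 = h + 2^-1 *: (u - w).
  by rewrite [in LHS]hE; apply: row3P; rewrite !coordE; field.
have -> : q - p0 = h + 2^-1 *: (u + w) by rewrite [in LHS]hE addrC addKr.
rewrite -/u; split.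
  apply/free3P => al be ga S.
  have [|g1 g2 g3] := (free3P u w h).1 fr (al + (be + ga) / 2)
    ((ga - be) / 2) (be + ga).
    by rewrite -[RHS]S; apply: row3P; rewrite !coordE; field.
  by split; lra.
have hh : dot h h = 3 - d ^+ 2.
  have := D _ _ n3; have := D _ _ n1; have := D _ _ n2 => w2 u2.
  have -> : dot (q - p0) (q - p0) = dot h h + dot h u + dot h w
      + 4^-1 * (dot u u + 2 * dot u w + dot w w).
    by rewrite [in LHS]hE !dotE !coordE; field.
  by rewrite hu hw uw u2 w2; lra.
have u2 := D _ _ n1; have w2 := D _ _ n2.
split; try split.
- by rewrite u2; ring.
- have -> : dot (h + 2^-1 *: (u - w)) (h + 2^-1 *: (u - w)) = dot h h + dot h u
      - dot h w + 4^-1 * (dot u u - 2 * dot u w + dot w w).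
    by rewrite !dotE !coordE; field.
  by rewrite hh hu hw uw u2 w2; field.
- have -> : dot (h + 2^-1 *: (u + w)) (h + 2^-1 *: (u + w)) = dot h h + dot h u
      + dot h w + 4^-1 * (dot u u + 2 * dot u w + dot w w).
    by rewrite !dotE !coordE; field.
  by rewrite hh hu hw uw u2 w2; field.
- have -> : dot u (h + 2^-1 *: (u - w)) = dot h u + 2^-1 * (dot u u - dot u w).
    by rewrite !dotE !coordE; field.
  by rewrite hu uw u2; field.
- have -> : dot u (h + 2^-1 *: (u + w)) = dot h u + 2^-1 * (dot u u + dot u w).
    by rewrite !dotE !coordE; field.
  by rewrite hu uw u2; field.
- have -> : dot (h + 2^-1 *: (u - w)) (h + 2^-1 *: (u + w)) = dot h h + dot h u
      + 4^-1 * (dot u u - dot w w).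
    by rewrite !dotE !coordE; field.
  by rewrite hh hu u2 w2; field.
Qed.

End Tetrahedron.

(** * Isometries from Gram matrices *)

Section Congruence.
Variables (R : realType) (d : R).
Hypotheses (d_ge1 : 1 <= d) (d_le : d ^+ 2 <= 2).
Implicit Types (a u v w x : 'rV[R]_3) (i j k : int).

Lemma tetra_gram_free u v w : tetra_gram d u v w -> free [:: u; v; w].
Proof.
have d1 := d_ge1; have d2 := d_le.
move=> [h1 h2 h3 [h4 h5 h6]]; apply/free3P => al be ga S.
have D x : al * dot u x + be * dot v x + ga * dot w x = 0.
  have <- : dot (al *: u + be *: v + ga *: w) x
    = al * dot u x + be * dot v x + ga * dot w x.
    by rewrite !dotE !coordE; ring.
  by rewrite S dotE !coordE !mul0r !addr0.
have Du := D u; have Dv := D v; have Dw := D w.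
rewrite h1 (dotC v) (dotC w) h4 h5 in Du.
rewrite h2 h4 (dotC w) h6 in Dv; rewrite h3 h5 h6 in Dw.
have bg : be = ga by lra.
have ab : al = - be.
  apply: (@mulfI _ (4 * d ^+ 2)); last by rewrite -bg in Du; lra.
  by rewrite mulf_neq0 // expf_neq0 // gt_eqF //; lra.
have b0 : be = 0.
  apply: (@mulfI _ (6 - 2 * d ^+ 2)); first by rewrite gt_eqF //; lra.
  by rewrite mulr0; move: Dv; rewrite ab -bg; lra.
by rewrite ab -bg b0 oppr0.
Qed.

Lemma sum_ord3 (V : nmodType) (F : 'I_3 -> V) :
  \sum_(i < 3) F i = F (inord 0) + F (inord 1) + F (inord 2).
Proof.
rewrite !big_ord_recr big_ord0 /= add0r.
by congr (F _ + F _ + F _); apply/val_inj; rewrite /= inordK.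
Qed.

Definition frame u v w : 'M[R]_3 := \matrix_(i < 3) nth 0 [:: u; v; w] i.

Lemma row_frame u v w : [/\ row (inord 0) (frame u v w) = u,
  row (inord 1) (frame u v w) = v & row (inord 2) (frame u v w) = w].
Proof. by split; rewrite rowK inordK. Qed.

Lemma frame_gram u v w (i j : 'I_3) :
  (frame u v w *m (frame u v w)^T) i j
    = dot (row i (frame u v w)) (row j (frame u v w)).
Proof.
rewrite /dot !mxE; apply: eq_bigr => k _.
by rewrite !mxE.
Qed.

Lemma frame_unit u v w : free [:: u; v; w] -> frame u v w \in unitmx.
Proof.
move=> /free3P H; rewrite -row_free_unit; apply: inj_row_free => y.
have [r0 r1 r2] := row_frame u v w.
rewrite mulmx_sum_row sum_ord3 r0 r1 r2.
move=> /H[h1 h2 h3]; apply: row3P; rewrite !coordE; [exact: h1|exact: h2|exact: h3].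
Qed.

(** The matrix that maps one frame to the other is orthogonal, as the frames have
    the same Gram matrix. *)
Lemma gram_congruent a u v w a' u' v' w' :
  tetra_gram d u v w -> tetra_gram d u' v' w' ->
  congruent (int_lattice a u v w) (int_lattice a' u' v' w').
Proof.
move=> T T'; pose B := frame u v w; pose B' := frame u' v' w'.
have Bu : B \in unitmx by apply/frame_unit/tetra_gram_free.
have BB : B' *m B'^T = B *m B^T.
  apply/matrixP => i j; rewrite !frame_gram.
  have [r0 r1 r2] := row_frame u v w; have [s0 s1 s2] := row_frame u' v' w'.
  have [h1 h2 h3 [h4 h5 h6]] := T; have [g1 g2 g3 [g4 g5 g6]] := T'.
  by have [] := ord3P i => ->; have [] := ord3P j => ->;
    rewrite ?r0 ?r1 ?r2 ?s0 ?s1 ?s2 ?(dotC v u) ?(dotC w u) ?(dotC w v)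
      ?(dotC v' u') ?(dotC w' u') ?(dotC w' v') ?h1 ?h2 ?h3 ?h4 ?h5 ?h6.
pose M := invmx B *m B'.
have MM : M *m M^T = 1%:M.
  rewrite /M trmx_mul mulmxA -(mulmxA (invmx B)) BB.
  rewrite mulmxA mulVmx // mul1mx -trmx_mul mulVmx //.
  by rewrite trmx1.
have dM x y : dot (x *m M) (y *m M) = dot x y.
  by rewrite /dot trmx_mul mulmxA -(mulmxA x) MM mulmx1.
have BM : B *m M = B' by rewrite /M mulmxA mulmxV // mul1mx.
have [uM vM wM] : [/\ u *m M = u', v *m M = v' & w *m M = w'].
  have [r0 r1 r2] := row_frame u v w; have [s0 s1 s2] := row_frame u' v' w'.
  by split; [rewrite -s0|rewrite -s1|rewrite -s2];
    rewrite -/B' -BM row_mul ?r0 ?r1 ?r2.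
exists (fun x => (x - a) *m M + a').
  move=> x y; rewrite /enorm; congr Num.sqrt.
  have -> : (x - a) *m M + a' - ((y - a) *m M + a') = (x - y) *m M.
    by rewrite opprD addrACA subrr addr0 -mulmxBl opprB addrA subrK.
  exact: dM.
have fE i j k : (a + u *~ i + v *~ j + w *~ k - a) *m M + a'
    = a' + u' *~ i + v' *~ j + w' *~ k.
  have -> : a + u *~ i + v *~ j + w *~ k - a
    = i%:~R *: u + j%:~R *: v + k%:~R *: w.
    by apply: row3P; rewrite !coordE; ring.
  rewrite !mulmxDl -!scalemxAl uM vM wM.
  by apply: row3P; rewrite !coordE; ring.
apply/seteqP; split=> x.
  by move=> [_ [i [j [k ->]]] <-]; exists i, j, k; rewrite fE.
move=> [i [j [k ->]]]; exists (a + u *~ i + v *~ j + w *~ k) => //.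
by exists i, j, k.
Qed.

End Congruence.

(** * Reduced bases and the extremal cell *)

Lemma seq_min (R : realType) (T : eqType) (f : T -> R) (s : seq T) x : x \in s ->
  exists2 y, y \in s & forall z, z \in s -> f y <= f z.
Proof.
elim: s x => // a s IH x _; case: s IH => [|b s] IH.
  by exists a; rewrite ?mem_head // => z; rewrite inE => /eqP ->.
have [y ys ymin] := IH b (mem_head _ _).
have [ay|ya] := leP (f a) (f y).
  exists a; first exact: mem_head.
  by move=> z; rewrite inE => /orP[/eqP ->|/ymin]; [|apply: le_trans].
exists y; first by rewrite inE ys orbT.
by move=> z; rewrite inE => /orP[/eqP ->|/ymin]; [exact: ltW|].
Qed.

Lemma nearest_int (R : realType) (t : R) : exists k : int, `|t - k%:~R| <= 2^-1.
Proof.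
exists (Num.floor (t + 2^-1)); have /andP[] := floor_itv (t + 2^-1).
by rewrite intrD ler_norml => h1 h2; apply/andP; split; lra.
Qed.

Section PlanarReduction.
Variables (R : realType) (d : R).
Hypotheses (d_ge1 : 1 <= d) (d_le : d ^+ 2 <= 2).
Implicit Types (g u v w x : 'rV[R]_3) (i j k : int).

(** The squared norm of the horizontal projection. *)
Definition psq u : R := x1 u ^+ 2 + x2 u ^+ 2.
Definition pdot u v : R := x1 u * x1 v + x2 u * x2 v.

Lemma phase_sqr_le t : phase d t ^+ 2 <= d ^+ 2.
Proof.
have d1 := d_ge1; have d0 : 0 < d by lra.
by apply: lerXn2r; rewrite ?nnegrE ?phase_ge0 ?phase_le // ltW.
Qed.

Variable G : set 'rV[R]_3.
Hypotheses (G0 : G 0) (GB : forall x y, G x -> G y -> G (x - y)).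
Hypothesis Gsep : forall g, G g -> g != 0 -> 4 <= psq g + phase d (x3 g) ^+ 2.
Hypothesis Gfin : forall r, exists s : seq 'rV[R]_3, forall g, G g -> psq g <= r -> g \in s.
Hypothesis Gspan : exists g g', [/\ G g, G g' & planar_det g g' != 0].

Lemma G_opp x : G x -> G (- x).
Proof. by move=> /(GB G0); rewrite sub0r. Qed.

Lemma G_add x y : G x -> G y -> G (x + y).
Proof. by move=> Gx /G_opp Gy; rewrite -[y]opprK; apply: GB. Qed.

Lemma G_mulz x k : G x -> G (x *~ k).
Proof.
move=> Gx; have N n : G (x *+ n).
  by elim: n => [|n IH]; rewrite ?mulr0n // mulrS; apply: G_add.
by case: k => n; [exact: N | apply: G_opp; exact: N].
Qed.

Lemma psq_ge2 g : G g -> g != 0 -> 2 <= psq g.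
Proof.
move=> Gg g0; have := Gsep Gg g0; have := phase_sqr_le (x3 g).
by have := d_le; lra.
Qed.

Lemma psq_eq0 g : G g -> psq g = 0 -> g = 0.
Proof.
move=> Gg p0; apply/eqP; apply: contraT => /(psq_ge2 Gg).
by rewrite p0; lra.
Qed.

(** Finitely many elements have projections in a given disc. *)
Lemma G_min (Pr : 'rV[R]_3 -> Prop) : (exists g, G g /\ Pr g) ->
  exists g, [/\ G g, Pr g & forall g', G g' -> Pr g' -> psq g <= psq g'].
Proof.
move=> [g0 [Gg0 Pg0]]; have [s sP] := Gfin (psq g0).
pose t := [seq g <- s | `[< G g /\ Pr g >]].
have g0t : g0 \in t by rewrite mem_filter sP // andbT; apply/asboolP.
have [g] := seq_min psq g0t.
rewrite mem_filter => /andP[/asboolP[Gg Pg] _] gmin; exists g; split=> // g' Gg' Pg'.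
have [h|h] := leP (psq g') (psq g0).
  by apply: gmin; rewrite mem_filter sP // andbT; apply/asboolP.
by rewrite (le_trans (gmin _ g0t)) // ltW.
Qed.

(** A shortest nonzero projection, then a shortest one that is not parallel to it.
    Subtracting the nearest integral combination from an element of the group
    leaves coefficients of absolute value at most 1/2, which would give a
    shorter element unless they vanish. *)
Lemma reduced_basis : exists u v, [/\ [/\ G u, G v & planar_det u v != 0],
  psq u <= psq v, 0 <= 2 * pdot u v <= psq u &
  forall g, G g <-> exists i j, g = u *~ i + v *~ j].
Proof.
have [g1 [g2 [Gg1 Gg2 D12]]] := Gspan.
have ne0 x y : planar_det x y != 0 -> x != 0 /\ y != 0.
  by move=> D; split; apply: contraNneq D => ->;
    rewrite /planar_det !coordE ?mul0r ?mulr0 subrr.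
have [u [Gu u0 umin]] : exists g, [/\ G g, g != 0 & forall g', G g' -> g' != 0 ->
    psq g <= psq g'].
  by apply: (G_min (Pr := fun g => g != 0)); exists g1; split=> //; case: (ne0 _ _ D12).
have U2 := psq_ge2 Gu u0.
have [v [Gv Dv vmin]] : exists g, [/\ G g, planar_det u g != 0 &
    forall g', G g' -> planar_det u g' != 0 -> psq g <= psq g'].
  apply: (G_min (Pr := fun g => planar_det u g != 0)).
  have [e1|e1] := eqVneq (planar_det u g1) 0; last by exists g1.
  have [e2|e2] := eqVneq (planar_det u g2) 0; last by exists g2.
  exfalso; move/eqP: D12; apply; apply: (@mulfI _ (psq u)).
    by rewrite gt_eqF //; lra.
  have -> : psq u * planar_det g1 g2 = pdot u g1 * planar_det u g2 - pdot u g2 * planar_det u g1.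
    by rewrite /psq /pdot /planar_det; ring.
  by rewrite e1 e2 !mulr0 subrr.
have [_ v0] := ne0 _ _ Dv.
have UV := umin _ Gv v0.
wlog pd : v Gv Dv vmin v0 UV / 0 <= pdot u v.
  move=> H; have [h|h] := leP 0 (pdot u v); first exact: (H v).
  have dN : planar_det u (- v) = - planar_det u v by rewrite /planar_det !coordE; ring.
  have pN : psq (- v) = psq v by rewrite /psq !coordE; ring.
  apply: (H (- v)); rewrite ?dN ?pN ?oppr_eq0 //; first exact: G_opp.
  have -> : pdot u (- v) = - pdot u v by rewrite /pdot !coordE; ring.
  by rewrite oppr_ge0 ltW.
have puv : 2 * pdot u v <= psq u.
  (* v - u is a competitor of v *)
  have D' : planar_det u (v - u) = planar_det u v by rewrite /planar_det !coordE; ring.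
  have := vmin (v - u) (GB Gv Gu); rewrite D' => /(_ Dv).
  have -> : psq (v - u) = psq v - 2 * pdot u v + psq u.
    by rewrite /psq /pdot !coordE; ring.
  lra.
exists u, v; split=> //.
  by rewrite puv mulr_ge0.
move=> g; split; last by move=> [i [j ->]]; apply: G_add; exact: G_mulz.
move=> Gg.
have [i] := nearest_int (planar_det g v / planar_det u v).
have [j] := nearest_int (planar_det u g / planar_det u v).
set be := _ - j%:~R; set al := _ - i%:~R => bej ali.
exists i, j; pose r := g - (u *~ i + v *~ j).
have Gr : G r by apply: GB => //; apply: G_add; exact: G_mulz.
have r1 : x1 r = al * x1 u + be * x1 v.
  rewrite /r /al /be !coordE; have := Dv; rewrite /planar_det => Dn; field.
  exact: Dn.
have r2 : x2 r = al * x2 u + be * x2 v.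
  rewrite /r /al /be !coordE; have := Dv; rewrite /planar_det => Dn; field.
  exact: Dn.
have pr : psq r = al ^+ 2 * psq u + 2 * (al * be * pdot u v) + be ^+ 2 * psq v.
  by rewrite /psq r1 r2 /pdot; ring.
have al2 : al ^+ 2 <= 4^-1.
  rewrite -real_normK ?num_real // (_ : 4^-1 = 2^-1 ^+ 2); last by field.
  by apply: lerXn2r; rewrite ?nnegrE.
have be2 : be ^+ 2 <= 4^-1.
  rewrite -real_normK ?num_real // (_ : 4^-1 = 2^-1 ^+ 2); last by field.
  by apply: lerXn2r; rewrite ?nnegrE.
have ab : 2 * (al * be) <= 2^-1 by have := sqr_ge0 (al - be); lra.
have V0 : 0 < psq v by lra.
have be0 : be = 0.
  apply/eqP; apply: contraT => ben0.
  have : planar_det u r != 0.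
    have -> : planar_det u r = be * planar_det u v by rewrite /planar_det r1 r2; ring.
    by rewrite mulf_neq0.
  move=> /(vmin _ Gr); rewrite pr.
  have : 0 <= (4^-1 - al ^+ 2) * psq u by rewrite mulr_ge0 ?subr_ge0 //; lra.
  have : 0 <= (4^-1 - be ^+ 2) * psq v by rewrite mulr_ge0 ?subr_ge0 // ltW.
  have : 0 <= (2^-1 - 2 * (al * be)) * pdot u v by rewrite mulr_ge0 ?subr_ge0.
  by lra.
have r0 : r = 0.
  apply/eqP; apply: contraT => rn0.
  have := umin _ Gr rn0; rewrite pr be0 mulr0 mul0r mulr0 expr0n /= mul0r !addr0.
  have : 0 <= (4^-1 - al ^+ 2) * psq u by rewrite mulr_ge0 ?subr_ge0 //; lra.
  by lra.
by move/eqP: r0; rewrite subr_eq0 => /eqP.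
Qed.

End PlanarReduction.

(** The form is a quadratic form whose polar form is increasing in both arguments
    as long as the triangles are not obtuse; the triangle with sides in [2, 4]
    never is. *)
Lemma bound_form_mono (R : realType) (U V W m1 m2 m3 : R) :
  m1 <= U -> m2 <= V -> m3 <= W ->
  2 <= m1 <= 4 -> 2 <= m2 <= 4 -> 2 <= m3 <= 4 ->
  [/\ 0 < V + W - U, 0 < U + W - V & 0 <= U + V - W] ->
  bound_form U V W <= bound_form m1 m2 m3 -> [/\ U = m1, V = m2 & W = m3].
Proof.
move=> l1 l2 l3 /andP[b1 b1'] /andP[b2 b2'] /andP[b3 b3'] [n1 n2 n3] le.
have P x m y z : m <= x -> 0 <= y -> 0 <= z -> 0 <= (x - m) * y /\ 0 <= (x - m) * z :> R.
  by move=> xm y0 z0; rewrite !mulr_ge0 ?subr_ge0.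
have [t1 q1] := P U m1 (V + W - U) (m2 + m3 - m1) l1 (ltW n1) ltac:(clear -b1' b2 b3; lra).
have [t2 q2] := P V m2 (U + W - V) (m1 + m3 - m2) l2 (ltW n2) ltac:(clear -b2' b1 b3; lra).
have [t3 q3] := P W m3 (U + V - W) (m1 + m2 - m3) l3 n3 ltac:(clear -b3' b1 b2; lra).
(* the difference of the two forms, split with the polar form at (U,V,W) and m *)
have S : (U - m1) * (V + W - U) + (V - m2) * (U + W - V) + (W - m3) * (U + V - W)
  + (U - m1) * (m2 + m3 - m1) + (V - m2) * (m1 + m3 - m2)
  + (W - m3) * (m1 + m2 - m3) <= 0.
  move: le; rewrite -subr_le0 /bound_form; apply: le_trans.
  by rewrite le_eqVlt; apply/orP; left; apply/eqP; ring.
have Z x m y : 0 < y -> (x - m) * y <= 0 -> m <= x -> x = m :> R.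
  move=> y0 xy mx; apply/eqP; rewrite eq_le mx andbT -subr_le0.
  by rewrite -(pmulr_lle0 _ y0).
have e1 : U = m1 by apply: (Z _ _ _ n1) => //; move: S t2 t3 q1 q2 q3; clear; lra.
have e2 : V = m2 by apply: (Z _ _ _ n2) => //; move: S t1 t3 q1 q2 q3; clear; lra.
split=> //.
(* the two remaining factors cannot vanish together unless W = m3 = U + V *)
have [h|h] := leP (U + V - W) 0.
  have [k|k] := ltP 0 (m1 + m2 - m3).
    by apply: (Z _ _ _ k) => //; move: S t1 t2 t3 q1 q2; clear; lra.
  by apply/eqP; rewrite eq_le l3 andbT; move: n3 h k; rewrite e1 e2; clear; lra.
by apply: (Z _ _ _ h) => //; move: S t1 t2 q1 q2 q3; clear; lra.
Qed.

Section ExtremalCell.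
Variables (R : realType) (d : R).
Hypotheses (d_ge1 : 1 <= d) (d_le : d ^+ 2 <= 2).
Implicit Types (a u v w x : 'rV[R]_3).

Definition well_separated x := 4 <= psq x + phase d (x3 x) ^+ 2.

(** The area of the reduced triangle is at most the minimum of [bound_form_ge],
    so equality holds everywhere. *)
Lemma extremal_cell u v (w := u - v) : psq u <= psq v ->
  0 <= 2 * pdot u v <= psq u -> 0 < psq u ->
  well_separated u -> well_separated v -> well_separated w ->
  planar_det u v ^+ 2 <= 4 * (3 - d ^+ 2) ->
  [/\ psq u = 4 - phase d (x3 u) ^+ 2, psq v = 4 - phase d (x3 v) ^+ 2,
      psq w = 4 - phase d (x3 w) ^+ 2 &
  [\/ [/\ phase d (x3 u) = d, phase d (x3 v) = d & phase d (x3 w) = 0],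
      [/\ phase d (x3 u) = d, phase d (x3 v) = 0 & phase d (x3 w) = d] |
      [/\ phase d (x3 u) = 0, phase d (x3 v) = d & phase d (x3 w) = d]]].
Proof.
have d1 := d_ge1; have d2 := d_le; have d0 : 0 < d by lra.
move=> UV /andP[p0 pU] U0; rewrite /well_separated => su sv sw D.
have hw : x3 w = x3 u - x3 v by rewrite /w !coordE.
have eu : phase d (x3 u - 0) = phase d (x3 u) by rewrite subr0.
have ev : phase d (0 - x3 v) = phase d (x3 v) by rewrite sub0r phaseN.
have ew : phase d (x3 v - x3 u) = phase d (x3 w) by rewrite -phaseN // opprB hw.
have Qge := bound_form_ge d0 (x3 u) 0 (x3 v).
have Qeq := @bound_form_eq R d d0 (x3 u) 0 (x3 v).
rewrite /= eu ev ew in Qge Qeq.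
have Wp : psq w = psq u + psq v - 2 * pdot u v.
  by rewrite /psq /pdot /w !coordE; ring.
have Df : 4 * planar_det u v ^+ 2 = bound_form (psq u) (psq v) (psq w).
  by rewrite Wp /bound_form /planar_det /psq /pdot; ring.
have mu := phase_sqr_le d1 (x3 u); have mv := phase_sqr_le d1 (x3 v).
have mw := phase_sqr_le d1 (x3 w).
have nu := sqr_ge0 (phase d (x3 u)); have nv := sqr_ge0 (phase d (x3 v)).
have nw := sqr_ge0 (phase d (x3 w)).
set m1 := 4 - phase d (x3 u) ^+ 2 in Qge Qeq *.
set m2 := 4 - phase d (x3 v) ^+ 2 in Qge Qeq *.
set m3 := 4 - phase d (x3 w) ^+ 2 in Qge Qeq *.
have l1 : m1 <= psq u by rewrite /m1; lra.
have l2 : m2 <= psq v by rewrite /m2; lra.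
have l3 : m3 <= psq w by rewrite /m3; lra.
have b1 : 2 <= m1 <= 4 by apply/andP; split; rewrite /m1; lra.
have b2 : 2 <= m2 <= 4 by apply/andP; split; rewrite /m2; lra.
have b3 : 2 <= m3 <= 4 by apply/andP; split; rewrite /m3; lra.
have le : bound_form (psq u) (psq v) (psq w) <= bound_form m1 m2 m3.
  by rewrite -Df; apply: le_trans Qge; lra.
have nob : [/\ 0 < psq v + psq w - psq u, 0 < psq u + psq w - psq v
    & 0 <= psq u + psq v - psq w] by rewrite Wp; split; lra.
have [e1 e2 e3] := bound_form_mono l1 l2 l3 b1 b2 b3 nob le.
by split=> //; apply: Qeq; rewrite -e1 -e2 -e3 -Df; lra.
Qed.

End ExtremalCell.

(** * Uniqueness of the densest lattice packing *)

Section Uniqueness.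
Variables (R : realType) (d : R).
Hypotheses (d_ge1 : 1 <= d) (d_le : d ^+ 2 <= 2).
Implicit Types (a g u v w x p q : 'rV[R]_3) (i j k : int).

Lemma phase_top h : phase d h = d -> exists k, h + 2 * d * k%:~R = d.
Proof.
have d1 := d_ge1; rewrite /phase /residue; set n := nearest d h.
have [r0|r0] := leP 0 (h - 2 * d * n%:~R).
  rewrite ger0_norm // => e; exists (- n).
  by rewrite intrN mulrN.
rewrite ltr0_norm // => e; exists (1 - n).
by rewrite intrB; lra.
Qed.

Lemma lat_up a p q k l : string_lattice d a p q = int_lattice a ((2 * d) *: e3 R) (up d p k) (up d q l).
Proof.
apply/seteqP; split=> x.
  move=> [i [j [m ->]]]; exists (m - k * i - l * j), i, j.
  apply: row3P; rewrite /lat_point /up !coordE ?(intrB, intrM); ring.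
move=> [m [i [j ->]]]; exists i, j, (m + k * i + l * j).
apply: row3P; rewrite /lat_point /up !coordE ?(intrD, intrM); ring.
Qed.

(** Both generators can be moved along their strings to height [d]. *)
Lemma extremal_gram p q : phase d (x3 p) = d -> phase d (x3 q) = d ->
  psq p = 4 - d ^+ 2 -> psq q = 4 - d ^+ 2 -> psq (p - q) = 4 ->
  exists k l, tetra_gram d ((2 * d) *: e3 R) (up d p k) (up d q l).
Proof.
move=> /phase_top[k pk] /phase_top[l ql] p2 q2 pq2; exists k, l.
have P : 2 * pdot p q = 4 - 2 * d ^+ 2.
  have : psq (p - q) = psq p + psq q - 2 * pdot p q.
    by rewrite /psq /pdot !coordE; ring.
  by rewrite p2 q2 pq2; lra.
have xp : x3 (up d p k) = d by rewrite /up !coordE mulr1.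
have xq : x3 (up d q l) = d by rewrite /up !coordE mulr1.
have [a1 a2] : x1 (up d p k) = x1 p /\ x2 (up d p k) = x2 p.
  by rewrite /up !coordE !mulr0 !addr0.
have [b1 b2] : x1 (up d q l) = x1 q /\ x2 (up d q l) = x2 q.
  by rewrite /up !coordE !mulr0 !addr0.
rewrite /tetra_gram !dotE xp xq a1 a2 b1 b2 !coordE.
rewrite /psq in p2 q2; rewrite /pdot in P.
by split; try split; lra.
Qed.

(** In each of the three cases, two of [u], [v] and [u - v] generate with phase
    [d], and the third is their difference up to sign, with phase 0. *)
Lemma extremal_lattice a u v : psq u <= psq v ->
  0 <= 2 * pdot u v <= psq u -> 0 < psq u ->
  well_separated d u -> well_separated d v -> well_separated d (u - v) ->
  planar_det u v ^+ 2 <= 4 * (3 - d ^+ 2) ->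
  exists e f g, tetra_gram d e f g /\ string_lattice d a u v = int_lattice a e f g.
Proof.
move=> h1 h2 h3 h4 h5 h6 h7.
have [U V W cases] := extremal_cell d_ge1 d_le h1 h2 h3 h4 h5 h6 h7.
have fin p q : string_lattice d a u v = string_lattice d a p q -> phase d (x3 p) = d ->
    phase d (x3 q) = d -> psq p = 4 - d ^+ 2 -> psq q = 4 - d ^+ 2 ->
    psq (p - q) = 4 ->
    exists e f g, tetra_gram d e f g /\ string_lattice d a u v = int_lattice a e f g.
  move=> -> hp hq p2 q2 pq2; have [k [l T]] := extremal_gram hp hq p2 q2 pq2.
  by exists ((2 * d) *: e3 R), (up d p k), (up d q l); rewrite (lat_up a p q k l).
case: cases => -[e1 e2 e3]; rewrite e1 e2 e3 ?expr0n /= ?subr0 in U V W.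
- exact: (fin u v).
- apply: (fin u (u - v)) => //; first by rewrite lat_subr.
  by rewrite opprB addrCA subrr addr0.
- apply: (fin v (v - u)) => //; first by rewrite lat_subr lat_swap.
  + by rewrite -phaseN ?(lt_le_trans _ d_ge1) // -x3N opprB.
  + by rewrite -W /psq !coordE; ring.
  + by rewrite opprB addrCA subrr addr0.
Qed.

Lemma string_set_count C : string_set d C ->
  exists eta delta, count_le C eta delta.
Proof.
have d1 := d_ge1; have A0p := tri_area_gt0 d_le; move=> CS.
have dd : 0 < 2 * d by lra.
have M0 : 0 <= (1 + 6) ^+ 2 / (2 * tri_area d).
  by rewrite divr_ge0 ?sqr_ge0 // mulr_ge0 // ltW.
have cnt := @count_upper R 1 0 1 (2 * d) ltr01 ltr01 dd C _ M0
  (fun _ l ul lP => string_tile_count d_ge1 d_le CS ltr01 ul lP).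
by eexists; eexists; exact: cnt.
Qed.

(** The coefficients of the first relation are the minors of the coordinates of
    the three vectors in the plane spanned by [p] and the vertical. *)
Lemma three_in_plane_not_free (s : nat -> 'rV[R]_3) p (t : nat -> R) :
  (forall n, x1 (s n) = t n * x1 p /\ x2 (s n) = t n * x2 p) ->
  ~ free [:: s 0%N; s 1%N; s 2%N].
Proof.
move=> H /free3P F.
have [h10 h20] := H 0%N; have [h11 h21] := H 1%N; have [h12 h22] := H 2%N.
have [|a0 b0 c0] := F (t 1%N * x3 (s 2%N) - t 2%N * x3 (s 1%N))
   (t 2%N * x3 (s 0%N) - t 0%N * x3 (s 2%N))
   (t 0%N * x3 (s 1%N) - t 1%N * x3 (s 0%N)).
  by apply: row3P; rewrite !coordE ?h10 ?h20 ?h11 ?h21 ?h12 ?h22; ring.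
have [|z1 z0 _] := F (x3 (s 1%N)) (- x3 (s 0%N)) 0.
  apply: row3P; rewrite !coordE ?h10 ?h20 ?h11 ?h21 ?h12 ?h22.
  - have -> : x3 (s 1%N) * (t 0%N * x1 p) + - x3 (s 0%N) * (t 1%N * x1 p)
      + 0 * (t 2%N * x1 p) = (t 0%N * x3 (s 1%N) - t 1%N * x3 (s 0%N)) * x1 p by ring.
    by rewrite c0 mul0r.
  - have -> : x3 (s 1%N) * (t 0%N * x2 p) + - x3 (s 0%N) * (t 1%N * x2 p)
      + 0 * (t 2%N * x2 p) = (t 0%N * x3 (s 1%N) - t 1%N * x3 (s 0%N)) * x2 p by ring.
    by rewrite c0 mul0r.
  - by ring.
have z0' : x3 (s 0%N) = 0 by apply/eqP; rewrite -oppr_eq0 z0.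
have [|t1 t0 _] := F (t 1%N) (- t 0%N) 0.
  apply: row3P; rewrite !coordE ?h10 ?h20 ?h11 ?h21 ?h12 ?h22 ?z0' ?z1; ring.
have t0' : t 0%N = 0 by apply/eqP; rewrite -oppr_eq0 t0.
have [|/eqP] := F 1 0 0; last by rewrite oner_eq0.
by apply: row3P; rewrite !coordE ?h10 ?h20 ?z0' ?t0'; ring.
Qed.

Theorem lattice_uniqueness (Lam : set 'rV[R]_3) a u v w :
  lattice_packing d Lam ->
  density Lam (translate (string d)) = (density_bound d)%:E ->
  tetra_gram d u v w ->
  congruent (ball_centres d Lam) (int_lattice a u v w).
Proof.
have d1 := d_ge1; have d2 := d_le; have A0p := tri_area_gt0 d_le.
have d0 : 0 < d by lra.
move=> [[v0 [G [[G0 GB _] _ LamE]]] pk [v3 [G3 [[G30 _ _] [s [sfree sG _]] CE]]]] dens T.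
have GLam g : G g -> Lam (g + v0) by move=> Gg; rewrite LamE; exists g.
have Gsep g : G g -> g != 0 -> 4 <= psq g + phase d (x3 g) ^+ 2.
  move=> Gg g0; have L1 := GLam g Gg; have L2 := GLam 0 G0; rewrite add0r in L2.
  have dis : (translate (string d) (g + v0))° `&` (translate (string d) v0)° = set0.
    apply: contrapT => h; move/eqP: g0; apply; apply: (addIr v0).
    by rewrite add0r; apply: pk => //; apply/set0P/eqP.
  rewrite !string_balls in dis.
  have c1 : [set g + v0 + (2 * d * k%:~R) *: e3 R | k in [set: int]] (g + v0).
    by exists 0; rewrite // mulr0 scale0r addr0.
  have c2 : [set v0 + (2 * d * k%:~R) *: e3 R | k in [set: int]]
      (v0 + (2 * d * (nearest d (x3 g))%:~R) *: e3 R).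
    by exists (nearest d (x3 g)).
  have := balls_separated dis c1 c2.
  rewrite enorm_ge // dotE !coordE /psq /phase real_normK ?num_real // /residue.
  by rewrite (_ : 2 ^+ 2 = 4); [lra|ring].
have CS : string_set d (ball_centres d Lam) by exact: (@packing_string_set R d _ Lam id pk).
have psq0 := psq_eq0 d_ge1 d_le Gsep.
have Gfin (r : R) : exists s : seq 'rV[R]_3, forall g, G g -> psq g <= r -> g \in s.
  have [r0|r0] := ltP r 0.
    exists [::] => g _ gr; have : 0 <= psq g by rewrite addr_ge0 ?sqr_ge0.
    by rewrite leNgt (le_lt_trans gr).
  have [eta [delta cnt]] := string_set_count CS.
  (* the element moved along its string to a bounded height *)
  pose phi g := up d (g + v0) (- nearest d (x3 g)).
  pose rho := enorm v0 + ((1 + r) + (1 + r) + d).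
  have rho0 : 0 < rho by have := enorm_ge0 v0; rewrite /rho; lra.
  have [t [_ tP]] : exists t, uniq t /\ forall g, g \in t <-> G g /\ psq g <= r.
    apply: (@bounded_enum_real R _ _ (eta * (rho + delta) ^+ 3)) => t ut tP.
    rewrite -(size_map phi); apply: cnt => //.
      rewrite map_inj_in_uniq // => g g' /tP[Gg _] /tP[Gg' _] e.
      apply/eqP; rewrite -subr_eq0; apply/eqP/psq0; first exact: GB.
      have := congr1 (@x1 R) e; have := congr1 (@x2 R) e.
      rewrite /phi /up /psq !coordE => e2 e1.
      have -> : x1 g + - x1 g' = 0 by lra.
      have -> : x2 g + - x2 g' = 0 by lra.
      by rewrite expr0n addr0.
    move=> x /mapP[g /tP[Gg gr] ->]; split.
      by exists (g + v0); [exact: GLam|exists (- nearest d (x3 g))].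
    have -> : phi g = v0 + (phi g - v0) by rewrite addrC subrK.
    rewrite (le_trans (enormD _ _)) // /rho lerD2l.
    rewrite (le_trans (enorm_le_coord _)) // /phi /up !coordE.
    have sq1 (y : R) : `|y| <= 1 + y ^+ 2.
      rewrite -(@real_normK _ y) ?num_real //.
      by have := sqr_ge0 (`|y| - 1); have := normr_ge0 y; lra.
    have := sq1 (x1 g); have := sq1 (x2 g).
    have := phase_le d0 (x3 g); rewrite /phase /residue.
    move: gr; rewrite /psq => gr p3 p2 p1.
    have := sqr_ge0 (x1 g); have := sqr_ge0 (x2 g) => s2 s1.
    have -> : x1 g + x1 v0 + 2 * d * (- nearest d (x3 g))%:~R * 0 + - x1 v0 = x1 g.
      by ring.
    have -> : x2 g + x2 v0 + 2 * d * (- nearest d (x3 g))%:~R * 0 + - x2 v0 = x2 g.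
      by ring.
    have -> : x3 g + x3 v0 + 2 * d * (- nearest d (x3 g))%:~R * 1 + - x3 v0
       = x3 g - 2 * d * (nearest d (x3 g))%:~R by rewrite intrN; ring.
    by lra.
  by exists t => g Gg gr; apply/tP.
have Gspan : exists g g', [/\ G g, G g' & planar_det g g' != 0].
  apply: contrapT => noG.
  have par g g' : G g -> G g' -> planar_det g g' = 0.
    move=> Gg Gg'; apply/eqP; apply: contraT => D.
    by case: noG; exists g, g'.
  have [p pP] : exists p, forall g, G g ->
      exists t : R, x1 g = t * x1 p /\ x2 g = t * x2 p.
    have [[p [Gp pn]]|no] := pselect (exists g, G g /\ psq g != 0).
      exists p => g Gg; exists (pdot g p / psq p).
      have D := par p g Gp Gg.
      split; apply: (@mulIf _ (psq p)) => //.
        rewrite mulrAC divfK //; apply/eqP; rewrite -subr_eq0.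
        have -> : x1 g * psq p - pdot g p * x1 p = - x2 p * planar_det p g.
          by rewrite /psq /pdot /planar_det; ring.
        by rewrite D mulr0.
      rewrite mulrAC divfK //; apply/eqP; rewrite -subr_eq0.
      have -> : x2 g * psq p - pdot g p * x2 p = x1 p * planar_det p g.
        by rewrite /psq /pdot /planar_det; ring.
      by rewrite D mulr0.
    exists 0 => g Gg; exists 0; rewrite !coordE mulr0.
    have /eqP : psq g = 0.
      by apply/eqP; apply: contraT => pn; case: no; exists g.
    by rewrite paddr_eq0 ?sqr_ge0 // !sqrf_eq0 => /andP[/eqP -> /eqP ->].
  have CG x : ball_centres d Lam x -> exists t : R,
      x1 x - x1 v0 = t * x1 p /\ x2 x - x2 v0 = t * x2 p.
    rewrite LamE => -[_ [g Gg <-] [k _ <-]]; have [t [t1 t2]] := pP g Gg.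
    by exists t; rewrite !coordE t1 t2; split; ring.
  have sP n : exists t : R, x1 s`_n = t * x1 p /\ x2 s`_n = t * x2 p.
    have [ns|ns] := leqP (size s) n.
      by exists 0; rewrite nth_default // !coordE !mul0r.
    have [|t [t1 t2]] := CG (s`_n + v3).
      by rewrite CE; exists s`_n => //; apply: sG; exact: mem_nth.
    have [|t' [t1' t2']] := CG v3.
      by rewrite CE; exists 0 => //; rewrite add0r.
    exists (t - t'); rewrite !mulrBl -t1 -t2 -t1' -t2' !coordE.
    by split; ring.
  have [t tP] := choice sP.
  apply: (@three_in_plane_not_free (fun n => s`_n) p t tP).
  move: sfree; congr (free _); case: (s) => -[|x [|y [|z []]]] //.
have [u0 [w0 [[Gu Gw D] UV uw Gbasis]]] :=
  reduced_basis d_ge1 d_le G0 GB Gsep Gfin Gspan.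
have CL : ball_centres d Lam = string_lattice d v0 u0 w0.
  rewrite LamE; apply/seteqP; split=> x.
    move=> [_ [g /Gbasis[i [j ->]] <-] [k _ <-]]; exists i, j, k.
    by apply: row3P; rewrite /lat_point /up !coordE; ring.
  move=> [i [j [k ->]]]; exists (u0 *~ i + w0 *~ j + v0).
    by exists (u0 *~ i + w0 *~ j) => //; apply/Gbasis; exists i, j.
  by exists k => //; apply: row3P; rewrite /lat_point /up !coordE; ring.
have nz : [/\ u0 != 0, w0 != 0 & u0 - w0 != 0].
  split; apply: contraNneq D.
  - by move=> ->; rewrite /planar_det !coordE !mul0r subrr.
  - by move=> ->; rewrite /planar_det !coordE !mulr0 subrr.
  - by move/eqP; rewrite subr_eq0 => /eqP ->; rewrite /planar_det mulrC subrr.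
have [nu nw nuw] := nz.
have Dle : planar_det u0 w0 ^+ 2 <= 4 * (3 - d ^+ 2).
  have := lat_density_le d0 v0 D.
  rewrite -CL -density_ball_centres dens -eta_bound // lee_fin.
  have K0 : 0 < 4 / 3 * pi :> R by rewrite mulr_gt0 ?pi_gt0.
  have X0 : 0 < 2 * d * (2 * tri_area d) by rewrite !mulr_gt0.
  have Y0 : 0 < 2 * d * `|planar_det u0 w0| by rewrite !mulr_gt0 ?normr_gt0.
  rewrite ler_pM2l // lef_pV2 ?posrE // ler_pM2l; last by rewrite mulr_gt0.
  move=> h; rewrite -real_normK ?num_real //.
  have -> : 4 * (3 - d ^+ 2) = (2 * tri_area d) ^+ 2.
    by rewrite exprMn /tri_area sqr_sqrtr; [ring|lra].
  by apply: lerXn2r; rewrite ?nnegrE // mulr_ge0 // ltW.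
have U0 : 0 < psq u0 by have := psq_ge2 d_ge1 d_le Gsep Gu nu; lra.
have [e [f [h [T' LE]]]] := extremal_lattice v0 UV uw U0 (@Gsep u0 Gu nu)
  (@Gsep w0 Gw nw) (@Gsep (u0 - w0) (@GB u0 w0 Gu Gw) nuw) Dle.
by rewrite CL LE; apply: (gram_congruent d_ge1 d_le).
Qed.

End Uniqueness.

(** * Density bound, extremal lattice and uniqueness *)

Theorem theorem2p1 (R : realType) (d : R) (d_ge1 : 1 <= d)
    (d_le : d <= Num.sqrt 2) :
  let bound := (pi / (3 * d * Num.sqrt (3 - d ^+ 2)))%:E in
  [/\ forall (I : Type) (t : I -> 'rV[R]_3),
        packing [set: I] (fun i => translate (string d) (t i)) ->
        (density [set: I] (fun i => translate (string d) (t i)) <= bound)%E,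

      exists a b c e : 'rV[R]_3, tetrahedron d a b c e /\ vertical (b - a),

      forall a b c e : 'rV[R]_3,
        tetrahedron d a b c e -> vertical (b - a) ->
        let Gam := lattice_gen [tuple a; b; c; e] in
        [/\ packing Gam (fun x => cball x 1),
            density Gam (fun x => cball x 1) = bound &
            exists Lam : set 'rV[R]_3,
              [/\ lattice_packing d Lam, ball_centres d Lam = Gam &
                  density Lam (translate (string d)) = bound]],

      forall (u : 'rV[R]_3) (Gam : set 'rV[R]_3),
        (exists a b c e : 'rV[R]_3,
           [/\ tetrahedron d a b c e, b - a = u &
               Gam = lattice_gen [tuple a; b; c; e]]) <->
        (exists p0 p1 p2 p3 q : 'rV[R]_3,
           [/\ pyramid d p0 p1 p2 p3 q, p1 - p0 = u &
               Gam = lattice_gen [tuple p0; p1; p2; p3; q]]) &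

      forall (Lam : set 'rV[R]_3) (a b c e : 'rV[R]_3),
        lattice_packing d Lam ->
        density Lam (translate (string d)) = bound ->
        tetrahedron d a b c e -> vertical (b - a) ->
        congruent (ball_centres d Lam) (lattice_gen [tuple a; b; c; e])].
Proof.
move=> bound.
have d0 : 0 <= d by rewrite (le_trans _ d_ge1).
have d2 : d ^+ 2 <= 2.
  by rewrite -[leRHS](@sqr_sqrtr R 2) // lerXn2r ?nnegrE ?sqrtr_ge0.
have -> : bound = (density_bound d)%:E by [].
split.
- move=> I t pk; rewrite densityE strings_balls.
  exact/(string_set_density d_ge1 d2)/(packing_string_set pk).
- exact: tetra_exists.
- move=> a b c e /(tetrahedronP d_ge1)[fr T] vu Gam.
  have GamE : Gam = int_lattice a (b - a) (c - a) (e - a) by exact: lattice_gen4E.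
  split.
  + by rewrite GamE; exact: (tetra_packing d_ge1 d2).
  + rewrite GamE densityE; exact: (tetra_density d_ge1 d2).
  exists (int_lattice a 0 (c - a) (e - a)).
  have CE := ball_centres_zlat a T vu.
  split; first exact: (tetra_lattice_packing d_ge1 d2 a T vu fr).
    by rewrite GamE CE.
  by rewrite density_ball_centres CE; exact: (tetra_density d_ge1 d2).
- move=> u Gam; split.
    move=> [a [b [c [e [tet <- ->]]]]].
    have [pyr genE] := pyramid_of_tetra d_ge1 tet.
    by exists a, b, (b + (e - c)), (a + (e - c)), e; rewrite genE.
  move=> [p0 [p1 [p2 [p3 [q [pyr <- ->]]]]]].
  have [tet genE] := tetra_of_pyramid d_ge1 pyr.
  by exists p0, p1, (q - (p3 - p0)), q; rewrite genE.
move=> Lam a b c e pk dens /(tetrahedronP d_ge1)[_ T] _.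
rewrite lattice_gen4E; exact: (lattice_uniqueness d_ge1 d2).
Qed.
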